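(* Let $\mathcal K$ act on $\mathcal V$ via $\Psi:\mathcal K\to\mathcal S$ and the convolution action of $\mathcal S$ on $\mathcal V$. Then $\mathcal K$ and $\mathcal H_{\mathscr Y}$ form a double centralizer, i.e., $\mathrm{End}_{\mathcal K}(\mathcal V)\simeq\mathcal H_{\mathscr Y}$ if $n\ge d$, and $\mathcal K\to\mathrm{End}_{\mathcal H_{\mathscr Y}}(\mathcal V)$ is surjective.
   Context: Geometry. Let $d,n\ge1$, $D=2d$, $N=2n+1$, $\mathcal A=\mathbb Z[v,v^{-1}]$. $\mathbb F_q$ is a finite field of odd characteristic, $Q$ the symmetric bilinear form on $\mathbb F_q^D$ with matrix $\begin{pmatrix}0&I_d\\ I_d&0\end{pmatrix}$, $|W|=\dim W$, $G=\mathrm{SO}(D)$ the special orthogonal group of $Q$, $M_d$ a fixed maximal isotropic subspace. $\mathscr X$ is the set of flags $V=(0=V_0\subseteq V_1\subseteq\cdots\subseteq V_N=\mathbb F_q^D)$ with $V_i=V_{N-i}^\perp$; $\mathscr X=\mathscr X^1\sqcup\mathscr X^2\sqcup\mathscr X^3$ where $\mathscr X^1$: $|V_n|<d$; $\mathscr X^2$: $|V_n|=d$, $|V_n\cap M_d|\equiv d\bmod 2$; $\mathscr X^3$: $|V_n|=d$, $|V_n\cap M_d|\equiv d-1\bmod 2$. $\mathscr Y$ is the set of complete flags $F=(F_i)_{0\le i\le D}$ with $|F_i|=i$, $F_i\subset F_{i+1}$, $F_i=F_{D-i}^\perp$ and $|F_d\cap M_d|\equiv d\bmod2$. For $G$-sets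 $X,Y$ among these, $\mathcal A_G(X\times Y)$ denotes the $\mathcal A$-module of $\mathcal A$-valued functions on $X\times Y$ invariant under the diagonal $G$-action. Put $\mathcal S=\mathcal S_D=\mathcal A_G(\mathscr X\times\mathscr X)$, $\mathcal V=\mathcal A_G(\mathscr X\times\mathscr Y)$, $\mathcal H_{\mathscr Y}=\mathcal A_G(\mathscr Y\times\mathscr Y)$. Generic convolution (structure constants in $\mathcal A$ which at $v=\sqrt q$ give $f*g(x,z)=\sum_yf(x,y)g(y,z)$) makes $\mathcal S$ and $\mathcal H_{\mathscr Y}$ associative $\mathcal A$-algebras and $\mathcal V$ an $\mathcal S$-$\mathcal H_{\mathscr Y}$-bimodule. Signed matrices. For a matrix $A$: $\mathrm{ro}(A)_i=\sum_ja_{ij}$, $\mathrm{co}(A)_j=\sum_ia_{ij}$, $\mathrm{ur}(A)=\sum_{i\le n,\,j\ge n+1}a_{ij}$. $\Xi$ is the set of $N\times N$ matrices over $\mathbb N$ with total sum $D$ and $a_{ij}=a_{N+1-i,N+1-j}$. $\Xi_{\mathbf D}=\Xi_{\mathbf D}(D)$ consists of pairs $\mathfrak a=(A,\alpha)$: $A\in\Xi$ with $\mathrm{ro}(A)_{n+1}>0$ and $\mathrm{co}(A)_{n+1}>0$, $\alpha=0$; or any other $A\in\Xi$, $\alpha\in\{+,-\}$. $G$-orbits $\mathcal O_{\mathfrak a}$ on $\mathscr X\times\mathscr X$ are labelled by $\mathfrak a\in\Xi_{\mathbf D}$: the orbit of $(V,V')\in\mathscr X^i\times\mathscr X^j$ has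 label $(A,\mathrm{sgn}(i,j))$ with $a_{kl}=\dim\frac{V_{k-1}+V_k\cap V'_l}{V_{k-1}+V_k\cap V'_{l-1}}$, $\mathrm{sgn}(1,1)=0$, $\mathrm{sgn}=+$ for $(1,2),(2,1),(2,2),(2,3)$ and $-$ for $(1,3),(3,1),(3,3),(3,2)$. $e_{\mathfrak a}$ is the characteristic function of $\mathcal O_{\mathfrak a}$ and $[\mathfrak a]=v^{-d_{\mathfrak a}}e_{\mathfrak a}$ with $d_{\mathfrak a}=\frac12\big(\sum_{i\ge k,\,j<l}a_{ij}a_{kl}-\sum_{i\ge n+1>j}a_{ij}\big)$. For $\mathfrak a=(A,\alpha)$: $\mathrm{ro}(\mathfrak a)=\mathrm{ro}(A)$, $\mathrm{co}(\mathfrak a)=\mathrm{co}(A)$, $p(\mathfrak a)\in\{0,1\}$ is the parity of $\mathrm{ur}(A)$. $s_l(\mathfrak a)=1$ if $\mathrm{ro}(A)_{n+1}>0$, and otherwise $2$ if $\alpha=+$, $3$ if $\alpha=-$. $s_r(\mathfrak a)=1$ if $\mathrm{co}(A)_{n+1}>0$, and otherwise $2+p(\mathfrak a)\delta_{0,\mathrm{ro}(A)_{n+1}}$ if $\alpha=+$, $3-p(\mathfrak a)\delta_{0,\mathrm{ro}(A)_{n+1}}$ if $\alpha=-$. Stabilization. $I'=I-E_{n+1,n+1}$, ${}_p\mathfrak a=(A+2pI',\alpha)$. $\widetilde\Xi_{\mathbf D}$ is the set of $\mathfrak a=(A,\alpha)\in\mathrm{Mat}_{N\times N}(\mathbb Z)\times\{+,0,-\}$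 with ${}_p\mathfrak a\in\Xi_{\mathbf D}(D)$ for some $p\in\mathbb Z,D\in\mathbb N$. $\mathcal K$ is the free $\mathcal A$-module on formal symbols $[\mathfrak a]$, $\mathfrak a\in\widetilde\Xi_{\mathbf D}$, with the (non-unital) associative product: if $\mathrm{co}(\mathfrak a_i)=\mathrm{ro}(\mathfrak a_{i+1})$, $s_r(\mathfrak a_i)=s_l(\mathfrak a_{i+1})$ for all $i$, then in $\mathcal S_{D}$ (for the appropriate $D$ depending on $p$) one has $[{}_p\mathfrak a_1]*\cdots*[{}_p\mathfrak a_r]=\sum_jG_j(v,v^{-p})[{}_p\mathfrak z_j]$ for all large even $p$, with finitely many $\mathfrak z_j\in\widetilde\Xi_{\mathbf D}$ and $G_j(v,v')\in\mathbb Q(v)[v',v'^{-1}]$, and one sets $[\mathfrak a_1]\cdots[\mathfrak a_r]=\sum_jG_j(v,1)[\mathfrak z_j]$; $[\mathfrak a][\mathfrak b]=0$ if $\mathrm{co}(\mathfrak a)\ne\mathrm{ro}(\mathfrak b)$ or $s_r(\mathfrak a)\neq s_l(\mathfrak b)$. $\Psi:\mathcal K\to\mathcal S$ is the $\mathcal A$-linear map with $\Psi([\mathfrak a])=[\mathfrak a]$ if $\mathfrak a\in\Xi_{\mathbf D}(D)$ and $0$ otherwise; the paper shows it is an algebra homomorphism.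
   Formalization: Orbit labels are corrected: α=0 only if a_{n+1,n+1}>0 too; if a_{n+1,n+1}=0, sgn(1,1) is ± by the family of V_n+V_{n+1}∩V'_n. With the stated Ξ_D two SO(D)-orbits share a label for every d≥2 (e.g. orthogonal isotropic lines, d=2). *)

(* Defs.v *)
From HB Require Import structures.
From mathcomp Require Import all_boot all_order all_algebra all_field.
From mathcomp Require Import boolp classical_sets functions.
From mathcomp Require Import freeg.

Set Implicit Arguments.
Unset Strict Implicit.
Unset Printing Implicit Defensive.

Import Order.TTheory GRing.Theory Num.Theory.
Local Open Scope ring_scope.

(** * The ring of Laurent polynomials Z[v, v^-1], inside Q(v) *)

Definition Qv := {fraction {poly rat}}.

Definition vQ : Qv := FracField.tofrac ('X : {poly rat}).

Definition ZtoQv (p : {poly int}) : Qv := FracField.tofrac (map_poly intr p).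

Definition laurent_form (x : Qv) (kp : nat * {poly int}) : Prop :=
  x * vQ ^+ kp.1 = ZtoQv kp.2.

Definition laurent : {pred Qv} := fun x => `[< exists kp, laurent_form x kp >].

Lemma ZtoQvB : {morph ZtoQv : p q / p - q}.
Proof. by move=> p q; rewrite /ZtoQv !rmorphB. Qed.

Lemma ZtoQvM : {morph ZtoQv : p q / p * q}.
Proof. by move=> p q; rewrite /ZtoQv !rmorphM. Qed.

Lemma ZtoQv1 : ZtoQv 1 = 1.
Proof. by rewrite /ZtoQv !rmorph1. Qed.

Lemma ZtoQvXn k : ZtoQv 'X^k = vQ ^+ k.
Proof. by rewrite /ZtoQv map_polyXn rmorphXn. Qed.

Fact laurent_subring : subring_closed laurent.
Proof.
split.
- by apply/asboolP; exists (0, 1); rewrite /laurent_form expr0 mulr1 ZtoQv1.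
- move=> x y /asboolP[[k p] Hx] /asboolP[[l q] Hy]; apply/asboolP.
  rewrite /laurent_form /= in Hx Hy *.
  exists ((k + l)%N, p * 'X^l - q * 'X^k) => /=.
  by rewrite mulrBl exprD ZtoQvB !ZtoQvM -Hx -Hy !ZtoQvXn !mulrA (mulrAC y).
- move=> x y /asboolP[[k p] Hx] /asboolP[[l q] Hy]; apply/asboolP.
  rewrite /laurent_form /= in Hx Hy *.
  exists ((k + l)%N, p * q) => /=.
  by rewrite exprD ZtoQvM -Hx -Hy mulrACA.
Qed.

HB.instance Definition _ := GRing.isSubringClosed.Build Qv laurent laurent_subring.

Record Lau := MkLau { lau_val : Qv; lau_valP : lau_val \in laurent }.

HB.instance Definition _ := [isSub for lau_val].
HB.instance Definition _ := [Choice of Lau by <:].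
HB.instance Definition _ := [SubChoice_isSubComNzRing of Lau by <:].

Fact vQ_neq0 : vQ != 0.
Proof. by rewrite tofrac_eq0 polyX_eq0. Qed.

Fact vpow_laurent (z : int) : vQ ^ z \in laurent.
Proof.
apply/asboolP; case: z => k.
  by exists (0, 'X^k); rewrite /laurent_form /= mulr1 ZtoQvXn -exprnP.
exists (k.+1, 1); rewrite /laurent_form /= ZtoQv1 NegzE -exprnN mulVf //.
by rewrite expf_neq0 // vQ_neq0.
Qed.

Definition vpow (z : int) : Lau := MkLau (vpow_laurent z).

Fact laurentP (x : Lau) : exists kp, laurent_form (lau_val x) kp.
Proof. by apply/asboolP; case: x. Qed.

(* For t != 0 the value does not depend on the chosen pair (k, p). *)
Definition lau_ev (t : algC) (x : Lau) : algC :=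
  let: (k, p) := projT1 (cid (laurentP x)) in (map_poly intr p).[t] / t ^+ k.

(* The pair (k, g) stands for the element v'^-k * g(v') of Q(v)[v', v'^-1]. *)
Definition lau2_ev (G : nat * {poly Qv}) (t : Qv) : Qv := G.2.[t] / t ^+ G.1.

(** * Invariant functions and generic convolution *)

Section InvariantFunctions.
Variables (T : finType) (R : rel T).

Definition inv_fun : {pred {ffun T -> Lau^o}} :=
  fun f => [forall s, forall t, R s t ==> (f s == f t)].

Fact inv_fun_submod : submod_closed inv_fun.
Proof.
split.
  by apply/forallP => s; apply/forallP => t; rewrite !ffunE eqxx implybT.
move=> a f g /forallP Hf /forallP Hg; apply/forallP => s; apply/forallP => t.
apply/implyP => st; have /forallP/(_ t)/implyP/(_ st)/eqP Efs := Hf s.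
have /forallP/(_ t)/implyP/(_ st)/eqP Egs := Hg s.
by rewrite !ffunE Efs Egs.
Qed.

HB.instance Definition _ :=
  GRing.isSubmodClosed.Build Lau {ffun T -> Lau^o} inv_fun inv_fun_submod.

Record AG := MkAG { ag_val : {ffun T -> Lau^o}; ag_valP : ag_val \in inv_fun }.

HB.instance Definition _ := [isSub for ag_val].
HB.instance Definition _ := [Choice of AG by <:].
HB.instance Definition _ := [SubChoice_isSubLmodule of AG by <:].

(* The value of f on the points labelled a: it does not depend on the chosen
   point when the fibres of lab are orbits. *)
Definition val_at (L : eqType) (lab : T -> L) (f : AG) (a : L) : Lau :=
  if [pick t | lab t == a] is Some t then ag_val f t else 0.

(* u times the characteristic function of the points labelled a.  The default
   0 of insubd is not reached when lab is constant on orbits. *)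
Definition char_at (L : eqType) (lab : T -> L) (a : L) (u : Lau) : AG :=
  insubd 0 [ffun t => if lab t == a then u else 0].

End InvariantFunctions.

Arguments val_at {T R L}.
Arguments char_at {T R L}.

(* The product whose structure constant at (a, b, c) is k a b c, where a, b, c
   label the orbits on X * Y, Y * Z and X * Z: if f = \sum_a f_a e_a and
   g = \sum_b g_b e_b then (f * g)_c = \sum_(a, b) k a b c f_a g_b. *)
Definition gconv (X Y Z : finType) (R1 : rel (X * Y)) (R2 : rel (Y * Z))
    (R3 : rel (X * Z)) (L1 L2 L3 : eqType) (l1 : X * Y -> L1)
    (l2 : Y * Z -> L2) (l3 : X * Z -> L3) (k : L1 -> L2 -> L3 -> Lau)
    (f : AG R1) (g : AG R2) : AG R3 :=
  insubd 0
    [ffun xz => \sum_(a <- undup (codom l1)) \sum_(b <- undup (codom l2))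
                  k a b (l3 xz) * val_at l1 f a * val_at l2 g b].

Arguments gconv {X Y Z R1 R2 R3 L1 L2 L3}.

(* At v = sqrt q the structure constants k are those of
   (f * g)(x, z) = \sum_y f(x, y) g(y, z). *)
Definition conv_at (q : nat) (X Y Z : finType) (L1 L2 L3 : eqType)
    (l1 : X * Y -> L1) (l2 : Y * Z -> L2) (l3 : X * Z -> L3)
    (k : L1 -> L2 -> L3 -> Lau) : Prop :=
  forall (a : L1) (b : L2) (x : X) (z : Z),
    lau_ev (sqrtC q%:R) (k a b (l3 (x, z))) =
    #|[set y | (l1 (x, y) == a) && (l2 (y, z) == b)]|%:R.

(** * Flags; subspaces of F_q^D are row spaces, with D = d + d *)

Section Flags.
Variables (Fq : finFieldType) (d : nat).

Definition Qform : 'M[Fq]_(d + d) := block_mx 0 1%:M 1%:M 0.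

Definition perp (U : 'M[Fq]_(d + d)) : 'M[Fq]_(d + d) := kermx (Qform *m U^T).

Definition SO_mx (g : 'M[Fq]_(d + d)) : bool :=
  (g *m Qform *m g^T == Qform) && (\det g == 1).

(* The maximal isotropic subspaces are the isotropic subspaces of dimension d. *)
Definition max_isotropic (M : 'M[Fq]_(d + d)) : bool :=
  (M *m Qform *m M^T == 0) && (\rank M == d).

Definition preflag (m : nat) := {ffun 'I_m.+1 -> 'M[Fq]_(d + d)}.

(* The first condition picks the canonical matrix of each row space. *)
Definition is_flag (m : nat) (V : preflag m) : bool :=
  [&& [forall i, (<<V i>>)%MS == V i],
      \rank (V ord0) == 0%N, \rank (V ord_max) == (d + d)%N,
      [forall i : 'I_m, (V (inord i) <= V (inord i.+1))%MS]
    & [forall i, (V i == perp (V (rev_ord i)))%MS]].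

(* g acts by u |-> u *m g on row vectors. *)
Definition moves (m : nat) (g : 'M[Fq]_(d + d)) (V V' : preflag m) : bool :=
  [forall i, V' i == (<<V i *m g>>)%MS].

Definition same_orbit (m m' : nat) (s t : preflag m * preflag m') : bool :=
  [exists g, [&& SO_mx g, moves g s.1 t.1 & moves g s.2 t.2]].

(* The entry of index (k, l) is, with indices starting from 1,
   dim (V_(k-1) + V_k :&: V'_l) / (V_(k-1) + V_k :&: V'_(l-1)). *)
Definition relpos (m m' : nat) (V : preflag m) (V' : preflag m') :
    'M[int]_(m, m') :=
  \matrix_(k, l)
    ((\rank (V (inord k) + V (inord k.+1) :&: V' (inord l.+1))%MS)%:Z
     - (\rank (V (inord k) + V (inord k.+1) :&: V' (inord l))%MS)%:Z).

(* For U maximal isotropic: the SO-family of U contains M. *)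
Definition same_family (M U : 'M[Fq]_(d + d)) : bool :=
  odd (\rank (U :&: M)%MS) == odd d.

End Flags.

(** * Signed matrices; N = 2n + 1, indices are shifted to start from 0 *)

Section SignedMatrices.
Variable n : nat.
Local Notation N := (n.*2.+1).

Definition mid : 'I_N := inord n.

(* (A, None) is (A, 0), (A, Some true) is (A, +), (A, Some false) is (A, -). *)
Definition signed := ('M[int]_N * option bool)%type.

Definition ro (A : 'M[int]_N) : 'rV[int]_N := \row_i \sum_j A i j.
Definition co (A : 'M[int]_N) : 'rV[int]_N := \row_j \sum_i A i j.
Definition ur (A : 'M[int]_N) : int :=
  \sum_(i < N | (i < n)%N) \sum_(j < N | (n <= j)%N) A i j.

Definition Xi (d : nat) (A : 'M[int]_N) : bool :=
  [&& [forall i, forall j, 0 <= A i j],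
      \sum_i \sum_j A i j == (d + d)%:Z
    & [forall i, forall j, A i j == A (rev_ord i) (rev_ord j)]].

(* The sign is 0 exactly when both middle sums and the middle entry are
   positive.  If the middle sums are positive but the middle entry is 0, the
   pairs of flags of relative position A form two SO-orbits (see sgn_lab): for
   d = 2, two distinct orthogonal isotropic lines span a maximal isotropic
   plane of either family.  So these matrices carry a sign + or - too. *)
Definition XiD (d : nat) (a : signed) : bool :=
  Xi d a.1 &&
  ([&& 0 < ro a.1 0 mid, 0 < co a.1 0 mid & 0 < a.1 mid mid]
     == (a.2 == None)).

Definition par (a : signed) : nat := odd `|ur a.1|%N.

Definition s_l (a : signed) : nat :=
  if 0 < ro a.1 0 mid then 1%N
  else match a.2 with
       | Some true => 2%N | Some false => 3%N | None => 1%N end.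

Definition s_r (a : signed) : nat :=
  if 0 < co a.1 0 mid then 1%N
  else match a.2 with
       | Some true => (2 + par a * (ro a.1 0 mid == 0)%R)%N
       | Some false => (3 - par a * (ro a.1 0 mid == 0)%R)%N
       | None => 1%N end.

Definition composable (a b : signed) : bool :=
  (co a.1 == ro b.1) && (s_r a == s_l b).

(* The division by 2 is exact on Xi_D. *)
Definition d_of (a : signed) : int :=
  let A := a.1 in
  ((\sum_(i < N) \sum_(j < N) \sum_(k < N | (k <= i)%N)
      \sum_(l < N | (j < l)%N) A i j * A k l
    - \sum_(i < N | (n <= i)%N) \sum_(j < N | (j < n)%N) A i j) %/ 2)%Z.

Definition shift (p : int) (a : signed) : signed :=
  (a.1 + (2 * p) *: (1%:M - delta_mx mid mid), a.2).

Definition is_tXi (a : signed) : bool :=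
  `[< exists p d, XiD d (shift p a) >].

Record tXi := MkTXi { tXi_val : signed; tXi_valP : is_tXi tXi_val }.

HB.instance Definition _ := [isSub for tXi_val].
HB.instance Definition _ := [Choice of tXi by <:].

End SignedMatrices.

Section FlagVarieties.
Variables (n d : nat) (Fq : finFieldType) (M : 'M[Fq]_(d + d)).
Local Notation N := (n.*2.+1).
Local Notation D := (d + d)%N.

Definition is_complete (F : preflag Fq d D) : bool :=
  [forall i : 'I_D.+1, \rank (F i) == i] && same_family M (F (inord d)).

Definition Xflag := {V : preflag Fq d N | is_flag V}.
Definition Yflag := {F : preflag Fq d D | is_flag F && is_complete F}.

Definition component (V : Xflag) : nat :=
  let Vn := val V (inord n) in
  if (\rank Vn < d)%N then 1%N else if same_family M Vn then 2%N else 3%N.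

(* In the case (1, 1) with middle entry 0, the subspace
   V_n + V_(n+1) :&: V'_n is maximal isotropic. *)
Definition sgn_lab (V V' : Xflag) : option bool :=
  match component V, component V' with
  | 1, 1 =>
      if (0 < relpos (val V) (val V') (mid n) (mid n))%R then None
      else Some (same_family M
                   (val V (inord n) +
                    val V (inord n.+1) :&: val V' (inord n))%MS)
  | 1, 2 | 2, 1 | 2, 2 | 2, 3 => Some true
  | _, _ => Some false
  end%N.

Definition labXX (p : Xflag * Xflag) : signed n :=
  (relpos (val p.1) (val p.2), sgn_lab p.1 p.2).
(* SO-orbits on X * Y and Y * Y are determined by the relative position. *)
Definition labXY (p : Xflag * Yflag) : 'M[int]_(N, D) :=
  relpos (val p.1) (val p.2).
Definition labYY (p : Yflag * Yflag) : 'M[int]_D :=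
  relpos (val p.1) (val p.2).

Definition orbXX : rel (Xflag * Xflag) :=
  fun s t => same_orbit (val s.1, val s.2) (val t.1, val t.2).
Definition orbXY : rel (Xflag * Yflag) :=
  fun s t => same_orbit (val s.1, val s.2) (val t.1, val t.2).
Definition orbYY : rel (Yflag * Yflag) :=
  fun s t => same_orbit (val s.1, val s.2) (val t.1, val t.2).

Definition Smod : lmodType Lau := AG orbXX.
Definition Vmod : lmodType Lau := AG orbXY.
Definition Hmod : lmodType Lau := AG orbYY.

End FlagVarieties.

(* Structure constants in Z[v, v^-1], common to all finite fields of odd
   characteristic and all choices of the maximal isotropic subspace.  Their
   values at triples of labels that label no orbits do not enter gconv. *)
Record generic_convolution (n d : nat) := GenericConvolution {
  cS : signed n -> signed n -> signed n -> Lau;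
  cSV : signed n -> 'M[int]_(n.*2.+1, d + d) -> 'M[int]_(n.*2.+1, d + d) -> Lau;
  cVH : 'M[int]_(n.*2.+1, d + d) -> 'M[int]_(d + d) ->
        'M[int]_(n.*2.+1, d + d) -> Lau;
  cH : 'M[int]_(d + d) -> 'M[int]_(d + d) -> 'M[int]_(d + d) -> Lau;
  conv_atP : forall (Fq : finFieldType) (M : 'M[Fq]_(d + d)),
    2%N \notin [pchar Fq] -> max_isotropic M ->
    let XX := @labXX n d Fq M in let XY := @labXY n d Fq M in
    let YY := @labYY d Fq M in
    [/\ conv_at #|Fq| XX XX XX cS, conv_at #|Fq| XX XY XY cSV,
        conv_at #|Fq| XY YY XY cVH & conv_at #|Fq| YY YY YY cH]
}.

Arguments Vmod n {d Fq} M.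
Arguments Hmod {d Fq} M.
Arguments labXX n {d Fq} M.
Arguments labXY n {d Fq} M.
Arguments labYY {d Fq} M.

Section Convolution.
Variables (n d : nat) (Fq : finFieldType) (M : 'M[Fq]_(d + d)).
Variable C : generic_convolution n d.

Definition mulS : Smod n d Fq -> Smod n d Fq -> Smod n d Fq :=
  gconv (labXX n M) (labXX n M) (labXX n M) (cS C).
Definition actS : Smod n d Fq -> Vmod n M -> Vmod n M :=
  gconv (labXX n M) (labXY n M) (labXY n M) (cSV C).
Definition actH : Vmod n M -> Hmod M -> Vmod n M :=
  gconv (labXY n M) (labYY M) (labXY n M) (cVH C).
Definition mulH : Hmod M -> Hmod M -> Hmod M :=
  gconv (labYY M) (labYY M) (labYY M) (cH C).

End Convolution.

Arguments mulS {n d Fq} M C.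
Arguments actS {n d Fq} M C.
Arguments actH {n d Fq} M C.
Arguments mulH {n d Fq} M C.

Definition brS (n d : nat) (Fq : finFieldType) (M : 'M[Fq]_(d + d))
    (a : signed n) : Smod n d Fq :=
  char_at (labXX n M) a (vpow (- d_of a)).

(** * The stabilized algebra K *)

Record nu_algebra := NUAlgebra {
  carrier :> lmodType Lau;
  nu_mul : carrier -> carrier -> carrier
}.

Section Stabilization.
Variables (n : nat) (Fq : finFieldType).
Variables (M : forall d, 'M[Fq]_(d + d)) (C : forall d, generic_convolution n d).

Definition Kmod := {freeg (tXi n) / Lau}.

Definition brK (a : tXi n) : Kmod := << a >>.

(* [a] * \prod_(b <- s) [b] is obtained by letting v' = 1 in the expansion of
   [_p a] * \prod_(b <- s) [_p b], where v' = v^-p for all large even p; the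
   expansion is the list t of the pairs (z_j, G_j). *)
Definition stable_product (m : Kmod -> Kmod -> Kmod) (a : tXi n)
    (s : seq (tXi n)) : Prop :=
  exists t : seq (tXi n * (nat * {poly Qv})),
    let expansion (L : lmodType Lau) (br : tXi n -> L) (v' : Qv) (x : L) :=
      all (fun zG => lau2_ev zG.2 v' \in laurent) t /\
      x = \sum_(zG <- t) (insubd 0 (lau2_ev zG.2 v') : Lau) *: br zG.1 in
    [/\ uniq (unzip1 t),
        exists p0 : nat, forall p d : nat,
          (p0 <= p)%N -> ~~ odd p ->
          all (fun b => XiD d (shift p%:Z (tXi_val b))) (a :: s) ->
          all (fun zG => XiD d (shift p%:Z (tXi_val zG.1))) t /\
          let br b := brS (M d) (shift p%:Z (tXi_val b)) in
          expansion (Smod n d Fq) br (vQ ^- p)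
            (foldl (mulS (M d) (C d)) (br a) (map br s))
      & expansion Kmod brK 1 (foldl m (brK a) (map brK s))].

Definition is_stabilized (m : Kmod -> Kmod -> Kmod) : Prop :=
  [/\ forall c x y z, m (c *: x + y) z = c *: m x z + m y z,
      forall c x y z, m x (c *: y + z) = c *: m x y + m x z,
      forall a b : tXi n, ~~ composable (tXi_val a) (tXi_val b) ->
        m (brK a) (brK b) = 0
    & forall (a : tXi n) (s : seq (tXi n)),
        path (fun b c => composable (tXi_val b) (tXi_val c)) a s ->
        stable_product m a s].

(* The product of K is the bilinear map characterized by is_stabilized. *)
Definition mulK : Kmod -> Kmod -> Kmod :=
  if pselect (exists m, is_stabilized m) is left h then projT1 (cid h)
  else fun _ _ => 0.

Definition Kalg : nu_algebra := NUAlgebra mulK.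

Definition Halg (d : nat) : nu_algebra := NUAlgebra (mulH (M d) (C d)).

Definition Psi (d : nat) : Kalg -> Smod n d Fq :=
  fglift (fun a : tXi n =>
            if XiD d (tXi_val a) then brS (M d) (tXi_val a) else 0).

Definition actK (d : nat) (k : Kalg) (x : Vmod n (M d)) : Vmod n (M d) :=
  actS (M d) (C d) (Psi d k) x.

Definition ractH (d : nat) (h : Halg d) (x : Vmod n (M d)) : Vmod n (M d) :=
  actH (M d) (C d) x h.

End Stabilization.

(* The Z[v, v^-1]-linear endomorphisms of L commuting with the operators
   act b, for b in B. *)
Definition End_alg (B : nu_algebra) (L : lmodType Lau) (act : B -> L -> L) :
    set (L -> L) :=
  [set phi | linear phi /\ forall b x, phi (act b x) = act b (phi x)]%classic.

(* Main.v *)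
(** Every identity between structure constants is checked by counting over the
    prime fields F_p, since a Laurent polynomial is determined by its values at
    the square roots of the odd primes.  The counts only involve labels that are
    realized by pairs of coordinate flags, i.e. by maps c from the standard
    hyperbolic basis to {0, ..., N - 1} compatible with duality, and these do not
    depend on the field: any two self-dual chains of subspaces have a common
    hyperbolic basis (Bruhat decomposition), and equality of labels means that two
    pairs are conjugate under SO.  Conjugacy under the full orthogonal group comes
    from a signed permutation; the determinant of an isometry g is
    (-1)^(d - dim (U :&: U g)) for U maximal isotropic, so the families of maximal
    isotropic subspaces control the passage to SO.

    For an SO-orbit of flags V there is a label b such that (V, F) has label b for
    exactly one V = pi F, given F; let x_b in the module V be the characteristic
    function of b.
    - Every characteristic function e_o, o the label of (V, F), is x_b * e_h with
      h the label of (F', F), where F' is the refinement of V by F: F' is fixed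
      by the stabilizer of V and F.
    - If phi commutes with H, then z = phi x_b satisfies z * 1_b = N z with
      1_b the characteristic function of the pairs with pi F = pi F' and N != 0.
      So z (V, F) only depends on (V, pi F), i.e. z = s * x_b with s in S; hence
      phi is the action of an element of S, and S is the image of Psi.
    - If n >= d there is such a b with pi injective, and then x_b generates the
      module V over S, while h |-> x_b * h is injective with image the functions
      supported on the pairs (pi F', F). *)

Require Import Defs.
From mathcomp Require Import all_boot all_order all_algebra.
From mathcomp Require Import boolp classical_sets functions.
From mathcomp Require Import all_field fingroup perm ring zify freeg.

Set Implicit Arguments.
Unset Strict Implicit.
Unset Printing Implicit Defensive.

Import Order.TTheory GRing.Theory Num.Theory.
Local Open Scope ring_scope.

(** * Specialization of Laurent polynomials *)

(** Two obstacles shape the proof. Even over the given field the product of invariant functions is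
    formal in v, so it is not the convolution of functions on flags, and the structure constants are
    known only through counts at labels that occur. Hence the argument is written for an abstract
    [model], used twice: over all prime fields to prove identities between constants, over the given
    field to translate functions into functions of labels. The factor N is not invertible in
    Z[v, v^-1]; it is only cancelled. The second obstacle is special to type D. Sorting a hyperbolic
    basis by V and then by F can give a complete flag whose middle term lies in the wrong family,
    hence outside Y. Its middle term is then exchanged for the other maximal isotropic subspace
    containing the term of dimension d - 1, and V need no longer consist of terms of F'. So pi is
    allowed to return that other subspace as well. It is still a function of F, since exactly two
    maximal isotropic subspaces contain F_(d-1), one in each family; this is how the third component
    of X is reached. *)

Lemma ZtoQv_inj : injective ZtoQv.
Proof.
move=> p q /eqP; rewrite /ZtoQv tofrac_eq => /eqP.
by apply: map_inj_poly => [x y /eqP|]; rewrite ?eqr_int // => /eqP.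
Qed.

(** Two representations x v^k = p and x v^l = q give p X^l = q X^k, so the two quotients agree at
    every nonzero t. *)
Lemma laurent_form_evE (t : algC) (x : Lau) k (p : {poly int}) : t != 0 ->
  laurent_form (lau_val x) (k, p) ->
  lau_ev t x = (map_poly intr p).[t] / t ^+ k.
Proof.
move=> t0 Hp; rewrite /lau_ev; case: (cid _) => -[l q] /= Hq.
rewrite /laurent_form /= in Hp Hq.
have E : p * 'X^l = q * 'X^k.
  by apply: ZtoQv_inj; rewrite !ZtoQvM !ZtoQvXn -Hp -Hq mulrAC.
have /(congr1 (fun r : {poly int} => (map_poly intr r : {poly algC}).[t])) := E.
rewrite !rmorphM /= !map_polyXn !hornerM !hornerXn => Et.
by apply/eqP; rewrite eqr_div ?expf_neq0 // -Et.
Qed.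

Section Evaluation.
Variables (t : algC) (t0 : t != 0).

Lemma lau_evB : {morph lau_ev t : x y / x - y}.
Proof.
move=> x y; have [[k p] Hp] := laurentP x; have [[l q] Hq] := laurentP y.
rewrite (laurent_form_evE t0 Hp) (laurent_form_evE t0 Hq).
have H : laurent_form (lau_val (x - y)) ((k + l)%N, p * 'X^l - q * 'X^k).
  rewrite /laurent_form /= in Hp Hq *.
  by rewrite mulrBl exprD ZtoQvB !ZtoQvM -Hp -Hq !ZtoQvXn !mulrA (mulrAC (lau_val y)).
rewrite (laurent_form_evE t0 H) rmorphB !rmorphM /= !map_polyXn.
rewrite hornerD hornerN !hornerM !hornerXn mulrBl exprD invfM.
have tk := expf_neq0 k t0; have tl := expf_neq0 l t0.
by congr (_ - _); rewrite mulrA ?mulfK // mulrAC mulfK.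
Qed.

Lemma lau_evM : {morph lau_ev t : x y / x * y}.
Proof.
move=> x y; have [[k p] Hp] := laurentP x; have [[l q] Hq] := laurentP y.
rewrite (laurent_form_evE t0 Hp) (laurent_form_evE t0 Hq).
have H : laurent_form (lau_val (x * y)) ((k + l)%N, p * q).
  rewrite /laurent_form /= in Hp Hq *.
  by rewrite exprD ZtoQvM -Hp -Hq mulrACA.
by rewrite (laurent_form_evE t0 H) rmorphM /= hornerM exprD invfM mulrACA.
Qed.

Lemma lau_ev0 : lau_ev t 0 = 0.
Proof. by rewrite -(subrr 0) lau_evB subrr. Qed.

Lemma lau_evD : {morph lau_ev t : x y / x + y}.
Proof.
by move=> x y; have := lau_evB x (0 - y); rewrite (lau_evB 0 y) lau_ev0 !sub0r !opprK.
Qed.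

Lemma lau_ev1 : lau_ev t 1 = 1.
Proof.
have H : laurent_form (lau_val 1) (0%N, 1) by rewrite /laurent_form /= mulr1 ZtoQv1.
by rewrite (laurent_form_evE t0 H) rmorph1 hornerC expr0 divr1.
Qed.

Lemma lau_ev_nat k : lau_ev t k%:R = k%:R.
Proof.
by elim: k => [|k IH]; rewrite ?mulr0n ?lau_ev0 // !mulrS lau_evD lau_ev1 IH.
Qed.

Lemma lau_ev_sum (I : Type) (r : seq I) (P : pred I) (F : I -> Lau) :
  lau_ev t (\sum_(i <- r | P i) F i) = \sum_(i <- r | P i) lau_ev t (F i).
Proof. by apply: (big_morph _ lau_evD lau_ev0). Qed.

End Evaluation.

Lemma sqrtC_nat_neq0 p : prime p -> sqrtC p%:R != 0 :> algC.
Proof. by move=> pp; rewrite sqrtC_eq0 pnatr_eq0 -lt0n prime_gt0. Qed.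

Lemma lau_eqP (x y : Lau) :
  (forall p, prime p -> odd p ->
     lau_ev (sqrtC p%:R) x = lau_ev (sqrtC p%:R) y) -> x = y.
Proof.
move=> H; apply/eqP; rewrite -subr_eq0; apply/eqP.
have {}H p : prime p -> odd p -> lau_ev (sqrtC p%:R) (x - y) = 0.
  by move=> pp op; rewrite lau_evB ?sqrtC_nat_neq0 // H // subrr.
move: (x - y) H => {x y} x H.
have [[k P] HP] := laurentP x.
suff P0 : P = 0.
  apply: val_inj; rewrite /=; move: HP; rewrite /laurent_form /= P0.
  rewrite /ZtoQv rmorph0 rmorph0 => /eqP.
  by rewrite mulf_eq0 expf_eq0 (negPf vQ_neq0) andbF orbF => /eqP.
suff P0 : map_poly intr P = 0 :> {poly algC}.
  apply/polyP => i; have /(congr1 (fun r : {poly algC} => r`_i)) := P0.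
  by rewrite coef_map !coef0 => /eqP; rewrite intr_eq0 => /eqP.
apply/eqP/negPn/negP => nz.
(* The square roots of the odd primes are infinitely many roots of the numerator. *)
have [s [us sz sp]] : exists s : seq nat,
    [/\ uniq s, size s = size (map_poly intr P : {poly algC})
      & all (fun p => prime p && odd p) s].
  elim: (size _) => [|m [s [us sz sp]]]; first by exists [::].
  (* The summand 2 makes p odd, the maximum keeps p out of [s]. *)
  have [p pb pp] := prime_above (2 + \max_(q <- s) q).
  exists (p :: s); split; rewrite /= ?sz ?sp ?us ?andbT ?pp //=.
    apply/negP => ps; have := leq_bigmax_seq (F := id) _ ps isT.
    by rewrite leqNgt (leq_ltn_trans _ pb) // leq_addl.
  by case: (even_prime pp) => // p2; rewrite p2 in pb.
suff : (size [seq sqrtC (p%:R : algC) | p <- s] < size (map_poly intr P : {poly algC}))%N.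
  by rewrite size_map sz ltnn.
apply: max_poly_roots => //.
  apply/allP => _ /mapP[p ps ->].
  have /andP[pp op] := allP sp _ ps.
  have := H p pp op; rewrite (laurent_form_evE (sqrtC_nat_neq0 pp) HP) => /eqP.
  by rewrite mulf_eq0 invr_eq0 expf_eq0 (negPf (sqrtC_nat_neq0 pp)) andbF orbF.
rewrite map_inj_uniq // => a b /(congr1 (fun z : algC => z ^+ 2)).
by rewrite !sqrtCK => /eqP; rewrite eqr_nat => /eqP.
Qed.

(** * Generic convolution on labelled orbits *)

(** Cancellation is inherited from the field Q(v); [Lau] itself carries only a ring structure. *)
Lemma lau_mulfI (c : Lau) : c != 0 -> injective ( *%R c).
Proof.
move=> c0 x y /(congr1 lau_val) /= E; apply/val_inj/(mulfI _ E) => /=.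
by apply: contra_neq c0 => c0; apply: val_inj.
Qed.

Lemma sum_delta (L : eqType) (S : pzRingType) (A : seq L) (F : L -> S) a :
  uniq A -> a \in A -> \sum_(e <- A) (e == a)%:R * F e = F a.
Proof.
move=> uA aA; rewrite (bigD1_seq a) //= eqxx mul1r big1 ?addr0 // => e /negPf->.
by rewrite mul0r.
Qed.

Lemma natr_card (T : finType) (S : pzSemiRingType) (P : pred T) :
  #|[set y | P y]|%:R = \sum_y (P y)%:R :> S.
Proof.
rewrite cardsE -sum1_card natr_sum big_mkcond; apply: eq_bigr => y _.
by rewrite unfold_in; case: (P y).
Qed.

Section LabelledOrbits.
Variables (T : finType) (R : rel T) (L : eqType) (l : T -> L).
Hypothesis RE : forall s t, R s t = (l s == l t).

Definition of_labels (u : L -> Lau) : AG R := insubd 0 [ffun t => u (l t) : Lau^o].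

Lemma of_labelsE u : ag_val (of_labels u) = [ffun t => u (l t)].
Proof.
rewrite -[ag_val _]/(val _) val_insubd; case: ifP => // /negP[].
apply/forallP => s; apply/forallP => t; apply/implyP; rewrite RE => /eqP E.
by rewrite !ffunE E.
Qed.

Lemma val_atE (f : AG R) t : val_at l f (l t) = ag_val f t.
Proof.
rewrite /val_at; case: pickP => [s /eqP E|/(_ t)]; last by rewrite eqxx.
have /forallP/(_ s)/forallP/(_ t)/implyP := ag_valP f.
by rewrite RE E eqxx => /(_ isT)/eqP.
Qed.

Lemma val_at_of_labels u t : val_at l (of_labels u) (l t) = u (l t).
Proof. by rewrite val_atE of_labelsE ffunE. Qed.

Lemma val_at_ext (f g : AG R) :
  (forall t, val_at l f (l t) = val_at l g (l t)) -> f = g.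
Proof. by move=> E; apply/val_inj/ffunP => t; move: (E t); rewrite !val_atE. Qed.

Lemma val_at_lin c (f g : AG R) a :
  val_at l (c *: f + g) a = c * val_at l f a + val_at l g a.
Proof.
rewrite /val_at; case: pickP => [t _|_]; last by rewrite mulr0 addr0.
by rewrite -[ag_val _]/(val _) linearP /= !ffunE.
Qed.

Lemma val_at0 a : val_at l (0 : AG R) a = 0.
Proof. by rewrite /val_at; case: pickP => // t _; rewrite ffunE. Qed.

Lemma val_at_sum (I : Type) (r : seq I) (F : I -> AG R) a :
  val_at l (\sum_(i <- r) F i) a = \sum_(i <- r) val_at l (F i) a.
Proof.
elim: r => [|i r IH]; first by rewrite !big_nil val_at0.
by rewrite !big_cons -[F i]scale1r val_at_lin IH mul1r scale1r.
Qed.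

Lemma val_atZ c (f : AG R) a : val_at l (c *: f) a = c * val_at l f a.
Proof. by rewrite -[c *: f]addr0 val_at_lin val_at0 addr0. Qed.

Lemma of_labels_decomp (A : seq L) (f : AG R) :
    uniq A -> (forall t, l t \in A) ->
  f = \sum_(a <- A) val_at l f a *: of_labels (fun o => (o == a)%:R).
Proof.
move=> uA lA; apply: val_at_ext => t; rewrite val_at_sum.
under eq_bigr => a _ do
  rewrite val_atZ val_at_of_labels mulrC [l t == a]eq_sym.
by rewrite sum_delta.
Qed.

End LabelledOrbits.

Section GenericConvolution.
Variables (X Y Z : finType) (R1 : rel (X * Y)) (R2 : rel (Y * Z)) (R3 : rel (X * Z)).
Variables (L1 L2 L3 : eqType) (l1 : X * Y -> L1) (l2 : Y * Z -> L2) (l3 : X * Z -> L3).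
Variable k : L1 -> L2 -> L3 -> Lau.
Hypothesis RE3 : forall s t, R3 s t = (l3 s == l3 t).
Variables (A : seq L1) (B : seq L2).
Hypotheses (uA : uniq A) (uB : uniq B).
Hypotheses (mA : codom l1 =i A) (mB : codom l2 =i B).

(** Trades the label lists [codom l1] and [codom l2], which come from one field, for lists [A] and
    [B] that can be shared by all fields. *)
Lemma val_at_gconv (f : AG R1) (g : AG R2) t :
  val_at l3 (gconv l1 l2 l3 k f g : AG R3) (l3 t) =
  \sum_(a <- A) \sum_(b <- B) k a b (l3 t) * val_at l1 f a * val_at l2 g b.
Proof.
pose u c := \sum_(a <- undup (codom l1)) \sum_(b <- undup (codom l2))
   k a b c * val_at l1 f a * val_at l2 g b.
rewrite -[gconv _ _ _ _ _ _]/(of_labels R3 l3 u) (val_at_of_labels RE3) /u.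
have pA : perm_eq (undup (codom l1)) A.
  by apply: uniq_perm; rewrite ?undup_uniq // => a; rewrite mem_undup mA.
have pB : perm_eq (undup (codom l2)) B.
  by apply: uniq_perm; rewrite ?undup_uniq // => a; rewrite mem_undup mB.
by rewrite (perm_big _ pA) /=; apply: eq_bigr => a _; rewrite (perm_big _ pB).
Qed.

Lemma gconv_linl c f f' g :
  gconv l1 l2 l3 k (c *: f + f' : AG R1) (g : AG R2) =
  c *: gconv l1 l2 l3 k f g + gconv l1 l2 l3 k f' g :> AG R3.
Proof.
apply: (val_at_ext RE3) => t.
rewrite [RHS]val_at_lin; apply: etrans (val_at_gconv _ g t) _.
apply: etrans _ (esym (congr2 (fun u v => c * u + v) (val_at_gconv f g t)
  (val_at_gconv f' g t))).
rewrite mulr_sumr -big_split; apply: eq_bigr => a _ /=.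
rewrite mulr_sumr -big_split; apply: eq_bigr => b _ /=.
by rewrite val_at_lin mulrDr mulrDl; congr (_ + _); rewrite mulrCA !mulrA.
Qed.

Lemma gconv_linr c f g g' :
  gconv l1 l2 l3 k (f : AG R1) (c *: g + g' : AG R2) =
  c *: gconv l1 l2 l3 k f g + gconv l1 l2 l3 k f g' :> AG R3.
Proof.
apply: (val_at_ext RE3) => t.
rewrite [RHS]val_at_lin; apply: etrans (val_at_gconv f _ t) _.
apply: etrans _ (esym (congr2 (fun u v => c * u + v) (val_at_gconv f g t)
  (val_at_gconv f g' t))).
rewrite mulr_sumr -big_split; apply: eq_bigr => a _ /=.
rewrite mulr_sumr -big_split; apply: eq_bigr => b _ /=.
by rewrite val_at_lin mulrDr; congr (_ + _); rewrite mulrCA.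
Qed.

End GenericConvolution.

Section Associativity.
Variables (X Y Z W : finType) (L12 L23 L34 L13 L24 L14 : eqType).
Variables (l12 : X * Y -> L12) (l23 : Y * Z -> L23) (l34 : Z * W -> L34).
Variables (l13 : X * Z -> L13) (l24 : Y * W -> L24) (l14 : X * W -> L14).
Variables (k1 : L12 -> L23 -> L13 -> Lau) (k2 : L13 -> L34 -> L14 -> Lau).
Variables (k3 : L23 -> L34 -> L24 -> Lau) (k4 : L12 -> L24 -> L14 -> Lau).
Variables (A13 : seq L13) (A24 : seq L24) (q : nat).
Hypotheses (u13 : uniq A13) (u24 : uniq A24).
Hypotheses (m13 : codom l13 =i A13) (m24 : codom l24 =i A24).
Hypotheses (q0 : sqrtC q%:R != 0 :> algC).
Hypotheses (H1 : conv_at q l12 l23 l13 k1) (H2 : conv_at q l13 l34 l14 k2).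
Hypotheses (H3 : conv_at q l23 l34 l24 k3) (H4 : conv_at q l12 l24 l14 k4).

(** Both sides count the pairs (y, z) such that (x, y), (y, z) and (z, w) have labels a, b and c:
    for given z, respectively y, the sum over e keeps only the label of (x, z), respectively (y,
    w). *)
Lemma conv_at_assoc a b c x w :
  lau_ev (sqrtC q%:R) (\sum_(e <- A13) k1 a b e * k2 e c (l14 (x, w))) =
  lau_ev (sqrtC q%:R) (\sum_(e <- A24) k3 b c e * k4 a e (l14 (x, w))).
Proof.
rewrite !lau_ev_sum //; set t := sqrtC _.
transitivity (\sum_z (l34 (z, w) == c)%:R * lau_ev t (k1 a b (l13 (x, z)))).
  under eq_bigr => e _ do rewrite lau_evM // H2 natr_card mulr_sumr.
  rewrite exchange_big /=; apply: eq_bigr => z _.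
  rewrite -(sum_delta (fun e => (l34 (z, w) == c)%:R * lau_ev t (k1 a b e)) u13);
    last by rewrite -m13 codom_f.
  by apply: eq_bigr => e _; rewrite -mulnb natrM [e == _]eq_sym mulrC -mulrA.
transitivity (\sum_y (l12 (x, y) == a)%:R * lau_ev t (k3 b c (l24 (y, w)))); last first.
  under [RHS]eq_bigr => e _ do rewrite lau_evM // H4 natr_card mulr_sumr.
  rewrite exchange_big /=; apply: eq_bigr => y _.
  rewrite -(sum_delta (fun e => (l12 (x, y) == a)%:R * lau_ev t (k3 b c e)) u24);
    last by rewrite -m24 codom_f.
  by apply: eq_bigr => e _; rewrite -mulnb natrM [e == _]eq_sym mulrC -mulrA mulrCA.
under eq_bigr => z _ do rewrite H1 natr_card mulr_sumr.
under [RHS]eq_bigr => y _ do rewrite H3 natr_card mulr_sumr.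
rewrite exchange_big /=; apply: eq_bigr => y _; apply: eq_bigr => z _.
by rewrite -!mulnb !natrM mulrC -mulrA.
Qed.

End Associativity.

(** * Double centralizers from models over all prime fields *)

Section Models.
Variables (L1 L2 L3 : eqType) (CX CY : finType) (K : Type).
Variables (cXX : CX * CX -> L1) (cXY : CX * CY -> L2) (cYY : CY * CY -> L3).
Variables (pi : K -> CY -> CX) (rlabel : K -> L2).
Variables (refk : CX -> CY -> K) (refy : CX -> CY -> CY) (faithful : K -> Prop).

(* A group acts on X and Y so that the labels separate the orbits on pairs, and
   the labels are those of the pairs of points realized by CX and CY, which are
   common to all models.  A pair of label rlabel m is (x, y) with x determined
   by y; for faithful m it is also the other way round. *)
Record model (X Y : finType) (lXX : X * X -> L1) (lXY : X * Y -> L2)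
    (lYY : Y * Y -> L3) := Model {
  mG : Type;
  aX : mG -> X -> X;
  aY : mG -> Y -> Y;
  rX : CX -> X;
  rY : CY -> Y;
  aY_inj : forall g, injective (aY g);
  lXX_inv : forall g x x', lXX (aX g x, aX g x') = lXX (x, x');
  lXY_inv : forall g x y, lXY (aX g x, aY g y) = lXY (x, y);
  lYY_inv : forall g y y', lYY (aY g y, aY g y') = lYY (y, y');
  lXX_sep : forall x1 x1' x2 x2', lXX (x1, x1') = lXX (x2, x2') ->
    exists g, aX g x1 = x2 /\ aX g x1' = x2';
  lXY_sep : forall x1 y1 x2 y2, lXY (x1, y1) = lXY (x2, y2) ->
    exists g, aX g x1 = x2 /\ aY g y1 = y2;
  lYY_sep : forall y1 y1' y2 y2', lYY (y1, y1') = lYY (y2, y2') ->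
    exists g, aY g y1 = y2 /\ aY g y1' = y2';
  rXX : forall c c', lXX (rX c, rX c') = cXX (c, c');
  rXY : forall c f, lXY (rX c, rY f) = cXY (c, f);
  rYY : forall f f', lYY (rY f, rY f') = cYY (f, f');
  cXX_surj : forall x x', exists c c', lXX (x, x') = cXX (c, c');
  cXY_surj : forall x y, exists c f, lXY (x, y) = cXY (c, f);
  cYY_surj : forall y y', exists f f', lYY (y, y') = cYY (f, f');
  rigid : forall m x x' y, lXY (x, y) = rlabel m -> lXY (x', y) = rlabel m -> x = x';
  rigid_label : forall m m' x y y',
    lXY (x, y) = rlabel m -> lXY (x, y') = rlabel m' -> m = m';
  rigid_faithful : forall m x y y', faithful m ->
    lXY (x, y) = rlabel m -> lXY (x, y') = rlabel m -> y = y';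
  ref_fixed : forall c f g h, aX g (rX c) = aX h (rX c) ->
    aY g (rY f) = aY h (rY f) -> aY g (rY (refy c f)) = aY h (rY (refy c f))
}.

Arguments aX {X Y lXX lXY lYY} _ _ _.
Arguments aY {X Y lXX lXY lYY} _ _ _.

Variables (kSV : L1 -> L2 -> L2 -> Lau) (kVH : L2 -> L3 -> L2 -> Lau).
Variable kH : L3 -> L3 -> L3 -> Lau.

Hypothesis cXY_pi : forall m f, cXY (pi m f, f) = rlabel m.
Hypothesis pi_ref : forall c f, pi (refk c f) (refy c f) = c.

(** The flag types vary with q and are therefore fields of the record, while the labels and the
    constants [kSV], [kVH], [kH] are parameters common to all q. *)
Record generic_model (q : nat) := GenericModel {
  gX : finType; gY : finType;
  gXX : gX * gX -> L1; gXY : gX * gY -> L2; gYY : gY * gY -> L3;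
  gmodel :> model gXX gXY gYY;
  gSV : conv_at q gXX gXY gXY kSV;
  gVH : conv_at q gXY gYY gXY kVH;
  gH : conv_at q gYY gYY gYY kH
}.

Arguments gSV {q} _.
Arguments gVH {q} _.
Arguments gH {q} _.

Hypothesis models : forall p, prime p -> odd p -> inhabited (generic_model p).

Definition A1 := undup (codom cXX).
Definition A2 := undup (codom cXY).
Definition A3 := undup (codom cYY).

Section ModelFacts.
Variables (X Y : finType) (lXX : X * X -> L1) (lXY : X * Y -> L2).
Variables (lYY : Y * Y -> L3) (Mo : model lXX lXY lYY).
Local Notation rX := (rX Mo). Local Notation rY := (rY Mo).
Local Notation aX := (aX Mo). Local Notation aY := (aY Mo).

Lemma mem_A1 : codom lXX =i A1.
Proof.
move=> a; rewrite mem_undup; apply/codomP/codomP => [[[x x'] ->]|[[c c'] ->]].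
  by have [c [c' ->]] := cXX_surj Mo x x'; exists (c, c').
by exists (rX c, rX c'); rewrite rXX.
Qed.

Lemma mem_A2 : codom lXY =i A2.
Proof.
move=> a; rewrite mem_undup; apply/codomP/codomP => [[[x x'] ->]|[[c c'] ->]].
  by have [c [c' ->]] := cXY_surj Mo x x'; exists (c, c').
by exists (rX c, rY c'); rewrite rXY.
Qed.

Lemma mem_A3 : codom lYY =i A3.
Proof.
move=> a; rewrite mem_undup; apply/codomP/codomP => [[[x x'] ->]|[[c c'] ->]].
  by have [c [c' ->]] := cYY_surj Mo x x'; exists (c, c').
by exists (rY c, rY c'); rewrite rYY.
Qed.

Lemma rXY_pi m f : lXY (rX (pi m f), rY f) = rlabel m.
Proof. by rewrite rXY cXY_pi. Qed.

Lemma rigidE m x f : (lXY (x, rY f) == rlabel m) = (x == rX (pi m f)).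
Proof.
apply/eqP/eqP => [E|->]; last exact: rXY_pi.
exact: (rigid Mo E (rXY_pi m f)).
Qed.

(** Moving (y, z) to a coordinate pair (f1, f2) moves x to [pi m f1] by rigidity. This locates the
    supports of the functions x_b * h. *)
Lemma rl_image m x y z : lXY (x, y) = rlabel m ->
  exists f1 f2, lXY (x, z) = cXY (pi m f1, f2).
Proof.
move=> xy; have [f1 [f2 E]] := cYY_surj Mo y z.
rewrite -(rYY Mo) in E; have [h [h1 h2]] := lYY_sep Mo (esym E).
exists f1, f2; rewrite -(rXY Mo) -h2 -[RHS](lXY_inv h).
congr (lXY (_, _)); apply: (rigid Mo xy).
by rewrite -h1 lXY_inv rXY_pi.
Qed.

(* Meant for labels h of pairs (F', F): the condition says that F' and F have
   the same image under pi m. *)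
Definition same_pi m h :=
  [exists f, exists f', (h == cYY (f', f)) && (cXY (pi m f, f') == rlabel m)].

Lemma same_piE m x y y' : lXY (x, y) = rlabel m ->
  same_pi m (lYY (y', y)) = (lXY (x, y') == rlabel m).
Proof.
move=> xy.
have key f f' g : aY g (rY f') = y' -> aY g (rY f) = y -> 
    lXY (x, y') = cXY (pi m f, f').
  move=> e' e; have <- : aX g (rX (pi m f)) = x.
    by apply: (rigid Mo _ xy); rewrite -e lXY_inv rXY_pi.
  by rewrite -e' lXY_inv rXY.
apply/existsP/eqP => [[f /existsP[f' /andP[/eqP E /eqP <-]]]|xy'].
  have [g [e' e]] : exists g, aY g (rY f') = y' /\ aY g (rY f) = y.
    by apply: lYY_sep; rewrite E rYY.
  exact: key e' e.
have [f' [f E]] := cYY_surj Mo y' y.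
have [g [e' e]] : exists g, aY g (rY f') = y' /\ aY g (rY f) = y.
  by apply: lYY_sep; rewrite E rYY.
by exists f; apply/existsP; exists f'; rewrite E eqxx -(key f f' g) //= xy'.
Qed.

End ModelFacts.

(** * Identities between structure constants, by counting in models *)

Local Notation ev p := (lau_ev (sqrtC p%:R)).

Lemma lau_eq_model x y :
  (forall p, prime p -> generic_model p -> ev p x = ev p y) -> x = y.
Proof. by move=> H; apply: lau_eqP => p pp op; have [M] := models pp op; apply: H. Qed.

(** Stated at a label [cXY (c, f)] because only there the constants are prescribed by counts. *)
Lemma kSV_kVH_assoc a b h c f :
  \sum_(e <- A2) kSV a b e * kVH e h (cXY (c, f)) =
  \sum_(e <- A2) kVH b h e * kSV a e (cXY (c, f)).
Proof.
apply: lau_eq_model => p pp M; rewrite -(rXY M).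
apply: (conv_at_assoc _ _ _ _ _ (gSV M) (gVH M) (gVH M) (gSV M));
  by rewrite ?undup_uniq ?sqrtC_nat_neq0 //; apply: mem_A2 M.
Qed.

Lemma kVH_kH_assoc b h h' c f :
  \sum_(e <- A2) kVH b h e * kVH e h' (cXY (c, f)) =
  \sum_(e <- A3) kH h h' e * kVH b e (cXY (c, f)).
Proof.
apply: lau_eq_model => p pp M; rewrite -(rXY M).
apply: (conv_at_assoc _ _ _ _ _ (gVH M) (gVH M) (gH M) (gVH M));
  rewrite ?undup_uniq ?sqrtC_nat_neq0 //; [exact: mem_A2 M|exact: mem_A3 M].
Qed.

(** Given y = [rY f], the only intermediate flag with label [rlabel m] is [rX (pi m f)], so the
    count is 0 or 1. *)
Lemma kSV_rigid a m c f :
  kSV a (rlabel m) (cXY (c, f)) = (a == cXX (c, pi m f))%:R.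
Proof.
apply: lau_eq_model => p pp M; rewrite -(rXY M) (gSV M).
rewrite lau_ev_nat ?sqrtC_nat_neq0 //; congr _%:R.
under eq_finset => y do rewrite (rigidE M).
case: eqP => [->|/eqP ne].
  rewrite (_ : [set _ | _] = [set rX M (pi m f)]) ?cards1 //.
  apply/setP => x; rewrite !inE andbC; case: eqP => [->|] //=.
  by rewrite rXX eqxx.
rewrite (_ : [set _ | _] = finset.set0) ?cards0 //.
apply/setP => x; rewrite !inE andbC; case: eqP => [->|] //=.
by rewrite rXX eq_sym (negPf ne).
Qed.

(** If y is counted, some g moves ([refy c f], f) to (y, f'), and by rigidity it moves c =
    [pi (refk c f) (refy c f)] to c'; so (c', f') is conjugate to (c, f). In that case y is unique,
    because [ref_fixed] makes its position independent of g. *)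
Lemma kVH_ref c f c' f' :
  kVH (rlabel (refk c f)) (cYY (refy c f, f)) (cXY (c', f')) =
  (cXY (c', f') == cXY (c, f))%:R.
Proof.
apply: lau_eq_model => p pp M; rewrite -{1}(rXY M) (gVH M).
rewrite lau_ev_nat ?sqrtC_nat_neq0 //; congr _%:R.
have key y : gXY (rX M c', y) == rlabel (refk c f) ->
    gYY (y, rY M f') == cYY (refy c f, f) -> exists g,
    [/\ aX M g (rX M c) = rX M c', aY M g (rY M f) = rY M f'
      & y = aY M g (rY M (refy c f))].
  move=> /eqP e1 /eqP; rewrite -(rYY M) => e2.
  have [g [g1 g2]] := lYY_sep M (esym e2).
  exists g; split=> //; apply: (rigid M _ e1).
  by rewrite -g1 lXY_inv rXY -{1}(pi_ref c f) cXY_pi.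
case: eqP => [E|/eqP ne].
  have [g [g1 g2]] : exists g,
      aX M g (rX M c) = rX M c' /\ aY M g (rY M f) = rY M f'.
    by apply: lXY_sep; rewrite !rXY E.
  rewrite (_ : [set _ | _] = [set aY M g (rY M (refy c f))]) ?cards1 //.
  apply/setP => y; rewrite !inE; apply/idP/eqP => [/andP[]|->].
    move=> e1 e2; have [h [h1 h2 ->]] := key y e1 e2.
    by apply: ref_fixed; rewrite ?h1 ?h2.
  rewrite -g1 -g2 lXY_inv lYY_inv rXY rYY -{1}(pi_ref c f) cXY_pi.
  by rewrite !eqxx.
rewrite (_ : [set _ | _] = finset.set0) ?cards0 //.
apply/setP => y; rewrite !inE; apply/negP => /andP[e1 e2].
have [g [g1 g2 _]] := key y e1 e2.
by case/eqP: ne; rewrite -!(rXY M) -g1 -g2 lXY_inv.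
Qed.

(* The structure constants of the product by the sum of the e_h, same_pi m h. *)
Definition kfib m o1 o := \sum_(h <- A3 | same_pi m h) kVH o1 h o.

(** Summing over h replaces the condition on the label of (y, F) by the condition that y and F have
    the same image under [pi m], so F enters the count only through that image. *)
Lemma ev_kfib p (M : generic_model p) m o1 c f : prime p ->
  ev p (kfib m o1 (cXY (c, f))) =
  #|[set y | (gXY (rX M c, y) == o1) && (gXY (rX M (pi m f), y) == rlabel m)]|%:R.
Proof.
move=> pp; rewrite lau_ev_sum ?sqrtC_nat_neq0 // natr_card.
under eq_bigr => h _ do rewrite -(rXY M) (gVH M) natr_card.
rewrite exchange_big /=; apply: eq_bigr => y _.
rewrite -(same_piE M y (rXY_pi M m f)) big_mkcond /=.
pose F h := ((gXY (rX M c, y) == o1) && same_pi m h)%:R : algC.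
rewrite -[RHS]/(F (gYY (y, rY M f))) -(sum_delta F (undup_uniq (codom cYY)));
  last by rewrite -/A3 -(mem_A3 M) codom_f.
apply: eq_bigr => h _; rewrite /F [h == _]eq_sym.
by case: same_pi; rewrite ?andbT ?andbF ?mulr0 // -natrM mulnb andbC.
Qed.

Lemma kfib_rl_neq m c f : cXY (c, f) != rlabel m -> kfib m (rlabel m) (cXY (c, f)) = 0.
Proof.
move=> ne; apply: lau_eq_model => p pp M; rewrite (ev_kfib M) //.
rewrite lau_ev0 ?sqrtC_nat_neq0 //.
rewrite (_ : [set _ | _] = finset.set0) ?cards0 //.
apply/setP => y; rewrite !inE; apply/negP => /andP[/eqP e1 /eqP e2].
by case/eqP: ne; rewrite -(rXY M) (rigid M e1 e2) rXY_pi.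
Qed.

(** One evaluation suffices: at p = 3 the count includes [rY M f] itself. *)
Lemma kfib_rl_neq0 m (f : CY) : kfib m (rlabel m) (rlabel m) != 0.
Proof.
have [M] := models (isT : prime 3) isT; apply/eqP => /(congr1 (ev 3)).
rewrite -{2}(cXY_pi m f) (ev_kfib M) // lau_ev0 ?sqrtC_nat_neq0 // => /eqP.
rewrite pnatr_eq0 cards_eq0 => /eqP/setP/(_ (rY M f)).
by rewrite !inE !rXY_pi eqxx.
Qed.

(** A group element moving (c, [pi m f]) to (c', [pi m f']) maps one counted set injectively into
    the other, wherever it sends f. *)
Lemma kfib_cXX m o1 c f c' f' : cXX (c, pi m f) = cXX (c', pi m f') ->
  kfib m o1 (cXY (c, f)) = kfib m o1 (cXY (c', f')).
Proof.
move=> E; apply: lau_eq_model => p pp M; rewrite !(ev_kfib M) //; congr _%:R.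
have le d e d' e' : cXX (d, pi m e) = cXX (d', pi m e') ->
  (#|[set y | (gXY (rX M d, y) == o1) && (gXY (rX M (pi m e), y) == rlabel m)]| <=
   #|[set y | (gXY (rX M d', y) == o1) && (gXY (rX M (pi m e'), y) == rlabel m)]|)%N.
  move=> F; have [g [g1 g2]] : exists g, aX M g (rX M d) = rX M d' /\
      aX M g (rX M (pi m e)) = rX M (pi m e').
    by apply: lXX_sep; rewrite !rXX F.
  rewrite -(card_imset _ (@aY_inj _ _ _ _ _ M g)); apply: subset_leq_card.
  apply/fintype.subsetP => _ /imsetP[y + ->].
  by rewrite !inE -g1 -g2 !lXY_inv.
by apply/eqP; rewrite eqn_leq !le.
Qed.

(** The orbit of [pi m f] alone already determines m, by [rigid_label]. Without this a function on
    labels of X * X could not be prescribed separately for each m. *)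
Lemma cXX_pi_label c c' m m' f f' :
  cXX (c, pi m f) = cXX (c', pi m' f') -> m = m'.
Proof.
have [M] := models (isT : prime 3) isT; rewrite -!(rXX M) => E.
have [g [g1 g2]] := lXX_sep M E.
apply: (rigid_label M (x := rX M (pi m' f')) (y := aY M g (rY M f))).
  by rewrite -g2 lXY_inv rXY_pi.
exact: rXY_pi.
Qed.

Section Injective.
Variable m0 : K.
Hypothesis m0P : faithful m0.

(** If g moves [pi m0 f] to [pi m0 f'], the translate of f by g and f' both lie over [pi m0 f'],
    hence coincide by faithfulness. *)
Lemma cXX_pi_inj c f c' f' :
  cXX (c, pi m0 f) = cXX (c', pi m0 f') -> cXY (c, f) = cXY (c', f').
Proof.
have [M] := models (isT : prime 3) isT; rewrite -!(rXX M) => E.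
have [g [g1 g2]] := lXX_sep M E; rewrite -!(rXY M) -g1.
suff -> : rY M f' = aY M g (rY M f) by rewrite lXY_inv.
by apply: (rigid_faithful M (x := rX M (pi m0 f')) m0P); rewrite ?rXY_pi // -g2 lXY_inv rXY_pi.
Qed.

(** A pair labelled by the diagonal orbit has its first member in the orbit of [pi m0 f0], and
    [rl_image] applies to it. *)
Lemma kSV_idem f0 b c f : kSV (cXX (pi m0 f0, pi m0 f0)) b (cXY (c, f)) != 0 ->
  exists f1 f2, cXY (c, f) = cXY (pi m0 f1, f2).
Proof.
move=> nz; apply: contrapT => N; case/eqP: nz.
apply: lau_eq_model => p pp M; rewrite -(rXY M) (gSV M).
rewrite lau_ev0 ?sqrtC_nat_neq0 //.
rewrite (_ : [set _ | _] = finset.set0) ?cards0 //.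
apply/setP => x; rewrite !inE; apply/negP => /andP[/eqP].
rewrite -(rXX M) => e1 _; have [g [g1 g2]] := lXX_sep M (esym e1).
apply: N; rewrite -(rXY M); apply: (@rl_image _ _ _ _ _ M m0 _ (aY M g (rY M f0))).
by rewrite -g1 lXY_inv rXY_pi.
Qed.

Lemma kVH_rl f f' h :
  kVH (rlabel m0) h (cXY (pi m0 f', f)) = (h == cYY (f', f))%:R.
Proof.
apply: lau_eq_model => p pp M; rewrite -(rXY M) (gVH M).
rewrite lau_ev_nat ?sqrtC_nat_neq0 //; congr _%:R.
have E y : (gXY (rX M (pi m0 f'), y) == rlabel m0) = (y == rY M f').
  by apply/eqP/eqP => [e|->]; rewrite ?rXY_pi //; apply: (rigid_faithful M m0P e); rewrite rXY_pi.
under eq_finset => y do rewrite E.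
case: eqP => [->|/eqP ne].
  rewrite (_ : [set _ | _] = [set rY M f']) ?cards1 //.
  by apply/setP => y; rewrite !inE; case: eqP => [->|] //=; rewrite rYY eqxx.
rewrite (_ : [set _ | _] = finset.set0) ?cards0 //.
apply/setP => y; rewrite !inE; case: eqP => [->|] //=.
by rewrite rYY eq_sym (negPf ne).
Qed.

Lemma kVH_rl_image h c f : kVH (rlabel m0) h (cXY (c, f)) != 0 ->
  exists f1 f2, cXY (c, f) = cXY (pi m0 f1, f2).
Proof.
move=> nz; apply: contrapT => N; case/eqP: nz.
apply: lau_eq_model => p pp M; rewrite -(rXY M) (gVH M).
rewrite lau_ev0 ?sqrtC_nat_neq0 //.
rewrite (_ : [set _ | _] = finset.set0) ?cards0 //.
apply/setP => y; rewrite !inE; apply/negP => /andP[/eqP E _].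
by apply: N; rewrite -(rXY M); apply: (rl_image M _ E).
Qed.

End Injective.

Lemma linear_fun_sum (R : pzRingType) (U W : lmodType R) (phi : U -> W) (I : Type)
    (r : seq I) (c : I -> R) (x : I -> U) : linear phi ->
  phi (\sum_(i <- r) c i *: x i) = \sum_(i <- r) c i *: phi (x i).
Proof.
move=> lin; have phi0 : phi 0 = 0.
  by have := lin (-1) 0 0; rewrite scaleN1r oppr0 addr0 scaleN1r addNr.
by elim: r => [|i r IH]; rewrite ?big_nil // !big_cons lin IH.
Qed.

(** * Centralizers over one field *)

Section DoubleCentralizer.
Variables (X Y : finType) (lXX : X * X -> L1) (lXY : X * Y -> L2).
Variables (lYY : Y * Y -> L3) (Mo : model lXX lXY lYY).
Variables (RXX : rel (X * X)) (RXY : rel (X * Y)) (RYY : rel (Y * Y)).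
Hypothesis RXXE : forall s t, RXX s t = (lXX s == lXX t).
Hypothesis RXYE : forall s t, RXY s t = (lXY s == lXY t).
Hypothesis RYYE : forall s t, RYY s t = (lYY s == lYY t).

Local Notation S := (AG RXX).
Local Notation V := (AG RXY).
Local Notation H := (AG RYY).

Variables (sv : S -> V -> V) (vh : V -> H -> V) (hh : H -> H -> H).
Hypothesis sv_def : forall s x, sv s x = gconv lXX lXY lXY kSV s x.
Hypothesis vh_def : forall x h, vh x h = gconv lXY lYY lXY kVH x h.
Hypothesis hh_def : forall h h', hh h h' = gconv lYY lYY lYY kH h h'.

Local Notation vS := (val_at lXX).
Local Notation vV := (val_at lXY).
Local Notation vH := (val_at lYY).

Lemma uniq_A1 : uniq A1. Proof. exact: undup_uniq. Qed.
Lemma uniq_A2 : uniq A2. Proof. exact: undup_uniq. Qed.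
Lemma uniq_A3 : uniq A3. Proof. exact: undup_uniq. Qed.

Lemma cXX_A1 c c' : cXX (c, c') \in A1. Proof. by rewrite mem_undup codom_f. Qed.
Lemma cXY_A2 c f : cXY (c, f) \in A2. Proof. by rewrite mem_undup codom_f. Qed.
Lemma cYY_A3 f f' : cYY (f, f') \in A3. Proof. by rewrite mem_undup codom_f. Qed.

Lemma svE s x c f : vV (sv s x) (cXY (c, f)) =
  \sum_(a <- A1) \sum_(o <- A2) kSV a o (cXY (c, f)) * vS s a * vV x o.
Proof.
rewrite -(rXY Mo) sv_def.
by apply: val_at_gconv (mem_A1 Mo) (mem_A2 Mo) _ _ _ => //; apply: undup_uniq.
Qed.

Lemma vhE x h c f : vV (vh x h) (cXY (c, f)) =
  \sum_(a <- A2) \sum_(o <- A3) kVH a o (cXY (c, f)) * vV x a * vH h o.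
Proof.
rewrite -(rXY Mo) vh_def.
by apply: val_at_gconv (mem_A2 Mo) (mem_A3 Mo) _ _ _ => //; apply: undup_uniq.
Qed.

Lemma hhE h h' f f' : vH (hh h h') (cYY (f, f')) =
  \sum_(a <- A3) \sum_(o <- A3) kH a o (cYY (f, f')) * vH h a * vH h' o.
Proof.
rewrite -(rYY Mo) hh_def.
by apply: val_at_gconv (mem_A3 Mo) (mem_A3 Mo) _ _ _ => //; apply: undup_uniq.
Qed.

Lemma V_ext (x y : V) : (forall c f, vV x (cXY (c, f)) = vV y (cXY (c, f))) -> x = y.
Proof.
move=> E; apply: (val_at_ext RXYE) => -[u v].
by have [c [f ->]] := cXY_surj Mo u v.
Qed.

Lemma H_ext (x y : H) : (forall f f', vH x (cYY (f, f')) = vH y (cYY (f, f'))) -> x = y.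
Proof.
move=> E; apply: (val_at_ext RYYE) => -[u v].
by have [c [f ->]] := cYY_surj Mo u v.
Qed.

Definition mkS (u : L1 -> Lau) : S := of_labels RXX lXX u.
Definition mkV (u : L2 -> Lau) : V := of_labels RXY lXY u.
Definition mkH (u : L3 -> Lau) : H := of_labels RYY lYY u.

Lemma vS_mk u c c' : vS (mkS u) (cXX (c, c')) = u (cXX (c, c')).
Proof. by rewrite -(rXX Mo); apply: val_at_of_labels. Qed.
Lemma vV_mk u c f : vV (mkV u) (cXY (c, f)) = u (cXY (c, f)).
Proof. by rewrite -(rXY Mo); apply: val_at_of_labels. Qed.
Lemma vH_mk u f f' : vH (mkH u) (cYY (f, f')) = u (cYY (f, f')).
Proof. by rewrite -(rYY Mo); apply: val_at_of_labels. Qed.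

Lemma A1P a : a \in A1 -> exists c c', a = cXX (c, c').
Proof. by rewrite mem_undup => /codomP[[c c'] ->]; exists c, c'. Qed.
Lemma A2P a : a \in A2 -> exists c c', a = cXY (c, c').
Proof. by rewrite mem_undup => /codomP[[c c'] ->]; exists c, c'. Qed.
Lemma A3P a : a \in A3 -> exists c c', a = cYY (c, c').
Proof. by rewrite mem_undup => /codomP[[c c'] ->]; exists c, c'. Qed.

(** After full expansion the coefficients agree by [kSV_kVH_assoc]. The intermediate labels stay in
    [A2], where values of products are given by [svE] and [vhE]. *)
Lemma sv_vh s x h : vh (sv s x) h = sv s (vh x h).
Proof.
apply: V_ext => c f; rewrite vhE svE.
transitivity (\sum_(a <- A1) \sum_(b <- A2) \sum_(o <- A3)
    (\sum_(e <- A2) kSV a b e * kVH e o (cXY (c, f))) * (vS s a * vV x b * vH h o)).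
  transitivity (\sum_(e <- A2) \sum_(o <- A3) \sum_(a <- A1) \sum_(b <- A2)
      (kSV a b e * kVH e o (cXY (c, f)) * (vS s a * vV x b * vH h o))).
    apply: eq_big_seq => e /A2P[c' [f' ->]]; apply: eq_bigr => o _.
    rewrite svE mulr_sumr mulr_suml; apply: eq_bigr => a _.
    rewrite mulr_sumr mulr_suml; apply: eq_bigr => b _.
    by rewrite -!mulrA mulrCA.
  rewrite exchange_big /=.
  under eq_bigr => o _ do (rewrite exchange_big /=;
    under eq_bigr => a _ do rewrite exchange_big /=).
  rewrite exchange_big /=; apply: eq_bigr => a _; rewrite exchange_big /=.
  by apply: eq_bigr => b _; apply: eq_bigr => o _; rewrite mulr_suml.
apply: eq_bigr => a _.
under eq_bigr => b _ do under eq_bigr => o _ do rewrite kSV_kVH_assoc mulr_suml.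
transitivity (\sum_(e <- A2) \sum_(b <- A2) \sum_(o <- A3)
      (kVH b o e * kSV a e (cXY (c, f)) * (vS s a * vV x b * vH h o))).
  by rewrite [RHS]exchange_big /=; apply: eq_bigr => b _; rewrite exchange_big.
apply: eq_big_seq => e /A2P[c' [f' ->]]; rewrite vhE mulr_sumr; apply: eq_bigr => b _.
rewrite mulr_sumr; apply: eq_bigr => o _.
by rewrite [kVH _ _ _ * _]mulrC -!mulrA; congr (_ * _); rewrite mulrCA.
Qed.

Lemma vh_hh x h h' : vh (vh x h) h' = vh x (hh h h').
Proof.
apply: V_ext => c f; rewrite vhE [RHS]vhE.
transitivity (\sum_(a <- A2) \sum_(b <- A3) \sum_(o <- A3)
    (\sum_(e <- A2) kVH a b e * kVH e o (cXY (c, f))) * (vV x a * vH h b * vH h' o)).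
  transitivity (\sum_(e <- A2) \sum_(o <- A3) \sum_(a <- A2) \sum_(b <- A3)
      (kVH a b e * kVH e o (cXY (c, f)) * (vV x a * vH h b * vH h' o))).
    apply: eq_big_seq => e /A2P[c' [f' ->]]; apply: eq_bigr => o _.
    rewrite vhE mulr_sumr mulr_suml; apply: eq_bigr => a _.
    rewrite mulr_sumr mulr_suml; apply: eq_bigr => b _.
    by rewrite -!mulrA mulrCA.
  rewrite exchange_big /=.
  under eq_bigr => o _ do (rewrite exchange_big /=;
    under eq_bigr => a _ do rewrite exchange_big /=).
  rewrite exchange_big /=; apply: eq_bigr => a _; rewrite exchange_big /=.
  by apply: eq_bigr => b _; apply: eq_bigr => o _; rewrite mulr_suml.
apply: eq_bigr => a _.
under eq_bigr => b _ do under eq_bigr => o _ do rewrite kVH_kH_assoc mulr_suml.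
transitivity (\sum_(e <- A3) \sum_(b <- A3) \sum_(o <- A3)
      (kH b o e * kVH a e (cXY (c, f)) * (vV x a * vH h b * vH h' o))).
  by rewrite [RHS]exchange_big /=; apply: eq_bigr => b _; rewrite exchange_big.
apply: eq_big_seq => e /A3P[c' [f' ->]]; rewrite hhE mulr_sumr; apply: eq_bigr => b _.
rewrite mulr_sumr; apply: eq_bigr => o _.
by rewrite [kH _ _ _ * _]mulrC -!mulrA; congr (_ * _); rewrite mulrCA.
Qed.

Lemma svDr c s x y : sv s (c *: x + y) = c *: sv s x + sv s y.
Proof.
rewrite !sv_def.
by apply: gconv_linr (mem_A1 Mo) (mem_A2 Mo) _ _ _ _ => //; apply: undup_uniq.
Qed.

Lemma vhDl c x y h : vh (c *: x + y) h = c *: vh x h + vh y h.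
Proof.
rewrite !vh_def.
by apply: gconv_linl (mem_A2 Mo) (mem_A3 Mo) _ _ _ _ => //; apply: undup_uniq.
Qed.

Lemma vhDr c x h h' : vh x (c *: h + h') = c *: vh x h + vh x h'.
Proof.
rewrite !vh_def.
by apply: gconv_linr (mem_A2 Mo) (mem_A3 Mo) _ _ _ _ => //; apply: undup_uniq.
Qed.

Definition xV (b : L2) : V := mkV (fun o => (o == b)%:R).

Lemma V_decomp x : x = \sum_(b <- A2) vV x b *: xV b.
Proof.
apply: (of_labels_decomp RXYE x uniq_A2) => t; rewrite -(mem_A2 Mo); exact: codom_f.
Qed.

Lemma sum_A2_delta (F : L2 -> Lau) b : b \in A2 ->
  \sum_(o <- A2) F o * vV (xV b) o = F b.
Proof.
move=> bA; rewrite -[RHS](sum_delta F uniq_A2 bA).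
apply: eq_big_seq => o /A2P[c [f ->]]; rewrite vV_mk mulrC; congr (_ * _).
Qed.

Lemma rl_A2 m (f : CY) : rlabel m \in A2.
Proof. by rewrite -(cXY_pi m f) cXY_A2. Qed.

(** Acting on x_b reads s off at the label of (V, pi F). Hence any function of that label is of the
    form s * x_b. *)
Lemma sv_rl s m c f : vV (sv s (xV (rlabel m))) (cXY (c, f)) = vS s (cXX (c, pi m f)).
Proof.
rewrite svE -[RHS](sum_delta (vS s) uniq_A1 (cXX_A1 _ _)); apply: eq_bigr => a _.
by rewrite (sum_A2_delta (fun o => kSV a o _ * _)) ?kSV_rigid // (rl_A2 m f).
Qed.

Lemma vh_xV b h c f : b \in A2 ->
  vV (vh (xV b) h) (cXY (c, f)) = \sum_(o <- A3) kVH b o (cXY (c, f)) * vH h o.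
Proof.
move=> bA; rewrite vhE exchange_big /=; apply: eq_bigr => o _.
rewrite -(sum_A2_delta (fun a => kVH a o (cXY (c, f)) * vH h o) bA).
by apply: eq_bigr => a _; rewrite mulrAC.
Qed.

Lemma xV_ref c f : xV (cXY (c, f)) =
  vh (xV (rlabel (refk c f))) (mkH (fun h => (h == cYY (refy c f, f))%:R)).
Proof.
apply: V_ext => c' f'; rewrite vh_xV ?(rl_A2 _ f) // vV_mk -kVH_ref.
rewrite -[LHS](sum_delta (fun o => kVH (rlabel (refk c f)) o (cXY (c', f'))) uniq_A3
  (cYY_A3 (refy c f) f)).
by apply: eq_big_seq => h /A3P[? [? ->]]; rewrite vH_mk mulrC.
Qed.

(** The element 1_b of H for b = [rlabel m]; the factor N is [kfib m (rlabel m) (rlabel m)]. *)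
Definition fibH m : H := mkH (fun h => (same_pi m h)%:R).

Lemma vh_fibH x m c f :
  vV (vh x (fibH m)) (cXY (c, f)) = \sum_(o <- A2) kfib m o (cXY (c, f)) * vV x o.
Proof.
rewrite vhE; apply: eq_bigr => o _; rewrite /kfib [in RHS]big_mkcond mulr_suml.
apply: eq_big_seq => h /A3P[? [? ->]]; rewrite vH_mk mulrAC.
by case: same_pi; rewrite ?mulr1 ?mulr0 ?mul0r.
Qed.

Lemma rl_fibH m (f : CY) :
  vh (xV (rlabel m)) (fibH m) = kfib m (rlabel m) (rlabel m) *: xV (rlabel m).
Proof.
apply: V_ext => c f'; rewrite vh_fibH sum_A2_delta ?(rl_A2 _ f) //.
rewrite val_atZ vV_mk; case: eqP => [->|/eqP ne]; first by rewrite mulr1.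
by rewrite mulr0 kfib_rl_neq.
Qed.

Theorem centralizer_H (phi : V -> V) : linear phi ->
    (forall h x, phi (vh x h) = vh (phi x) h) -> exists s, phi =1 sv s.
Proof.
move=> lin com.
(* If [CY] is empty, V is zero; otherwise [f0] is an auxiliary flag by which members of [CX] are
   refined. *)
have [f0|noY] := pickP (fun _ : CY => true); last first.
  by exists 0 => x; apply: V_ext => c f; have := noY f.
move=> _.
pose z m := vV (phi (xV (rlabel m))).
have zE m c f c' f' : cXX (c, pi m f) = cXX (c', pi m f') ->
    z m (cXY (c, f)) = z m (cXY (c', f')).
  move=> E; apply: (lau_mulfI (kfib_rl_neq0 m f)).
  have key : vh (phi (xV (rlabel m))) (fibH m) = kfib m (rlabel m) (rlabel m) *: phi (xV (rlabel m)).
    rewrite -com (rl_fibH m f).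
    (* Homogeneity of phi, as a sum with one term. *)
    have := linear_fun_sum [:: tt] (fun=> kfib m (rlabel m) (rlabel m)) (fun=> xV (rlabel m)) lin.
    by rewrite !big_seq1.
  rewrite -!val_atZ -key !vh_fibH; apply: eq_bigr => o _.
  by rewrite (kfib_cXX _ E).
(* For a label of (c, c'), write c' as the image of its refinement by [f0] and read z there. By [zE]
   and [cXX_pi_label] neither the chosen pair nor [f0] matters. *)
pose u a := if [pick t | cXX t == a] is Some (c, c') then
   z (refk c' f0) (cXY (c, refy c' f0)) else 0.
exists (mkS u).
have uE m c f : u (cXX (c, pi m f)) = z m (cXY (c, f)).
  rewrite /u; case: pickP => [[c1 c1'] /eqP E|/(_ (c, pi m f))]; last by rewrite eqxx.
  rewrite -(pi_ref c1' f0) in E; have Em := cXX_pi_label E.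
  by rewrite Em in E *; apply: zE.
have rlE m : phi (xV (rlabel m)) = sv (mkS u) (xV (rlabel m)).
  by apply: V_ext => c f; rewrite sv_rl vS_mk uE.
have xE b : b \in A2 -> phi (xV b) = sv (mkS u) (xV b).
  by move=> /A2P[c [f ->]]; rewrite xV_ref com rlE sv_vh.
move=> x; rewrite [x in LHS]V_decomp [x in RHS]V_decomp.
rewrite !linear_fun_sum //; last by move=> *; apply: svDr.
by apply: eq_big_seq => b /xE ->.
Qed.

Section InjectiveDC.
Variable m0 : K.
Hypothesis m0P : faithful m0.

Local Notation eta := (xV (rlabel m0)).

Lemma vh_eta h f' f : vV (vh eta h) (cXY (pi m0 f', f)) = vH h (cYY (f', f)).
Proof.
rewrite vh_xV ?(rl_A2 _ f) // -[RHS](sum_delta (vH h) uniq_A3 (cYY_A3 _ _)).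
by apply: eq_bigr => o _; rewrite kVH_rl.
Qed.

Lemma vh_eta_inj h h' : vh eta h = vh eta h' -> h = h'.
Proof. by move=> E; apply: H_ext => f' f; rewrite -!vh_eta E. Qed.

(** When pi is injective, the label of (V, pi F) determines that of (V, F), so every function on X *
    Y can be read as a function of the former. *)
Lemma sv_eta_surj x : exists s, x = sv s eta.
Proof.
pose u a := if [pick t | cXX (t.1, pi m0 t.2) == a] is Some t
  then vV x (cXY t) else 0.
exists (mkS u); apply: V_ext => c f; rewrite sv_rl vS_mk /u.
case: pickP => [[c' f'] /eqP /= E|/(_ (c, f))]; last by rewrite eqxx.
by rewrite (cXX_pi_inj m0P E).
Qed.

(** Since [eta] generates V over S, phi is determined by y = phi(eta). It remains to see that y is
    supported on pairs (pi F', F), where right multiples of [eta] take arbitrary values. *)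
Theorem centralizer_S (phi : V -> V) : linear phi ->
    (forall s x, phi (sv s x) = sv s (phi x)) -> exists h, phi =1 vh^~ h.
Proof.
move=> lin com.
have [f0|noY] := pickP (fun _ : CY => true); last first.
  by exists 0 => x; apply: V_ext => c f; have := noY f.
move=> _; pose y := phi eta.
(* [e0] is the characteristic function of the diagonal orbit of [pi m0 f0]. It fixes [eta], hence
   also y, and this confines the support of y. *)
pose a0 := cXX (pi m0 f0, pi m0 f0).
pose e0 := mkS (fun a => (a == a0)%:R).
have e0E : sv e0 eta = eta.
  apply: V_ext => c f; rewrite sv_rl vS_mk vV_mk; congr (nat_of_bool _)%:R.
  apply/eqP/eqP => [/(cXX_pi_inj m0P)->|E]; first exact: cXY_pi.
  have [M] := models (isT : prime 3) isT.
  move: E; rewrite -(cXY_pi m0 f0) -!(rXY M) => E.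
  have [g [g1 g2]] := lXY_sep M E.
  rewrite /a0 -!(rXX M) -[LHS](lXX_inv (m0 := M) g) g1.
  congr (gXX (_, _)); apply: (rigid M (y := rY M f0) (m := m0)).
    by rewrite -g2 lXY_inv rXY_pi.
  exact: rXY_pi.
have supp c f : vV y (cXY (c, f)) != 0 ->
    exists f1 f2, cXY (c, f) = cXY (pi m0 f1, f2).
  move=> nz; apply: contrapT => N; case/eqP: nz.
  rewrite /y -e0E com svE; apply: big1_seq => a /A1P[c1 [c2 ->]].
  apply: big1_seq => o _; rewrite vS_mk.
  case: eqP => [->|]; last by rewrite mulr0 mul0r.
  suff -> : kSV a0 o (cXY (c, f)) = 0 by rewrite !mul0r.
  by apply/eqP/negPn/negP => /kSV_idem.
pose u b := if [pick t | cYY t == b] is Some t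
  then vV y (cXY (pi m0 t.1, t.2)) else 0.
pose h := mkH u; exists h.
have yE : y = vh eta h.
  apply: V_ext => c f.
  have E f1 f2 : vV y (cXY (pi m0 f1, f2)) = vV (vh eta h) (cXY (pi m0 f1, f2)).
    rewrite vh_eta vH_mk /u; case: pickP => [[f3 f4] /= /eqP|/(_ (f1, f2))]; last first.
      by rewrite eqxx.
    rewrite -!(rYY Mo) => /(lYY_sep Mo)[g [g1 g2]]; congr (val_at lXY y _).
    rewrite -!(rXY Mo) -g2 -[RHS](lXY_inv (m0 := Mo) g); congr (lXY (_, _)).
    apply: (rigid Mo (y := rY Mo f1) (m := m0)); first exact: rXY_pi.
    by rewrite -g1 lXY_inv rXY_pi.
  case: (eqVneq (vV y (cXY (c, f))) 0) => [y0|/supp[f1 [f2 ->]]]; last exact: E.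
  case: (eqVneq (vV (vh eta h) (cXY (c, f))) 0) => [h0|nz]; first by rewrite y0 h0.
  have [f1 [f2 ->]] : exists f1 f2, cXY (c, f) = cXY (pi m0 f1, f2); last exact: E.
  apply: contrapT => N; case/eqP: nz; rewrite vh_xV ?(rl_A2 _ f) //.
  apply: big1 => o _; suff -> : kVH (rlabel m0) o (cXY (c, f)) = 0 by rewrite mul0r.
  by apply/eqP/negPn/negP => /(kVH_rl_image).
by move=> x; have [s ->] := sv_eta_surj x; rewrite com -/y yE sv_vh.
Qed.

End InjectiveDC.
End DoubleCentralizer.
End Models.

(** * Adapted hyperbolic bases *)

Section Geometry.
Variables (F : finFieldType) (d : nat).
Local Notation D := (d + d)%N.
Local Notation Q := (Qform F d).

Lemma Qform_sym : Q^T = Q.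
Proof. by rewrite /Qform tr_block_mx !trmx0 !trmx1. Qed.

Lemma Qform_sqr : Q *m Q = 1%:M.
Proof.
rewrite /Qform mulmx_block !mul0mx !mulmx0 !mul1mx !addr0 !add0r.
by rewrite -scalar_mx_block.
Qed.

Lemma Qform_unit : Q \in unitmx.
Proof. by case: (mulmx1_unit Qform_sqr). Qed.

Lemma sub_perp m p (A : 'M_(m, D)) (B : 'M[F]_(p, D)) (C : 'M[F]_D) :
  (B == C)%MS -> (A <= perp C)%MS = (A *m Q *m B^T == 0).
Proof.
move=> /andP[BC CB]; rewrite /perp; apply/sub_kermxP/eqP; rewrite mulmxA => E.
  by have /submxP[X ->] := BC; rewrite trmx_mul mulmxA E mul0mx.
by have /submxP[X ->] := CB; rewrite trmx_mul mulmxA E mul0mx.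
Qed.

Lemma sub_perpE m (A : 'M_(m, D)) (C : 'M[F]_D) :
  (A <= perp C)%MS = (A *m Q *m C^T == 0).
Proof. by apply: sub_perp; rewrite submx_refl. Qed.

Lemma perp_mul0 m p (A : 'M_(m, D)) (B : 'M[F]_(p, D)) (C : 'M[F]_D) :
  (B <= C)%MS -> (A <= perp C)%MS -> A *m Q *m B^T = 0.
Proof.
rewrite sub_perpE => /submxP[X ->] /eqP E.
by rewrite trmx_mul mulmxA E mul0mx.
Qed.

Lemma perp_sym (A C : 'M[F]_D) : (A <= perp C)%MS = (C <= perp A)%MS.
Proof.
rewrite !sub_perpE; apply/eqP/eqP => /(congr1 trmx);
  by rewrite !trmx_mul trmxK Qform_sym trmx0 mulmxA.
Qed.

Lemma rank_perp (A : 'M[F]_D) : \rank (perp A) = (D - \rank A)%N.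
Proof.
rewrite /perp mxrank_ker -mxrank_tr trmx_mul trmxK.
by rewrite mxrankMfree // row_free_unit unitmx_tr Qform_unit.
Qed.

Lemma perpS (A B : 'M[F]_D) : (A <= B)%MS -> (perp B <= perp A)%MS.
Proof. by move=> AB; rewrite perp_sym (submx_trans AB) // perp_sym. Qed.

Lemma perpK (A : 'M[F]_D) : (perp (perp A) :=: A)%MS.
Proof.
apply/eqmxP; rewrite andbC; have AA : (A <= perp (perp A))%MS by rewrite perp_sym.
rewrite AA /= -(mxrank_leqif_sup AA) !rank_perp subKn ?eqxx //; exact: rank_leq_col.
Qed.

Lemma eqmx_perp (A B : 'M[F]_D) : (A :=: B)%MS -> (perp A :=: perp B)%MS.
Proof. by move=> E; apply/eqmxP; rewrite !perpS // E. Qed.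

Lemma perp_adds (A B : 'M[F]_D) : (perp (A + B)%MS :=: perp A :&: perp B)%MS.
Proof.
apply/eqmxP/andP; split.
  by rewrite sub_capmx; apply/andP; split; apply: perpS;
    [exact: addsmxSl|exact: addsmxSr].
by rewrite perp_sym addsmx_sub !(perp_sym A, perp_sym B) capmxSl capmxSr.
Qed.

Definition bq (u v : 'rV[F]_D) : F := (u *m Q *m v^T) 0 0.

Lemma bqE u v : u *m Q *m v^T = (bq u v)%:M.
Proof. by rewrite [LHS]mx11_scalar. Qed.

Lemma bqC u v : bq u v = bq v u.
Proof.
have E : v *m Q *m u^T = (u *m Q *m v^T)^T.
  by rewrite !trmx_mul trmxK Qform_sym mulmxA.
by rewrite /bq E [RHS]mxE.
Qed.

Lemma bq_row m u (A : 'M_(m, D)) i : bq u (row i A) = (u *m Q *m A^T) 0 i.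
Proof. by rewrite /bq tr_row colE mulmxA -colE mxE. Qed.

Lemma bqDl u1 u2 v : bq (u1 + u2) v = bq u1 v + bq u2 v.
Proof. by rewrite /bq !mulmxDl mxE. Qed.

Lemma bqZl c u v : bq (c *: u) v = c * bq u v.
Proof. by rewrite /bq -!scalemxAl mxE. Qed.

Lemma bqDr u v1 v2 : bq u (v1 + v2) = bq u v1 + bq u v2.
Proof. by rewrite bqC bqDl !(bqC u). Qed.

Lemma bqZr c u v : bq u (c *: v) = c * bq u v.
Proof. by rewrite bqC bqZl (bqC u). Qed.

Lemma bq0 u v (A : 'M[F]_D) : (u <= perp A)%MS -> (v <= A)%MS -> bq u v = 0.
Proof.
rewrite sub_perpE => /eqP E /submxP[X ->].
by rewrite /bq trmx_mul mulmxA E mul0mx mxE.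
Qed.

Lemma bqP u (A : 'M[F]_D) :
  reflect (forall v, (v <= A)%MS -> bq u v = 0) (u <= perp A)%MS.
Proof.
apply: (iffP idP) => [uA v|H]; first exact: bq0.
rewrite sub_perpE; apply/eqP/rowP => i; rewrite [RHS]mxE -bq_row.
exact: H (row_sub i A).
Qed.

(** A self-dual chain. Its members count up to row space, hence [:=:] in the second clause; the
    third clause gives the zero space and by duality the whole space. *)
Definition isochain (s : seq 'M[F]_D) :=
  [/\ forall A B : 'M[F]_D, A \in s -> B \in s -> (A <= B)%MS || (B <= A)%MS,
      forall A : 'M[F]_D, A \in s -> exists2 B : 'M[F]_D, B \in s & (B :=: perp A)%MS
    & exists2 A : 'M[F]_D, A \in s & \rank A = 0%N].

Lemma chain_rank s (A B : 'M[F]_D) : isochain s -> A \in s -> B \in s ->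
  (\rank A <= \rank B)%N -> (A <= B)%MS.
Proof.
move=> [tot _ _] As Bs rAB; have /orP[//|BA] := tot A B As Bs.
by rewrite -(geq_leqif (mxrank_leqif_sup BA)).
Qed.

Lemma chain_full s : isochain s -> exists2 A : 'M[F]_D, A \in s & (1%:M <= A)%MS.
Proof.
move=> [_ per [A As rA]]; have [B Bs EB] := per A As.
by exists B; rewrite // EB sub1mx -col_leq_rank rank_perp rA subn0.
Qed.

Lemma chain_min (s : seq 'M[F]_D) (P : pred 'M[F]_D) A0 : A0 \in s -> P A0 ->
  exists A : 'M[F]_D, [/\ A \in s, P A & forall B : 'M[F]_D, B \in s -> P B -> (\rank A <= \rank B)%N].
Proof.
move=> A0s PA0.
have ex : exists k, has (fun A => P A && (\rank A == k)) s.
  by exists (\rank A0); apply/hasP; exists A0; rewrite ?PA0 /=.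
case: (ex_minnP ex) => k /hasP[A As /andP[PA /eqP rA]] mn; exists A; split=> // B Bs PB.
by rewrite rA mn //; apply/hasP; exists B; rewrite ?PB /=.
Qed.

Lemma chain_max (s : seq 'M[F]_D) (P : pred 'M[F]_D) A0 : A0 \in s -> P A0 ->
  exists A : 'M[F]_D, [/\ A \in s, P A & forall B : 'M[F]_D, B \in s -> P B -> (\rank B <= \rank A)%N].
Proof.
move=> A0s PA0.
have ex : exists k, has (fun A => P A && (\rank A == k)) s.
  by exists (\rank A0); apply/hasP; exists A0; rewrite ?PA0 /=.
have ub k : has (fun A => P A && (\rank A == k)) s -> (k <= D)%N.
  by case/hasP=> A _ /andP[_ /eqP<-]; rewrite rank_leq_col.
case: (ex_maxnP ex ub) => k /hasP[A As /andP[PA /eqP rA]] mx; exists A; split=> // B Bs PB.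
by rewrite rA mx //; apply/hasP; exists B; rewrite ?PB /=.
Qed.

Definition hyperbolic r (U W : 'M[F]_(r, D)) :=
  [/\ U *m Q *m U^T = 0, W *m Q *m W^T = 0 & U *m Q *m W^T = 1%:M].

(* For a hyperbolic pair (u, w) in a self-dual chain, this condition on all V of
   the chain says that each V is spanned by its intersections with <u, w> and
   with its orthogonal. *)
Definition adapted r (U W : 'M[F]_(r, D)) (V : 'M[F]_D) :=
  forall i, (row i U <= V)%MS \/ (row i W <= perp V)%MS.

Lemma adapted_dual s r (U W : 'M[F]_(r, D)) : isochain s ->
  (forall V, V \in s -> adapted U W V) -> forall V, V \in s -> adapted W U V.
Proof.
move=> [_ per _] H V Vs i; have [V' V's E] := per V Vs.
have [|] := H V' V's i; first by rewrite E; right.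
by rewrite (eqmx_perp E) perpK; left.
Qed.

Lemma adapted_sub r (U W : 'M[F]_(r, D)) (V : 'M[F]_D) (v : 'rV_D) :
  adapted U W V -> (v <= V)%MS -> (v *m Q *m W^T *m U <= V)%MS.
Proof.
move=> ad vV; rewrite mulmx_sum_row; apply: summx_sub => i _.
have [uV|wV] := ad i; first exact: scalemx_sub.
suff -> : (v *m Q *m W^T) 0 i = 0 by rewrite scale0r sub0mx.
by rewrite -bq_row bqC (bq0 wV vV).
Qed.

(** For a hyperbolic pair, the orthogonal projection onto the span of U and W. *)
Definition hpart r (U W : 'M[F]_(r, D)) (v : 'rV[F]_D) : 'rV_D :=
  v *m Q *m W^T *m U + v *m Q *m U^T *m W.

Lemma hpart_sub r (U W : 'M[F]_(r, D)) v : (hpart U W v <= U + W)%MS.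
Proof. by rewrite addmx_sub_adds ?submxMl. Qed.

Lemma hpart_id r (U W : 'M[F]_(r, D)) v : hyperbolic U W ->
  (v <= U + W)%MS -> hpart U W v = v.
Proof.
move=> [UU WW UW] /sub_addsmxP[[a b] /= ->].
have WU : W *m Q *m U^T = 1%:M.
  by move/(congr1 trmx): UW; rewrite !trmx_mul trmxK Qform_sym trmx1 mulmxA.
rewrite /hpart !mulmxDl -!(mulmxA _ Q) -!(mulmxA _ U) -!(mulmxA _ W) !(mulmxA _ Q).
by rewrite UU WW UW WU !mulmx1 !mulmx0 !mul0mx addr0 add0r.
Qed.

Lemma hpart0 r (U W : 'M[F]_(r, D)) v :
  (v <= perp (U + W)%MS)%MS -> hpart U W v = 0.
Proof.
move=> vp; rewrite /hpart !(perp_mul0 _ vp) ?mul0mx ?addr0 //.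
  exact: addsmxSl.
exact: addsmxSr.
Qed.

Lemma hpart_perp r (U W : 'M[F]_(r, D)) v : hyperbolic U W ->
  (v - hpart U W v <= perp (U + W)%MS)%MS.
Proof.
move=> [UU WW UW].
have WU : W *m Q *m U^T = 1%:M.
  by move/(congr1 trmx): UW; rewrite !trmx_mul trmxK Qform_sym trmx1 mulmxA.
have BC : (col_mx U W == (U + W)%MS)%MS by rewrite !addsmxE !submx_refl.
rewrite (sub_perp _ BC).
rewrite tr_col_mx mul_mx_row /hpart !mulmxBl !mulmxDl.
rewrite -!(mulmxA _ U) -!(mulmxA _ W) -!(mulmxA _ (U *m Q)) -!(mulmxA _ (W *m Q)).
by rewrite UU WW UW WU !mulmx1 !mulmx0 addr0 add0r !subrr row_mx0.
Qed.

Lemma hpart_chain s r (U W : 'M[F]_(r, D)) V v : isochain s ->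
    (forall V, V \in s -> adapted U W V) -> V \in s -> (v <= V)%MS ->
  (hpart U W v <= V)%MS.
Proof.
move=> cs ad Vs vV; rewrite addmx_sub ?adapted_sub //; first exact: ad.
exact: (adapted_dual cs).
Qed.

(** The projection onto the span of U and W preserves V, so v minus its projection lies in V and in
    the orthogonal, hence vanishes. *)
Lemma chain_cap_neq0 s r (U W : 'M[F]_(r, D)) V : isochain s ->
    hyperbolic U W -> (forall V, V \in s -> adapted U W V) -> V \in s ->
  (V :&: perp (U + W)%MS)%MS = 0 -> (V <= U + W)%MS.
Proof.
move=> cs hUW ad Vs V0; apply/row_subP => i; set v := row i V.
have vV : (v <= V)%MS := row_sub i V.
suff /eqP : v - hpart U W v = 0 by rewrite subr_eq0 => /eqP ->; apply: hpart_sub.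
apply/eqP; rewrite -submx0 -V0 sub_capmx hpart_perp // andbT.
by rewrite addmx_sub // eqmx_opp (hpart_chain cs).
Qed.

(** Otherwise V lies in the span of r hyperbolic planes, and being isotropic and adapted it lies in
    a sum of r lines, one in each plane. *)
Lemma isotropic_cap s r (U W : 'M[F]_(r, D)) V : isochain s -> hyperbolic U W ->
    (forall V, V \in s -> adapted U W V) -> V \in s -> (V <= perp V)%MS -> (r < \rank V)%N -> (V :&: perp (U + W)%MS)%MS != 0.
Proof.
move=> cs hUW ad Vs iV rV; apply/eqP => V0.
have VUW := chain_cap_neq0 cs hUW ad Vs V0.
pose Z : 'M_(r, D) := \matrix_i (if (row i U <= V)%MS then row i U else row i W).
suff /mxrankS : (V <= Z)%MS by rewrite leqNgt (leq_ltn_trans (rank_leq_row Z)).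
apply/row_subP => i; set v := row i V; have vV : (v <= V)%MS := row_sub i V.
suff -> : v = hpart U W v.
  rewrite /hpart (mulmx_sum_row _ U) (mulmx_sum_row _ W) -big_split; apply: summx_sub => j _ /=.
  have Zj : row j Z = if (row j U <= V)%MS then row j U else row j W.
    exact: rowK.
  rewrite -!bq_row; case: ifP Zj => [uV|uV] Zj.
    rewrite [X in _ + X *: _](bq0 (submx_trans vV iV) uV) scale0r addr0.
    by rewrite scalemx_sub // -Zj row_sub.
  have [|wV] := ad V Vs j; first by rewrite uV.
  rewrite bqC (bq0 wV vV) scale0r add0r.
  by rewrite scalemx_sub // -Zj row_sub.
by rewrite hpart_id // (submx_trans vV).
Qed.

Section Extend.
Hypothesis two : 2%N \notin [pchar F].
Variables (s s' : seq 'M[F]_D) (Wm : 'M[F]_D).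
Hypotheses (cs : isochain s) (cs' : isochain s').
Hypotheses (Wms : Wm \in s) (iWm : (Wm <= perp Wm)%MS) (rWm : \rank Wm = d).

(* u is taken in the smallest V0 :&: V1 that meets the orthogonal E of U and W,
   and w in E :&: perp P with P the largest member of s' not containing V1; then
   w is made isotropic by subtracting a multiple of u, which is allowed because
   either w is already isotropic or u is orthogonal to P. *)
Lemma extend_hyperbolic r (U W : 'M[F]_(r, D)) : (r < d)%N -> hyperbolic U W ->
    (forall V, V \in s -> adapted U W V) -> (forall V, V \in s' -> adapted U W V) ->
  exists u w : 'rV_D, [/\ hyperbolic (col_mx U u) (col_mx W w),
    forall V, V \in s -> (u <= V)%MS \/ (w <= perp V)%MS
    & forall V, V \in s' -> (u <= V)%MS \/ (w <= perp V)%MS].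
Proof.
move=> rd hUW ad ad'; set E := perp (U + W)%MS.
have [|V0 [V0s V0E V0min]] := @chain_min s (fun V => (V :&: E)%MS != 0) Wm Wms.
  by apply: (isotropic_cap cs hUW ad) => //; rewrite rWm.
have V0Wm : (V0 <= Wm)%MS.
  apply: (chain_rank cs) => //; apply: V0min => //.
  by apply: (isotropic_cap cs hUW ad) => //; rewrite rWm.
have [T Ts' fT] := chain_full cs'.
have [|V1 [V1s V1E V1min]] := @chain_min s' (fun V => (V0 :&: V :&: E)%MS != 0) T Ts'.
  apply: contra_neq V0E => T0; apply/eqP; rewrite -submx0 -T0.
  by rewrite !sub_capmx capmxSl capmxSr (submx_trans _ fT) // submx1.
have [_ _ [Z Zs' /eqP]] := cs'; rewrite mxrank_eq0 => /eqP Z0.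
have V1nz : V1 != 0.
  by apply: contra_neq V1E => ->; rewrite capmx0 cap0mx.
have [|P [Ps' NP Pmax]] := @chain_max s' (fun V => ~~ (V1 <= V)%MS) Z Zs'.
  by rewrite Z0 submx0.
have V1P V : V \in s' -> (V1 <= V)%MS \/ (V <= P)%MS.
  move=> Vs'; case: (boolP (V1 <= V)%MS) => [|nV]; first by left.
  by right; apply: (chain_rank cs') => //; apply: Pmax.
pose u := nz_row (V0 :&: V1 :&: E)%MS.
have u0 : u != 0 by rewrite nz_row_eq0.
have : (u <= V0 :&: V1 :&: E)%MS by apply: nz_row_sub.
rewrite !sub_capmx => /andP[/andP[uV0 uV1] uE].
have uu : bq u u = 0.
  have uWm := submx_trans uV0 V0Wm.
  exact: bq0 (submx_trans uWm iWm) uWm.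
(* If no such [w0] exists, u is orthogonal to E :&: perp P and so lies in (U + W) + P. As u is in E,
   it is the E-component of an element of P; adaptedness puts it in P, against the minimality of
   V1. *)
have [w0 w0EP uw0] : exists2 w0 : 'rV_D, (w0 <= E :&: perp P)%MS & bq u w0 != 0.
  apply: contrapT => N.
  have : (u <= perp (E :&: perp P)%MS)%MS.
    apply/bqP => v vEP; apply/eqP/negPn/negP => nz; apply: N; by exists v.
  rewrite -[(E :&: perp P)%MS]/(perp _ :&: perp P)%MS.
  rewrite (eqmx_perp (eqmx_sym (perp_adds _ _))) perpK => /sub_addsmxP[[a p] /= uap].
  have pP : (p *m P <= P)%MS := submxMl p P.
  have upE : u - (p *m P - hpart U W (p *m P)) = 0.
    have hE : (u - (p *m P - hpart U W (p *m P)) <= E)%MS.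
      by rewrite addmx_sub // eqmx_opp hpart_perp.
    have hH : (u - (p *m P - hpart U W (p *m P)) <= U + W)%MS.
      rewrite uap opprB addrCA addrK addmx_sub ?hpart_sub //; exact: submxMl.
    by rewrite -[LHS](hpart_id hUW hH) hpart0.
  have uP : (u <= P)%MS.
    move/eqP: upE; rewrite subr_eq0 => /eqP ->.
    by rewrite addmx_sub // eqmx_opp (hpart_chain cs' ad').
  have PV1 : (P <= V1)%MS.
    by have [tot _ _] := cs'; have /orP[|//] := tot V1 P V1s Ps'; rewrite (negPf NP).
  case/negP: NP; apply: (chain_rank cs') => //; apply: V1min => //.
  by apply: contra_neq u0 => PE0; apply/eqP; rewrite -submx0 -PE0 !sub_capmx uV0 uP.
pose w1 := (bq u w0)^-1 *: w0.
have uw1 : bq u w1 = 1 by rewrite bqZr mulVf.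
have : (w1 <= E :&: perp P)%MS by apply: scalemx_sub.
rewrite sub_capmx => /andP[w1E w1P].
clearbody w1.
pose w := w1 - (bq w1 w1 / 2%:R) *: u.
have uw : bq u w = 1 by rewrite /w -scaleNr bqDr bqZr uu mulr0 addr0.
have nz2 : 2%:R != 0 :> F by apply: contra two => z2; rewrite inE /= z2.
have ww : bq w w = 0.
  rewrite /w -scaleNr !(bqDl, bqDr, bqZl, bqZr) (bqC w1 u) uu uw1; field.
  exact: nz2.
have wE : (w <= E)%MS by rewrite addmx_sub // eqmx_opp scalemx_sub.
exists u, w; split.
- have [UU WW UW] := hUW.
  have ort (x : 'rV_D) : (x <= E)%MS -> x *m Q *m U^T = 0 /\ x *m Q *m W^T = 0.
    by move=> xE; split; apply: perp_mul0 xE; [exact: addsmxSl|exact: addsmxSr].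
  have ort' (x : 'rV_D) : (x <= E)%MS -> U *m Q *m x^T = 0 /\ W *m Q *m x^T = 0.
    move=> /ort[e1 e2]; split; apply: trmx_inj;
      by rewrite !trmx_mul trmxK Qform_sym trmx0 mulmxA.
  have [uU uW] := ort u uE; have [wU wW] := ort w wE.
  have [Uu Wu] := ort' u uE; have [Uw Ww] := ort' w wE.
  split; rewrite tr_col_mx !mul_col_mx !mul_mx_row.
  + by rewrite UU Uu uU bqE uu -scalemx1 scale0r !row_mx0 col_mx0.
  + by rewrite WW Ww wW bqE ww -scalemx1 scale0r !row_mx0 col_mx0.
  + by rewrite UW Uw uW bqE uw [RHS]scalar_mx_block.
(* The chain [s] puts no condition on w beyond w in E: a member not containing V0 meets E trivially,
   so it lies in U + W, to which w is orthogonal. *)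
- move=> V Vs; case: (boolP (V0 <= V)%MS) => [V0V|nV]; first by left; apply: submx_trans V0V.
  right; have VV0 : (V <= V0)%MS.
    by have [tot _ _] := cs; have /orP[|//] := tot V0 V V0s Vs; rewrite (negPf nV).
  have : (V :&: E)%MS = 0.
    apply/eqP/negPn/negP => VE; case/negP: nV.
    by apply: (chain_rank cs) => //; apply: V0min.
  move=> /(chain_cap_neq0 cs hUW ad Vs) VH.
  exact: submx_trans wE (perpS VH).
- move=> V /V1P[V1V|VP]; first by left; apply: submx_trans V1V.
  right; apply: submx_trans (perpS VP); rewrite addmx_sub // eqmx_opp.
  have [_ per _] := cs'; have [P' P's' EP'] := per P Ps'.
  have [V1P'|P'P] := V1P P' P's'.
    by rewrite scalemx_sub // -EP' (submx_trans uV1).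
  have -> : bq w1 w1 = 0 by apply: (bq0 w1P); apply: submx_trans P'P; rewrite EP'.
  by rewrite mul0r scale0r sub0mx.
Qed.

Lemma hyperbolic_basis : exists U W : 'M[F]_(d, D), [/\ hyperbolic U W,
  forall V, V \in s -> adapted U W V & forall V, V \in s' -> adapted U W V].
Proof.
suff H r : (r <= d)%N -> exists U W : 'M[F]_(r, D), [/\ hyperbolic U W,
  forall V, V \in s -> adapted U W V & forall V, V \in s' -> adapted U W V].
  exact: H (leqnn d).
elim: r => [|r IH] rd.
  exists 0, 0; split; [split|by move=> ? ? []|by move=> ? ? []];
    by rewrite ?[1%:M]flatmx0 ?mul0mx.
have [U [W [hUW ad ad']]] := IH (ltnW rd).
have [u [w [h e e']]] := extend_hyperbolic rd hUW ad ad'.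
rewrite -addn1; exists (col_mx U u), (col_mx W w).
have A V : adapted U W V -> (u <= V)%MS \/ (w <= perp V)%MS ->
    adapted (col_mx U u) (col_mx W w) V.
  move=> a b i; case: (split_ordP i) => j ->; first by rewrite !rowKu.
  by rewrite !rowKd; have [H|H] := b; [left|right]; rewrite (submx_trans _ H) // row_sub.
split=> // V Vs; apply: A; by [apply: ad|apply: ad'|apply: e|apply: e'].
Qed.

End Extend.

End Geometry.

(** * Coordinate subspaces and isometries *)

Section Signs.
Variable d : nat.
Local Notation D := (d + d)%N.
Local Notation I := 'I_(d + d).

(** The index of the dual basis vector: the form pairs the basis vector x with [sg x] only. *)
Definition sg (x : I) : I :=
  match fintype.split x with inl i => rshift d i | inr i => lshift d i end.

Definition hidx (x : I) : 'I_d :=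
  match fintype.split x with inl i => i | inr i => i end.

Definition low : {set I} := [set x : I | (x < d)%N].

Lemma split_lshift i : fintype.split (lshift d i : I) = inl i.
Proof. exact: (unsplitK (inl i)). Qed.

Lemma split_rshift i : fintype.split (rshift d i : I) = inr i.
Proof. exact: (unsplitK (inr i)). Qed.

Lemma sg_l i : sg (lshift d i) = rshift d i.
Proof. by rewrite /sg split_lshift. Qed.

Lemma sg_r i : sg (rshift d i) = lshift d i.
Proof. by rewrite /sg split_rshift. Qed.

Lemma hidx_l i : hidx (lshift d i) = i.
Proof. by rewrite /hidx split_lshift. Qed.

Lemma hidx_r i : hidx (rshift d i) = i.
Proof. by rewrite /hidx split_rshift. Qed.

Lemma low_l i : lshift d i \in low. Proof. by rewrite inE /= ltn_ord. Qed.
Lemma low_r i : rshift d i \in low = false.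
Proof. by rewrite inE /= ltnNge leq_addr. Qed.

Lemma sgK : involutive sg.
Proof. by move=> x; case: (split_ordP x) => i ->; rewrite ?sg_l ?sg_r ?sg_l. Qed.

Lemma hidx_sg x : hidx (sg x) = hidx x.
Proof. by case: (split_ordP x) => i ->; rewrite ?sg_l ?sg_r ?hidx_l ?hidx_r. Qed.

Lemma low_sg x : (sg x \in low) = (x \notin low).
Proof. by case: (split_ordP x) => i ->; rewrite ?sg_l ?sg_r ?low_l ?low_r. Qed.

Lemma sg_neq x : (sg x == x) = false.
Proof. by apply/eqP => E; have := low_sg x; rewrite E; case: (_ \in _). Qed.

Lemma hidx_eq x y : hidx x = hidx y -> y = x \/ y = sg x.
Proof.
case: (split_ordP x) => i ->; case: (split_ordP y) => j ->;
  rewrite ?hidx_l ?hidx_r ?sg_l ?sg_r => ->; by [left|right].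
Qed.

(** The signed permutations, i.e. the Weyl group of type B_d inside the symmetric group on 2d
    letters. *)
Definition sgperm : {set 'S_D} := [set s : 'S_D | [forall x, s (sg x) == sg (s x)]].

Lemma sgpermP (s : 'S_D) : reflect (forall x, s (sg x) = sg (s x)) (s \in sgperm).
Proof. by rewrite inE; apply: (iffP forallP) => H x; apply/eqP; rewrite H. Qed.

(** The sign changes of the signed permutation group: the two basis vectors of each hyperbolic plane
    in T are exchanged. *)
Definition swap_fun (T : {set 'I_d}) (x : I) : I := if hidx x \in T then sg x else x.

Lemma swap_funK T : involutive (swap_fun T).
Proof.
by move=> x; rewrite /swap_fun; case hx: (hidx x \in T); rewrite ?hidx_sg hx ?sgK.
Qed.

Definition swap T : 'S_D := perm (can_inj (swap_funK T)).

Lemma swapE T x : swap T x = if hidx x \in T then sg x else x.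
Proof. by rewrite permE. Qed.

Lemma swapK T : involutive (swap T).
Proof. by move=> x; rewrite !permE swap_funK. Qed.

Lemma swap_sgperm T : swap T \in sgperm.
Proof. by apply/sgpermP => x; rewrite !swapE hidx_sg; case: ifP. Qed.

Lemma odd_swap (T : {set 'I_d}) : odd_perm (swap T) = odd #|T|.
Proof.
move: {2}#|T| (erefl #|T|) => k; elim: k T => [|k IH] T cT.
  have -> : swap T = 1%g.
    apply/permP => x; rewrite swapE perm1 ifF //.
    by move/eqP: cT; rewrite cards_eq0 => /eqP->; rewrite inE.
  by rewrite odd_perm1 cT.
have [i iT] : exists i, i \in T by apply/card_gt0P; rewrite cT.
have cT' : #|T :\ i| = k by move: cT; rewrite (cardsD1 i) iT => -[].
have -> : swap T = (tperm (lshift d i) (rshift d i) * swap (T :\ i))%g.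
  apply/permP => x; rewrite permM !swapE.
  case: (eqVneq (hidx x) i) => [hx|hx].
    case: tpermP => [->|->|].
    - by rewrite hidx_l hidx_r !inE eqxx iT sg_l.
    - by rewrite hidx_r hidx_l !inE eqxx iT sg_r.
    - by case: (split_ordP x) hx => j ->; rewrite ?hidx_l ?hidx_r => ->.
  rewrite tpermD ?inE ?hx //.
  - by apply: contra_neq hx => <-; rewrite hidx_l.
  - by apply: contra_neq hx => <-; rewrite hidx_r.
rewrite odd_permM odd_tperm IH // cT cT' /=.
(* The transposition is nontrivial: i and d + i differ because i < d forces d to be positive. *)
by rewrite -(inj_eq val_inj) /= -{1}[val i]add0n eqn_add2r eq_sym -lt0n (leq_ltn_trans _ (ltn_ord i)).
Qed.

(** One index from each dual pair: these are the sets S whose coordinate subspace is maximal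
    isotropic. *)
Definition transversal_sg (S : {set I}) := forall x, (sg x \in S) = (x \notin S).

Lemma low_transversal : transversal_sg low.
Proof. exact: low_sg. Qed.

Definition swap_set (S S' : {set I}) : {set 'I_d} :=
  [set i | (lshift d i \in S) != (lshift d i \in S')].

Lemma swap_setP (S S' : {set I}) x : transversal_sg S -> transversal_sg S' ->
  (hidx x \in swap_set S S') = ((x \in S) != (x \in S')).
Proof.
move=> tS tS'; case: (split_ordP x) => i ->; rewrite ?hidx_l ?hidx_r inE //.
by rewrite -!sg_l tS tS'; do 2!case: (_ \in _).
Qed.

Lemma swap_setE (S S' : {set I}) x : transversal_sg S -> transversal_sg S' ->
  (swap (swap_set S S') x \in S') = (x \in S).
Proof.
move=> tS tS'; rewrite swapE swap_setP //.
case: (boolP (x \in S)) => H; case: (boolP (x \in S')) => H' /=;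
  by rewrite ?tS' ?H' ?(negPf H').
Qed.

Lemma card_transversal_sg (S : {set I}) : transversal_sg S -> #|S| = d.
Proof.
move=> tS; have E : ~: S = sg @: S.
  apply/setP => x; rewrite inE -tS; apply/idP/imsetP => [xS|[y yS ->]].
    by exists (sg x); rewrite ?sgK.
  by rewrite sgK.
have := cardsC S; rewrite E card_imset; last exact: can_inj sgK.
rewrite card_ord; move: #|S| => k; rewrite !addnn; exact: double_inj.
Qed.

Lemma card_swap_set (S S' : {set I}) : transversal_sg S -> transversal_sg S' ->
  #|swap_set S S'| = (d - #|S :&: S'|)%N.
Proof.
move=> tS tS'.
have E : hidx @: (S :\: S') = swap_set S S'.
  apply/setP => i; apply/imsetP/idP => [[x xS ->]|iT].
    by rewrite swap_setP //; move: xS; rewrite inE => /andP[/negPf-> ->].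
  have := swap_setP (lshift d i) tS tS'; rewrite hidx_l iT.
  case: (boolP (lshift d i \in S)) => iS; case: (boolP (lshift d i \in S')) => iS' // _.
    by exists (lshift d i); rewrite ?hidx_l // inE iS iS'.
  by exists (sg (lshift d i)); rewrite ?hidx_sg ?hidx_l // inE tS tS' iS iS'.
rewrite -E card_in_imset; last first.
  move=> x y; rewrite !inE => /andP[_ xS] /andP[_ yS] /hidx_eq[->//|E'].
  by move: yS; rewrite E' tS xS.
by rewrite cardsD (card_transversal_sg tS).
Qed.

End Signs.

Section Coordinates.
Variables (F : finFieldType) (d : nat).
Local Notation D := (d + d)%N.
Local Notation I := 'I_(d + d).
Local Notation Q := (Qform F d).

Lemma QformE x y : Q x y = (y == sg x)%:R.
Proof.
case: (split_ordP x) => i ->; case: (split_ordP y) => j ->;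
  rewrite /Qform ?block_mxEul ?block_mxEur ?block_mxEdl ?block_mxEdr ?sg_l ?sg_r mxE.
- by rewrite eq_lrshift.
- by rewrite (inj_eq (@rshift_inj _ _)) eq_sym.
- by rewrite (inj_eq (@lshift_inj _ _)) eq_sym.
- by rewrite eq_rlshift.
Qed.

Definition coordsp (S : {set I}) : 'M[F]_D := diag_mx (\row_i (i \in S)%:R).

Lemma row_csp S i : row i (coordsp S) = (i \in S)%:R *: delta_mx 0 i.
Proof.
by apply/rowP => j; rewrite !mxE eqxx /= [i == j]eq_sym mulr_natr.
Qed.

Lemma sub_csp (v : 'rV_D) (S : {set I}) : reflect (forall j, j \notin S -> v 0 j = 0) (v <= coordsp S)%MS.
Proof.
apply: (iffP idP) => [/submxP[a ->] j jS|H].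
  rewrite mxE big1 // => i _; rewrite !mxE; case: eqP => [->|_]; last by rewrite mulr0n mulr0.
  by rewrite (negPf jS) mul0rn mulr0.
suff -> : v = v *m coordsp S by apply: submxMl.
apply/rowP => j; rewrite mul_mx_diag !mxE.
by case: (boolP (j \in S)) => [|/H ->]; rewrite ?mulr1 ?mul0r.
Qed.

Lemma csp_sub m (A : 'M_(m, D)) (S : {set I}) : (forall j, j \in S -> ((delta_mx 0 j : 'rV[F]_D) <= A)%MS) ->
  (coordsp S <= A)%MS.
Proof.
move=> H; apply/row_subP => i; rewrite row_csp.
by case: (boolP (i \in S)) => [/H|]; rewrite ?scale1r ?scale0r ?sub0mx.
Qed.

Lemma delta_csp (S : {set I}) j : ((delta_mx 0 j : 'rV[F]_D) <= coordsp S)%MS = (j \in S).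
Proof.
apply/sub_csp/idP => [H|jS k kS]; last first.
  by rewrite mxE eqxx /=; case: eqP => // kj; rewrite kj jS in kS.
apply/negPn/negP => /H; rewrite mxE !eqxx => /eqP; by rewrite oner_eq0.
Qed.

Lemma csp_subset S T : (coordsp S <= coordsp T)%MS = (S \subset T).
Proof.
apply/idP/fintype.subsetP => [ST x xS|ST].
  by rewrite -delta_csp (submx_trans _ ST) // delta_csp.
by apply: csp_sub => j /ST; rewrite delta_csp.
Qed.

Lemma csp_cap S T : (coordsp (S :&: T) :=: coordsp S :&: coordsp T)%MS.
Proof.
apply/eqmxP/andP; split.
  by rewrite sub_capmx !csp_subset finset.subsetIl finset.subsetIr.
apply/row_subP => i; apply/sub_csp => j; rewrite inE negb_and.
have : (row i (coordsp S :&: coordsp T)%MS <= coordsp S :&: coordsp T)%MS := row_sub _ _.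
rewrite sub_capmx => /andP[/sub_csp a /sub_csp b] /orP[]; [exact: a|exact: b].
Qed.

Lemma csp_add S T : (coordsp (S :|: T) :=: coordsp S + coordsp T)%MS.
Proof.
apply/eqmxP/andP; split.
  apply: csp_sub => j; rewrite inE => /orP[] jS.
    by apply: submx_trans (addsmxSl _ _); rewrite delta_csp.
  by apply: submx_trans (addsmxSr _ _); rewrite delta_csp.
by rewrite addsmx_sub !csp_subset finset.subsetUl finset.subsetUr.
Qed.

Lemma cspT : coordsp finset.setT = 1%:M.
Proof. by rewrite /coordsp -diag_const_mx; congr diag_mx; apply/rowP => j; rewrite !mxE inE. Qed.

Lemma csp0 : coordsp finset.set0 = 0.
Proof. by apply/row_matrixP => i; rewrite row_csp inE scale0r row0. Qed.

(** The ranks for S and for its complement add up to 2d, so the upper bound by cardinality is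
    attained for both. *)
Lemma rank_csp S : \rank (coordsp S) = #|S|.
Proof.
have le T : (\rank (coordsp T) <= #|T|)%N.
  have : (coordsp T <= \sum_(i in T) <<delta_mx 0 i : 'rV[F]_D>>)%MS.
    apply: csp_sub => j jT; apply: (sumsmx_sup j) => //; by rewrite genmxE.
  move/mxrankS/leq_trans; apply.
  apply: leq_trans (mxrank_sum_leqif _) _ => /=.
  rewrite -sum1_card; apply: leq_sum => i _; by rewrite mxrank_gen mxrank_delta.
apply/eqP; rewrite eqn_leq le /=.
have := mxrank_sum_cap (coordsp S) (coordsp (~: S)).
rewrite -csp_add -csp_cap finset.setICr csp0 mxrank0 addn0.
rewrite finset.setUCr cspT mxrank1 => E.
have := le (~: S); have := cardsC S; rewrite card_ord.
move=> H1 H2; move: E H1 H2; move: (\rank _) (\rank _) #|_| #|_| => a b x y; lia.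
Qed.

Lemma delta_Q x : delta_mx 0 x *m Q = delta_mx 0 (sg x) :> 'rV_D.
Proof. by rewrite -rowE; apply/rowP => j; rewrite [LHS]mxE QformE mxE eqxx. Qed.

Lemma perp_csp S : (perp (coordsp S) :=: coordsp [set x | sg x \notin S])%MS.
Proof.
apply/eqmxP; rewrite andbC.
have sub : (coordsp [set x | sg x \notin S] <= perp (coordsp S))%MS.
  apply: csp_sub => j; rewrite inE => jS; rewrite sub_perpE delta_Q.
  apply/eqP/rowP => k; rewrite tr_diag_mx mul_mx_diag !mxE eqxx /=.
  by case: eqP => [->|]; rewrite ?mul0r // (negPf jS) mulr0.
rewrite sub /= -(mxrank_leqif_sup sub) rank_perp !rank_csp.
have -> : [set x | sg x \notin S] = @sg d @: (~: S).
  apply/setP => x; rewrite inE; apply/idP/imsetP => [xS|[y + ->]].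
    by exists (sg x); rewrite ?inE ?sgK.
  by rewrite inE sgK.
rewrite card_imset; last exact: can_inj (@sgK d).
by have := cardsC S; rewrite card_ord; move: #|_| #|_| => a b; lia.
Qed.

Definition Qisometry (B : 'M[F]_D) := B *m Q *m B^T == Q.

Lemma isom_unit B : Qisometry B -> B \in unitmx.
Proof.
move=> /eqP /(congr1 (mulmx^~ Q)); rewrite Qform_sqr -!mulmxA => /mulmx1_unit[].
by [].
Qed.

Lemma isomV_E B : Qisometry B -> invmx B = Q *m B^T *m Q.
Proof.
move=> iB; have uB := isom_unit iB; move/eqP: iB => iB.
have : B *m (Q *m B^T *m Q) = 1%:M by rewrite !mulmxA iB Qform_sqr.
by move/(congr1 (mulmx (invmx B))); rewrite mulKmx // mulmx1.
Qed.

Lemma isom1 : Qisometry 1%:M. Proof. by rewrite /Qisometry mul1mx trmx1 mulmx1. Qed.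

Lemma isomM A B : Qisometry A -> Qisometry B -> Qisometry (A *m B).
Proof.
move=> /eqP iA /eqP iB; apply/eqP.
have -> : A *m B *m Q *m (A *m B)^T = A *m (B *m Q *m B^T) *m A^T.
  by rewrite trmx_mul !mulmxA.
by rewrite iB iA.
Qed.

Lemma isomV B : Qisometry B -> Qisometry (invmx B).
Proof.
move=> iB; have uB := isom_unit iB; move/eqP: iB => iB; rewrite /Qisometry -{1}iB.
by rewrite !mulmxA mulVmx // mul1mx -mulmxA -trmx_mul mulVmx // trmx1 mulmx1.
Qed.

Lemma perp_isom (A B : 'M[F]_D) : Qisometry B -> (perp (A *m B) :=: perp A *m B)%MS.
Proof.
move=> iB; have uB := isom_unit iB; apply/eqmxP; rewrite andbC.
have sub : (perp A *m B <= perp (A *m B))%MS.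
  rewrite sub_perpE trmx_mul !mulmxA; move/eqP: iB => iB.
  have -> : perp A *m B *m Q *m B^T *m A^T = perp A *m (B *m Q *m B^T) *m A^T.
    by rewrite !mulmxA.
  by rewrite iB -sub_perpE submx_refl.
rewrite sub /= -(mxrank_leqif_sup sub) rank_perp.
have fB : row_free B by rewrite row_free_unit.
by rewrite (mxrankMfree (perp A) fB) (mxrankMfree A fB) rank_perp.
Qed.

Lemma isom_perm (s : 'S_D) : s \in sgperm d -> Qisometry (perm_mx s).
Proof.
move=> /sgpermP cs; apply/eqP; rewrite tr_perm_mx -row_permE -col_permE.
apply/matrixP => i j; rewrite [LHS]mxE [LHS]mxE !QformE -cs.
by rewrite (inj_eq perm_inj).
Qed.

Lemma csp_perm (S : {set I}) (s : 'S_D) : (coordsp (s @: S) :=: coordsp S *m perm_mx s)%MS.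
Proof.
apply/eqmxP; rewrite andbC.
have sub : (coordsp S *m perm_mx s <= coordsp (s @: S))%MS.
  apply/row_subP => i; rewrite row_mul row_csp -scalemxAl -rowE.
  case: (boolP (i \in S)) => iS; rewrite ?scale0r ?sub0mx // scale1r.
  have -> : row i (perm_mx s) = delta_mx 0 (s i) :> 'rV[F]_D.
    by apply/rowP => j; rewrite !mxE eqxx eq_sym.
  by rewrite delta_csp imset_f.
rewrite sub /= -(mxrank_leqif_sup sub) mxrankMfree ?row_free_unit ?unitmx_perm //.
by rewrite !rank_csp card_imset //; exact: perm_inj.
Qed.
End Coordinates.

(** * The two families of maximal isotropic subspaces *)

Section Families.
Variables (F : finFieldType) (d : nat).
Hypothesis two : 2%N \notin [pchar F].
Local Notation D := (d + d)%N.
Local Notation I := 'I_(d + d).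
Local Notation Q := (Qform F d).
Local Notation coordsp := (@coordsp F d).

Lemma csp_mul_subset (S T : {set I}) (B : 'M[F]_D) : B \in unitmx ->
  (coordsp S *m B <= coordsp T *m B)%MS = (S \subset T).
Proof. by move=> uB; rewrite submxMfree ?row_free_unit // csp_subset. Qed.

Lemma csp_mul_inj (S T : {set I}) (B : 'M[F]_D) : B \in unitmx ->
  (coordsp S *m B :=: coordsp T *m B)%MS -> S = T.
Proof.
by move=> uB E; apply/eqP; rewrite finset.eqEsubset -!(csp_mul_subset _ _ uB) !E !submx_refl.
Qed.

Lemma rank_csp_mul (S : {set I}) (B : 'M[F]_D) : B \in unitmx ->
  \rank (coordsp S *m B) = #|S|.
Proof. by move=> uB; rewrite mxrankMfree ?row_free_unit // rank_csp. Qed.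

Lemma capmxMunit (A C B : 'M[F]_D) : B \in unitmx ->
  ((A :&: C) *m B :=: (A *m B) :&: (C *m B))%MS.
Proof.
move=> uB; apply/eqmxP; rewrite capmxMr /= -(mulmxKV uB (_ :&: _)%MS) submxMr // sub_capmx.
by rewrite -{2}(mulmxK uB A) -{3}(mulmxK uB C) !submxMr ?capmxSl ?capmxSr.
Qed.

Lemma csp_mul_cap (S T : {set I}) (B : 'M[F]_D) : B \in unitmx ->
  (coordsp (S :&: T) *m B :=: (coordsp S *m B) :&: (coordsp T *m B))%MS.
Proof.
move=> uB; apply: eqmx_trans (eqmxMr B (csp_cap F S T)) _.
exact: capmxMunit.
Qed.

Lemma csp_mul_add (S T : {set I}) (B : 'M[F]_D) :
  (coordsp (S :|: T) *m B :=: (coordsp S *m B) + (coordsp T *m B))%MS.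
Proof. exact: eqmx_trans (eqmxMr B (csp_add F S T)) (addsmxMr _ _ _). Qed.

(** The coordinate of v along row j of a hyperbolic basis is the pairing of v with row [sg j]; it
    vanishes on V when row j is not in V. *)
Lemma adapted_csp (B V : 'M[F]_D) : Qisometry B ->
    (forall x, (row x B <= V)%MS \/ (row (sg x) B <= perp V)%MS) ->
  (V :=: coordsp [set x | (row x B <= V)%MS] *m B)%MS.
Proof.
move=> iB ad; have uB := isom_unit iB; apply/eqmxP/andP; split; last first.
  apply/row_subP => i; rewrite row_mul row_csp -scalemxAl -rowE inE.
  by case: (boolP (row i B <= V)%MS); rewrite ?scale1r ?scale0r ?sub0mx.
rewrite -{1}(mulmxKV uB V); apply: submxMr; rewrite isomV_E //.
apply/row_subP => i; set v := row i V; rewrite row_mul -/v.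
apply/sub_csp => j; rewrite inE => /negP jV.
have -> : (v *m (Q *m B^T *m Q)) 0 j = bq v (row (sg j) B).
  rewrite bq_row !mulmxA [LHS]mxE (bigD1 (sg j)) //= QformE sgK eqxx mulr1.
  rewrite big1 ?addr0 // => k kj; rewrite QformE; case: eqP => [E|]; last by rewrite mulr0.
  by case/eqP: kj; rewrite E sgK.
have [h|p] := ad j; first by case: (jV h).
by rewrite bqC (bq0 p) // row_sub.
Qed.

Lemma frame s s' (Wm : 'M[F]_D) : isochain s -> isochain s' -> Wm \in s ->
    (Wm <= perp Wm)%MS -> \rank Wm = d ->
  exists2 B, Qisometry B & forall V, V \in s ++ s' ->
    (V :=: coordsp [set x | (row x B <= V)%MS] *m B)%MS.
Proof.
move=> cs cs' Ws iW rW; have [U [W [[UU WW UW] ad ad']]] := hyperbolic_basis two cs cs' Ws iW rW.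
have WU : W *m Q *m U^T = 1%:M.
  by move/(congr1 trmx): UW; rewrite !trmx_mul trmxK Qform_sym trmx1 mulmxA.
have iB : Qisometry (col_mx U W).
  by apply/eqP; rewrite tr_col_mx !mul_col_mx !mul_mx_row UU WW UW WU.
exists (col_mx U W) => // V Vs; apply: (adapted_csp iB) => x.
have {}Vs : (V \in s) || (V \in s') by rewrite -mem_cat.
have [a b] : adapted U W V /\ adapted W U V.
  case/orP: Vs => Vs; split.
  - exact: ad. - exact: (adapted_dual cs). - exact: ad'. - exact: (adapted_dual cs').
case: (split_ordP x) => i ->; rewrite ?sg_l ?sg_r rowKu rowKd; [exact: a|exact: b].
Qed.

Lemma max_isotropicP (U : 'M[F]_D) : reflect ((perp U :=: U)%MS /\ \rank U = d) (max_isotropic U).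
Proof.
apply: (iffP andP) => [[/eqP iU /eqP rU]|[E rU]].
  split=> //; have UU : (U <= perp U)%MS by rewrite sub_perpE iU.
  apply/eqmxP; rewrite andbC UU /= -(mxrank_leqif_sup UU) rank_perp rU addnK //.
by rewrite -sub_perpE E rU submx_refl.
Qed.

Lemma isochain3 (U : 'M[F]_D) : (perp U :=: U)%MS -> isochain [:: 0; U; 1%:M].
Proof.
move=> E; have p0 : (1%:M :=: perp (0 : 'M[F]_D))%MS.
  by apply/eqmxP; rewrite submx1 sub_perpE trmx0 mulmx0 eqxx.
split.
- move=> A B; rewrite !inE => /or3P[]/eqP-> /or3P[]/eqP->;
    by rewrite ?sub0mx ?submx1 ?submx_refl ?orbT.
- move=> A; rewrite !inE => /or3P[]/eqP->.
  + by exists 1%:M; rewrite ?inE ?eqxx ?orbT.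
  + by exists U; rewrite ?inE ?eqxx ?orbT //; apply: eqmx_sym.
  + exists 0; rewrite ?inE ?eqxx ?orbT //.
    by apply: eqmx_trans (eqmx_sym (perpK _)) _; apply/eqmx_perp/eqmx_sym.
- by exists 0; rewrite ?inE ?eqxx ?mxrank0.
Qed.

Lemma csp_max_isotropic (S : {set I}) (B : 'M[F]_D) : Qisometry B ->
  max_isotropic (coordsp S *m B) -> transversal_sg S.
Proof.
move=> iB /max_isotropicP[E _] x; have uB := isom_unit iB.
have : [set x | sg x \notin S] = S.
  apply: (csp_mul_inj uB); apply: eqmx_trans _ E; apply: eqmx_sym.
  by apply: eqmx_trans (perp_isom _ iB) _; apply: eqmxMr; apply: perp_csp.
by move=> /setP/(_ x); rewrite inE => <-; rewrite negbK.
Qed.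

Lemma transversal_max_isotropic (S : {set I}) (B : 'M[F]_D) : Qisometry B ->
  transversal_sg S -> max_isotropic (coordsp S *m B).
Proof.
move=> iB tS; apply/max_isotropicP; rewrite rank_csp_mul ?isom_unit // card_transversal_sg //.
split=> //; apply: eqmx_trans (perp_isom _ iB) _; apply: eqmxMr.
apply: eqmx_trans (perp_csp F S) _.
rewrite (_ : [set x | _] = S) //; by apply/setP => x; rewrite inE tS negbK.
Qed.

Lemma max_isotropic_eqmx (U V : 'M[F]_D) : (U :=: V)%MS -> max_isotropic U -> max_isotropic V.
Proof.
move=> E /max_isotropicP[p r]; apply/max_isotropicP; split; last by rewrite -E.
exact: eqmx_trans (eqmx_perp (eqmx_sym E)) (eqmx_trans p E).
Qed.

Lemma max_isotropic_isom (U g : 'M[F]_D) : Qisometry g -> max_isotropic U -> max_isotropic (U *m g).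
Proof.
move=> ig /max_isotropicP[p r]; apply/max_isotropicP.
rewrite mxrankMfree ?row_free_unit ?isom_unit //; split=> //.
exact: eqmx_trans (perp_isom _ ig) (eqmxMr _ p).
Qed.

Lemma frame2 (U U' : 'M[F]_D) : max_isotropic U -> max_isotropic U' ->
  exists B (S S' : {set I}), [/\ Qisometry B, transversal_sg S, transversal_sg S',
    (U :=: coordsp S *m B)%MS & (U' :=: coordsp S' *m B)%MS].
Proof.
move=> mU mU'; have [pU rU] := max_isotropicP _ mU; have [pU' rU'] := max_isotropicP _ mU'.
have [] := frame (isochain3 pU) (isochain3 pU') (Wm := U).
- by rewrite !inE eqxx orbT.
- by rewrite pU submx_refl.
- exact: rU.
move=> B iB H; exists B, [set x | (row x B <= U)%MS], [set x | (row x B <= U')%MS].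
have E : (U :=: coordsp [set x | (row x B <= U)%MS] *m B)%MS by apply: H; rewrite !inE eqxx !orbT.
have E' : (U' :=: coordsp [set x | (row x B <= U')%MS] *m B)%MS by apply: H; rewrite !inE eqxx !orbT.
split=> //; apply: (csp_max_isotropic iB).
  exact: max_isotropic_eqmx E mU.
exact: max_isotropic_eqmx E' mU'.
Qed.

Lemma csp_swap (S S' : {set I}) : transversal_sg S -> transversal_sg S' ->
  (coordsp S *m perm_mx (swap (swap_set S S')) :=: coordsp S')%MS.
Proof.
move=> tS tS'; apply: eqmx_trans (eqmx_sym (csp_perm _ _ _)) _.
rewrite (_ : _ @: _ = S') //; apply/setP => x; apply/imsetP/idP => [[y yS ->]|xS'].
  by rewrite swap_setE.
exists (swap (swap_set S S') x); last by rewrite swapK.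
by rewrite -(swap_setE _ tS tS') swapK.
Qed.

Lemma isom_swap T : Qisometry (perm_mx (swap T) : 'M[F]_D).
Proof. exact/isom_perm/swap_sgperm. Qed.

(** Such k is block triangular with diagonal blocks a and b, and the isometry condition gives a b^T
    = 1. *)
Lemma det_stab_low (k : 'M[F]_D) : Qisometry k ->
  (coordsp (low d) *m k <= coordsp (low d))%MS -> \det k = 1.
Proof.
move=> ik st.
have ur0 : ursubmx k = 0.
  apply/matrixP => i j; rewrite !mxE.
  have : (row (lshift d i) k <= coordsp (low d))%MS.
    by rewrite rowE (submx_trans _ st) // submxMr // delta_csp low_l.
  by move/sub_csp => H; have := H (rshift d j); rewrite low_r !mxE => ->.
move: ik; rewrite -(submxK k) ur0 /Qisometry det_lblock.
rewrite tr_block_mx trmx0 /Qform !mulmx_block !mul0mx !mulmx0 !mulmx1 !add0r !addr0 ?mul0mx ?mulmx0.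
move=> /eqP/eq_block_mx[_ E _ _]; rewrite -[\det (drsubmx k)]det_tr -det_mulmx.
by move: E; rewrite ?add0r ?addr0 => ->; rewrite det1.
Qed.

(** By a hyperbolic basis and a sign change, U is the image of the standard maximal isotropic
    subspace under an isometry; conjugating by it does not alter the determinant. *)
Lemma det_stab (U k : 'M[F]_D) : max_isotropic U -> Qisometry k ->
  (U *m k <= U)%MS -> \det k = 1.
Proof.
move=> mU ik st; have [B [S [_ [iB tS _ EU _]]]] := frame2 mU mU.
pose t : 'M[F]_D := perm_mx (swap (swap_set (low d) S)).
have it : Qisometry t := isom_swap _.
have uB := isom_unit iB; have ut := isom_unit it.
have Et : (coordsp (low d) *m t :=: coordsp S)%MS := csp_swap (@low_transversal d) tS.
have EU' : (U :=: coordsp (low d) *m (t *m B))%MS.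
  by apply: eqmx_trans EU _; apply: eqmx_sym; rewrite mulmxA; apply: eqmxMr.
have iB' := isomM it iB; have uB' := isom_unit iB'; move: (t *m B) EU' iB' uB' => B' EU' iB' uB'.
have ik' : Qisometry (B' *m k *m invmx B') by rewrite !isomM ?isomV.
have <- : \det (B' *m k *m invmx B') = \det k.
  by rewrite !det_mulmx mulrAC -det_mulmx mulmxV // det1 mul1r.
apply: det_stab_low => //; rewrite !mulmxA -[X in (_ <= X)%MS](mulmxK uB').
apply: submxMr; rewrite -EU'; apply: submx_trans st; apply: submxMr.
by rewrite EU'.
Qed.

(** The parity of the codimension of U :&: V in U, for maximal isotropic U and V; it is [false]
    within one family. *)
Definition fampar (U V : 'M[F]_D) : bool := odd (\rank (U :&: V)%MS) (+) odd d.

Lemma par_eqmx (U U' V V' : 'M[F]_D) : (U :=: U')%MS -> (V :=: V')%MS -> fampar U V = fampar U' V'.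
Proof. by move=> E E'; rewrite /fampar (cap_eqmx E E'). Qed.

Lemma parC U V : fampar U V = fampar V U.
Proof. by rewrite /fampar capmxC. Qed.

Lemma par_csp (S S' : {set I}) (B : 'M[F]_D) : Qisometry B ->
  transversal_sg S -> fampar (coordsp S *m B) (coordsp S' *m B) = odd (d - #|S :&: S'|).
Proof.
move=> iB tS; have uB := isom_unit iB; rewrite /fampar -(csp_mul_cap _ _ uB) rank_csp_mul //.
have := subset_leq_card (finset.subsetIl S S'); rewrite (card_transversal_sg tS) => le.
by rewrite oddB // addbC.
Qed.

(** In a common hyperbolic basis U and U' belong to transversals S and S', and the sign change at
    the d - #|S :&: S'| planes where these differ does it. *)
Lemma Qisometry_swap U U' : max_isotropic U -> max_isotropic U' ->
  exists2 h, Qisometry h & (U *m h :=: U')%MS /\ \det h = (-1) ^+ fampar U U'.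
Proof.
move=> mU mU'; have [B [S [S' [iB tS tS' EU EU']]]] := frame2 mU mU'.
pose t : 'M[F]_D := perm_mx (swap (swap_set S S')).
have it : Qisometry t := isom_swap _; have uB := isom_unit iB.
exists (invmx B *m t *m B); first by rewrite !isomM ?isomV.
split; last first.
  rewrite !det_mulmx mulrAC -det_mulmx mulVmx // det1 mul1r det_perm odd_swap.
  by rewrite (par_eqmx EU EU') par_csp // card_swap_set.
apply: eqmx_trans (eqmxMr _ EU) _; rewrite !mulmxA mulmxK //.
apply: eqmx_trans (eqmxMr _ (csp_swap tS tS')) _; exact: eqmx_sym.
Qed.

(** Any isometry h with the same image of U has the same determinant, as g h^-1 stabilizes U. *)
Lemma det_par U g : max_isotropic U -> Qisometry g -> \det g = (-1) ^+ fampar U (U *m g).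
Proof.
move=> mU ig; have mUg := max_isotropic_isom ig mU.
have [h ih [Uh <-]] := Qisometry_swap mU mUg.
have uh := isom_unit ih.
have k1 : \det (g *m invmx h) = 1.
  apply: (det_stab mU); first by rewrite isomM ?isomV.
  by rewrite mulmxA -[X in (_ <= X)%MS](mulmxK uh) submxMr // Uh.
by rewrite -[LHS]mulr1 -[in LHS](mulmxKV uh g) det_mulmx k1 mul1r mulr1.
Qed.

Lemma opp1_neq1 : -1 != 1 :> F.
Proof.
rewrite eq_sym -subr_eq0 opprK; apply: contra two => z2; by rewrite inE /= z2.
Qed.

Lemma sign_inj (b b' : bool) : (-1) ^+ b = (-1) ^+ b' :> F -> b = b'.
Proof.
by case: b b' => [] [] //= /eqP; rewrite expr0 expr1 ?[1 == _]eq_sym (negPf opp1_neq1).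
Qed.

(** Multiplicativity of the determinant, read through [det_par]. This is what makes the families an
    equivalence relation with two classes. *)
Lemma par_trans U V W : max_isotropic U -> max_isotropic V -> max_isotropic W ->
  fampar U W = fampar U V (+) fampar V W.
Proof.
move=> mU mV mW; have [h ih [Uh dh]] := Qisometry_swap mU mV.
have [k ik [Vk dk]] := Qisometry_swap mV mW.
apply: sign_inj; rewrite signr_addb -dh -dk -det_mulmx.
rewrite (det_par mU (isomM ih ik)); congr (_ ^+ nat_of_bool _); apply: par_eqmx => //.
rewrite mulmxA; apply: eqmx_sym; exact: eqmx_trans (eqmxMr _ Uh) Vk.
Qed.

(** The intersection has dimension d - 1 or d, and parity excludes d - 1. Thus a maximal isotropic
    subspace is determined by its family and a hyperplane in it. *)
Lemma par0_eqmx (U V E : 'M[F]_D) : max_isotropic U -> max_isotropic V ->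
  (E <= U)%MS -> (E <= V)%MS -> (d <= (\rank E).+1)%N -> fampar U V = false -> (U :=: V)%MS.
Proof.
move=> mU mV EU EV rE pUV; have [_ rU] := max_isotropicP _ mU.
have [_ rV] := max_isotropicP _ mV.
have rI : (\rank E <= \rank (U :&: V)%MS)%N by rewrite mxrankS // sub_capmx EU.
have : (\rank (U :&: V)%MS <= d)%N by rewrite -[X in (_ <= X)%N]rU mxrankS // capmxSl.
move: pUV; rewrite /fampar => /negbT; rewrite negb_add => /eqP pd le.
have rUV : \rank (U :&: V)%MS = d by move: rE rI le pd; move: (\rank _) (\rank _) => a b; clear; lia.
have sU : (U <= U :&: V)%MS by rewrite -(geq_leqif (mxrank_leqif_sup (capmxSl U V))) rUV rU.
have sV : (V <= U :&: V)%MS by rewrite -(geq_leqif (mxrank_leqif_sup (capmxSr U V))) rUV rV.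
apply/eqmxP; rewrite (submx_trans sU (capmxSr _ _)).
exact: submx_trans sV (capmxSl _ _).
Qed.

End Families.

(** * Coordinate flags *)

Section Colorings.
Variable d : nat.
Local Notation D := (d + d)%N.
Local Notation I := 'I_(d + d).

(* Replacing each value a by a representative of {a, rho a} reduces the claim to
   the lower half of the indices, where the equal counts give a permutation. *)
Lemma involution_coloring_perm (A : finType) (rho : A -> A) (c e : I -> A) :
    involutive rho -> (forall x, c (sg x) = rho (c x)) ->
    (forall x, e (sg x) = rho (e x)) ->
    (forall a, #|[set x | c x == a]| = #|[set x | e x == a]|) ->
  exists2 s, s \in sgperm d & forall x, e (s x) = c x.
Proof.
move=> rhoK cs es card_eq.
pose rep a := if (enum_rank a <= enum_rank (rho a))%N then a else rho a.
have rep_rho a : rep (rho a) = rep a.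
  rewrite /rep rhoK; case: (ltngtP (enum_rank a) (enum_rank (rho a))) => // E.
  by apply: enum_rank_inj; apply: val_inj.
have repP a b : rep a = rep b -> b = a \/ b = rho a.
  rewrite /rep; case: ifP => _; case: ifP => _ E.
  - by left; rewrite E.
  - by right; rewrite E rhoK.
  - by right; rewrite E.
  - by left; rewrite -[b]rhoK -E rhoK.
have card2 (f : I -> A) a : (forall x, f (sg x) = rho (f x)) ->
    #|[set x | rep (f x) == a]| = #|[set i | rep (f (lshift d i)) == a]|.*2.
  move=> fs; pose S := [set i | rep (f (lshift d i)) == a]; rewrite -/S -addnn.
  have E1 := card_imset (mem S) (@lshift_inj d d).
  have E2 := card_imset (mem S) (@rshift_inj d d).
  rewrite -{1}E1 -E2 -cardsUI (_ : _ :&: _ = finset.set0) ?cards0 ?addn0; last first.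
    apply/setP => x; rewrite !inE; apply/negP => /andP[/imsetP[i _ ->] /imsetP[j _]].
    by move/eqP; rewrite eq_lrshift.
  congr #|pred_of_set _|; apply/setP => x; rewrite !inE.
  case: (split_ordP x) => i ->.
    rewrite (mem_imset _ _ (@lshift_inj d d)) inE; case: eqP => //= _.
    apply/esym/negP => /imsetP[j _] /eqP; by rewrite eq_lrshift.
  rewrite -[rshift d i]sg_l fs rep_rho sg_l (mem_imset _ _ (@rshift_inj d d)) inE orbC.
  case: eqP => //= _.
  apply/esym/negP => /imsetP[j _] /eqP; by rewrite eq_rlshift.
have cardE (f : I -> A) a : #|[set x | rep (f x) == a]| =
    (\sum_(b | rep b == a) #|[set x | f x == b]|)%N.
  rewrite -sum1_card (partition_big f (fun b => rep b == a)) /=; last by move=> x; rewrite inE.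
  apply: eq_bigr => b /eqP rb; rewrite -sum1_card; apply: eq_bigl => x.
  by rewrite !inE; case: (f x =P b) => [->|]; rewrite ?andbF // rb eqxx.
pose u (f : I -> A) := [tuple rep (f (lshift d i)) | i < d].
have cu f a : count_mem a (u f) = #|[set i | rep (f (lshift d i)) == a]|.
  rewrite /= count_map -sum1_count big_enum_cond /= -sum1_card.
  by apply: eq_bigl => i; rewrite inE.
have /tuple_permP[p Ep] : perm_eq (u c) (u e).
  apply/allP => a _ /=; apply/eqP; rewrite !cu; apply: double_inj.
  by rewrite -!card2 // !cardE; apply: eq_bigr => b _; apply: card_eq.
have Ep' i : rep (c (lshift d i)) = rep (e (lshift d (p i))).
  have := congr1 (fun t => nth (rep (c (lshift d i))) t i) Ep.
  by rewrite -!tnth_nth !tnth_mktuple.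
pose z x : I := lshift d (p (hidx x)).
(* The permutation p matches colors only up to [rho]; passing to the dual index where necessary
   makes them match exactly. *)
pose y x := if e (z x) == c (lshift d (hidx x)) then z x else sg (z x).
pose s x := if x \in low d then y x else sg (y x).
have ey x : e (y x) = c (lshift d (hidx x)).
  rewrite /y; case: eqP => // ne; rewrite es.
  by have [E|E] := repP _ _ (Ep' (hidx x)); [case: ne; rewrite /z E|rewrite /z E rhoK].
have s_sg x : s (sg x) = sg (s x).
  by rewrite /s low_sg /y /z hidx_sg; case: (_ \in _); rewrite ?sgK.
have hs x : hidx (s x) = p (hidx x).
  by rewrite /s /y /z; do 2!case: ifP => _; rewrite ?hidx_sg hidx_l.
have s_inj : injective s.
  move=> x x' E; have /perm_inj/hidx_eq[->//|E'] : p (hidx x) = p (hidx x') by rewrite -!hs E.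
  by move/eqP: E; rewrite E' s_sg eq_sym sg_neq.
exists (perm s_inj); first by apply/sgpermP => x; rewrite !permE.
move=> x; rewrite permE /s; case: (split_ordP x) => i ->.
  by rewrite low_l ey hidx_l.
by rewrite low_r es ey hidx_r -cs sg_l.
Qed.

Definition equivariant m (c : {ffun I -> 'I_m}) : bool :=
  [forall x, c (sg x) == rev_ord (c x)].

Lemma equivariantP m (c : {ffun I -> 'I_m}) :
  reflect (forall x, c (sg x) = rev_ord (c x)) (equivariant c).
Proof. exact: 'forall_eqP. Qed.

(** By [relpos_cflag], the relative position of the flags with colorings c and c', for every field
    and every hyperbolic basis. *)
Definition crel m m' (c : {ffun I -> 'I_m}) (c' : {ffun I -> 'I_m'}) : 'M[int]_(m, m') :=
  \matrix_(k, l) (#|[set x | (c x == k) && (c' x == l)]|%:Z).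

Lemma crel_perm m m' (c e : {ffun I -> 'I_m}) (c' e' : {ffun I -> 'I_m'}) :
    equivariant c -> equivariant e -> equivariant c' -> equivariant e' ->
    crel c c' = crel e e' ->
  exists2 s, s \in sgperm d & forall x, e (s x) = c x /\ e' (s x) = c' x.
Proof.
move=> /equivariantP qc /equivariantP qe /equivariantP qc' /equivariantP qe' E.
pose rho (a : 'I_m * 'I_m') := (rev_ord a.1, rev_ord a.2).
have [||||s ss H] := @involution_coloring_perm _ rho (fun x => (c x, c' x)) (fun x => (e x, e' x)).
- by move=> [a b]; rewrite /rho /= !rev_ordK.
- by move=> x; rewrite qc qc'.
- by move=> x; rewrite qe qe'.
- move=> [a b]; have /(congr1 (fun A : 'M_(m, m') => A a b)) := E.
  by rewrite !mxE => -[].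
by exists s => // x; have [-> ->] := H x.
Qed.

Definition below m (c : {ffun I -> 'I_m}) (k : nat) : {set I} := [set x | (c x < k)%N].

End Colorings.

Section CoordinateFlags.
Variables (F : finFieldType) (d : nat).
Hypothesis two : 2%N \notin [pchar F].
Local Notation D := (d + d)%N.
Local Notation I := 'I_(d + d).
Local Notation Q := (Qform F d).
Local Notation coordsp := (@coordsp F d).

Definition flag_act m (g : 'M[F]_D) (V : preflag F d m) : preflag F d m :=
  [ffun i => <<V i *m g>>%MS].

Lemma movesE m g (V V' : preflag F d m) : moves g V V' = (V' == flag_act g V).
Proof.
apply/forallP/eqP => [H|-> i]; last by rewrite ffunE.
by apply/ffunP => i; rewrite ffunE; apply/eqP.
Qed.

Lemma flag_actM m g h (V : preflag F d m) : flag_act h (flag_act g V) = flag_act (g *m h) V.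
Proof.
apply/ffunP => i; rewrite !ffunE; apply/eq_genmx; rewrite mulmxA.
exact/eqmxMr/genmxE.
Qed.

Lemma flag_act1 m (V : preflag F d m) : is_flag V -> flag_act 1%:M V = V.
Proof.
by case/and5P=> /forallP cV _ _ _ _; apply/ffunP => i; rewrite ffunE mulmx1; apply/eqP.
Qed.

Definition cflag m (B : 'M[F]_D) (c : {ffun I -> 'I_m}) : preflag F d m :=
  [ffun k : 'I_m.+1 => <<coordsp (below c k) *m B>>%MS].

Lemma act_cflag m g B (c : {ffun I -> 'I_m}) : flag_act g (cflag B c) = cflag (B *m g) c.
Proof.
apply/ffunP => i; rewrite !ffunE; apply/eq_genmx; rewrite mulmxA.
exact/eqmxMr/genmxE.
Qed.

Lemma cflagE m B (c : {ffun I -> 'I_m}) (k : 'I_m.+1) :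
  (cflag B c k :=: coordsp (below c k) *m B)%MS.
Proof. by rewrite ffunE; apply: genmxE. Qed.

Lemma below_sub m (c : {ffun I -> 'I_m}) i j : (i <= j)%N -> below c i \subset below c j.
Proof. by move=> ij; apply/fintype.subsetP => x; rewrite !inE => /leq_trans; apply. Qed.

Lemma is_flag_cflag m B (c : {ffun I -> 'I_m}) : Qisometry B -> equivariant c ->
  is_flag (cflag B c).
Proof.
move=> iB /equivariantP qc; have uB := isom_unit iB; apply/and5P; split.
- by apply/forallP => i; rewrite ffunE genmx_id.
- rewrite cflagE rank_csp_mul // cards_eq0; apply/eqP/setP => x.
  by rewrite !inE.
- rewrite cflagE rank_csp_mul // (_ : below c _ = finset.setT).
    by rewrite cardsT card_ord.
  by apply/setP => x; rewrite !inE ltn_ord.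
- apply/forallP => i; rewrite !cflagE csp_mul_subset // below_sub //.
  by rewrite !inordK // ltnS // ltnW.
- apply/forallP => i; apply/eqmxP; apply: eqmx_trans (cflagE _ _ _) _; apply: eqmx_sym.
  apply: eqmx_trans (eqmx_perp (cflagE _ _ _)) _.
  apply: eqmx_trans (perp_isom _ iB) _; apply: eqmxMr.
  apply: eqmx_trans (perp_csp F _) _.
  rewrite (_ : [set x | _] = below c i) //; apply/setP => x; rewrite !inE qc /=.
  have := ltn_ord (c x); have := ltn_ord i; move: (nat_of_ord i) (nat_of_ord (c x)) => a b; clear; lia.
Qed.

Lemma flag_nested m (V : preflag F d m) (i j : 'I_m.+1) : is_flag V -> (i <= j)%N ->
  (V i <= V j)%MS.
Proof.
case/and5P=> _ _ _ /forallP nV _.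
have H k : (i + k < m.+1)%N -> (V i <= V (inord (i + k)))%MS.
  elim: k => [|k IH] le; first by rewrite addn0 inord_val submx_refl.
  have lt : (i + k < m)%N by rewrite -addnS.
  rewrite (submx_trans (IH _)) ?ltnS 1?ltnW //.
  by have := nV (Ordinal lt); rewrite /= addnS.
by move=> ij; have := H (j - i)%N; rewrite subnKC // inord_val; apply.
Qed.

Lemma flag_perp m (V : preflag F d m) i : is_flag V -> (V i :=: perp (V (rev_ord i)))%MS.
Proof. by case/and5P=> _ _ _ _ /forallP pV; apply/eqmxP. Qed.

Lemma isochain_flag m (V : preflag F d m) : is_flag V -> isochain (codom V).
Proof.
move=> fV; split.
- move=> A B /codomP[i ->] /codomP[j ->]; have /orP[ij|ji] := leq_total i j.
    by rewrite (flag_nested fV ij).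
  by rewrite (flag_nested fV ji) orbT.
- move=> A /codomP[i ->]; exists (V (rev_ord i)); first exact: codom_f.
  by rewrite -{2}(rev_ordK i); apply: flag_perp.
- exists (V ord0); first exact: codom_f.
  by case/and5P: fV => _ /eqP.
Qed.

Variables (M : 'M[F]_D) (mM : max_isotropic M).

(* The sum of the largest isotropic V of the flag with perp V :&: M has
   dimension d. *)
Lemma isochain_refine m (V : preflag F d m) : is_flag V ->
  exists U : 'M[F]_D, [/\ isochain (U :: codom V), (U <= perp U)%MS & \rank U = d].
Proof.
move=> fV; have [pM rM] := max_isotropicP _ mM.
(* [m./2] is the largest k with k <= m - k, where V_k lies in its orthogonal V_(m-k). *)
have hm : (m./2 < m.+1)%N by rewrite ltnS; lia.
pose h := Ordinal hm; pose W := V h.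
have Wiso : (W <= perp W)%MS.
  rewrite /W -{2}(rev_ordK h) -(flag_perp (rev_ord h) fV); apply: flag_nested => //=.
  rewrite subSS; have := odd_double_half m; rewrite -addnn; lia.
pose U := (W + (perp W :&: M))%MS.
have iU : (U <= perp U)%MS.
  have WU : (W <= perp U)%MS.
    by rewrite perp_sym addsmx_sub Wiso capmxSl.
  rewrite addsmx_sub WU /= perp_sym addsmx_sub; apply/andP; split.
    by rewrite perp_sym capmxSl.
  rewrite (submx_trans (capmxSr _ _)) // -{1}pM perpS // capmxSr //.
(* Since perp M = M, the space perp W :&: M is the orthogonal of W + M. In dim W + dim (perp W :&:
   M) - dim (W :&: M) the dimension of W then cancels and 2d - d remains. *)
have rU : \rank U = d.
  have E1 := mxrank_sum_cap W (perp W :&: M)%MS.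
  have E2 : (W :&: (perp W :&: M) :=: W :&: M)%MS.
    apply/eqmxP; rewrite !sub_capmx !capmxSl /= (submx_trans (capmxSr _ _)) ?capmxSr //.
    by rewrite (submx_trans (capmxSl _ _) Wiso).
  have E3 : (perp (W + M)%MS :=: perp W :&: M)%MS.
    by apply: eqmx_trans (perp_adds _ _) _; apply: cap_eqmx.
  have E4 := mxrank_sum_cap W M; have E5 := rank_perp (W + M)%MS.
  have E6 : (\rank (W + M)%MS <= D)%N := rank_leq_col _.
  rewrite E2 -E3 E5 in E1; move: E1 E4 E6; rewrite rM -/U.
  move: (\rank _) (\rank _) (\rank _) (\rank _) => a b e f; lia.
exists U; split=> //; have [tot per zer] := isochain_flag fV.
have cmp i : (V i <= U)%MS || (U <= V i)%MS.
  have [ih|hi] := leqP i h.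
    by rewrite (submx_trans (flag_nested fV ih)) // addsmxSl.
  apply/orP; right; rewrite addsmx_sub (flag_nested fV (ltnW hi)) /=.
  rewrite (submx_trans (capmxSl _ _)) //.
  have E : (perp W :=: V (rev_ord h))%MS.
    by have := flag_perp (rev_ord h) fV; rewrite rev_ordK => E; apply: eqmx_sym.
  rewrite E flag_nested //= subSS; move: hi => /=; lia.
split.
- move=> A B; rewrite !inE => /predU1P[->|As] /predU1P[->|Bs].
  + by rewrite submx_refl.
  + by case/codomP: Bs => i ->; rewrite orbC cmp.
  + by case/codomP: As => i ->; rewrite cmp.
  + exact: tot.
- move=> A; rewrite inE => /predU1P[->|/per[B Bs E]]; last by exists B; rewrite ?inE ?Bs ?orbT.
  exists U; rewrite ?inE ?eqxx //; apply/eqmxP; rewrite iU -(geq_leqif (mxrank_leqif_sup iU)).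
  by rewrite rank_perp rU addnK leqnn.
- by have [A As rA] := zer; exists A; rewrite ?inE ?As ?orbT.
Qed.

Lemma coloring_of_basis m (V : preflag F d m) B : is_flag V -> Qisometry B ->
    (forall i, (V i :=: coordsp [set x | (row x B <= V i)%MS] *m B)%MS) ->
  exists2 c : {ffun I -> 'I_m}, equivariant c & V = cflag B c.
Proof.
move=> fV iB H; have uB := isom_unit iB.
pose S i := [set x | (row x B <= V i)%MS].
have S0 : S ord0 = finset.set0.
  apply/eqP; rewrite -cards_eq0 -(rank_csp_mul _ uB) -H.
  by case/and5P: fV.
have Sm : S ord_max = finset.setT.
  apply/eqP; rewrite eqEcard finset.subsetT /= cardsT card_ord -(rank_csp_mul _ uB) -H.
  by case/and5P: fV => _ _ /eqP->.
have Sle (i j : 'I_m.+1) x : (i <= j)%N -> x \in S i -> x \in S j.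
  by move=> /(flag_nested fV) ij; rewrite !inE => /submx_trans; apply.
(* The color of x is one less than the first index at which row x of B enters the flag. *)
have cex x : exists i : 'I_m, forall k : 'I_m.+1, (x \in S k) = (i < k)%N.
  have ex : exists k : nat, (k <= m)%N && (x \in S (inord k)).
    exists m; rewrite leqnn /= (_ : inord m = ord_max) ?Sm ?inE //.
    by apply: val_inj; rewrite /= inordK.
  case: (ex_minnP ex) => k0 /andP[k0m xk0] mn.
  have k0_gt0 : (0 < k0)%N.
    rewrite lt0n; apply/eqP => E; move: xk0; rewrite E (_ : inord 0 = ord0) ?S0 ?inE //.
    by apply: val_inj; rewrite /= inordK.
  have lt : (k0.-1 < m)%N by rewrite prednK.
  exists (Ordinal lt) => k /=; rewrite prednK //; apply/idP/idP => [xk|].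
    by apply: mn; rewrite -ltnS ltn_ord inord_val.
  by move=> k0k; apply: Sle xk0; rewrite inordK.
have [c cE] := boolp.choice cex.
have dual x (k : 'I_m.+1) : (sg x \in S k) = (x \notin S (rev_ord k)).
  have E : (V k :=: coordsp [set x | sg x \notin S (rev_ord k)] *m B)%MS.
    apply: eqmx_trans (flag_perp k fV) _.
    apply: eqmx_trans (eqmx_perp (H _)) _; apply: eqmx_trans (perp_isom _ iB) _.
    apply: eqmxMr; exact: perp_csp.
  have -> : S k = [set x | sg x \notin S (rev_ord k)].
    by apply: (csp_mul_inj uB); apply: eqmx_trans E; apply: eqmx_sym.
  by rewrite inE sgK.
exists (finfun c).
  apply/equivariantP => x; rewrite !ffunE; apply: val_inj => /=.
  have K k : (k <= m)%N -> (c (sg x) < k)%N = (m - k <= c x)%N.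
    move=> km; have := dual x (inord k); rewrite !cE /= -leqNgt subSS.
    by rewrite inordK.
  have := K (c (sg x)) (ltnW (ltn_ord _)); have := K (c (sg x)).+1 (ltn_ord _).
  have := ltn_ord (c x); have := ltn_ord (c (sg x)).
  rewrite ltnn ltnSn; move: (nat_of_ord (c (sg x))) (nat_of_ord (c x)) => a b.
  by move=> am bm /esym h1 /esym/negbT; rewrite -ltnNge => h2; move: am bm h1 h2; lia.
have cV : [forall i, <<V i>>%MS == V i] by case/and5P: fV.
apply/ffunP => k; rewrite ffunE -(eqP (forallP cV k)); apply/eq_genmx.
rewrite (_ : below _ _ = S k) //; apply/setP => x.
by rewrite cE inE ffunE.
Qed.

Lemma flag_frame m m' (V : preflag F d m) (V' : preflag F d m') :
    is_flag V -> is_flag V' ->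
  exists B (c : {ffun I -> 'I_m}) (c' : {ffun I -> 'I_m'}),
    [/\ Qisometry B, equivariant c, equivariant c', V = cflag B c & V' = cflag B c'].
Proof.
move=> fV fV'; have [U [cU iU rU]] := isochain_refine fV.
have [B iB H] := frame two cU (isochain_flag fV') (mem_head _ _) iU rU.
have [|c qc Ec] := coloring_of_basis fV iB.
  by move=> i; apply: H; rewrite mem_cat inE codom_f orbT.
have [|c' qc' Ec'] := coloring_of_basis fV' iB.
  by move=> i; apply: H; rewrite mem_cat codom_f orbT.
by exists B, c, c'.
Qed.

Lemma relpos_cflag m m' B (c : {ffun I -> 'I_m}) (c' : {ffun I -> 'I_m'}) :
  Qisometry B -> relpos (cflag B c) (cflag B c') = crel c c'.
Proof.
move=> iB; have uB := isom_unit iB; apply/matrixP => k l; rewrite !mxE.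
have E (i j : 'I_m.+1) (a : 'I_m'.+1) :
    \rank (cflag B c i + cflag B c j :&: cflag B c' a)%MS =
    #|below c i :|: (below c j :&: below c' a)|.
  rewrite -(rank_csp_mul _ uB); apply: eqmx_rank; apply/eqmxP.
  apply: eqmx_sym; apply: eqmx_trans (csp_mul_add _ _ _) _.
  apply: adds_eqmx; first exact/eqmx_sym/cflagE.
  apply: eqmx_trans (csp_mul_cap _ _ uB) _.
  by apply: cap_eqmx; apply/eqmx_sym/cflagE.
rewrite !E; set P := _ :|: _; set P' := _ :|: _.
have P'P : P' \subset P.
  apply: finset.setUS; apply: finset.setIS; apply: below_sub.
  by rewrite !inordK // ltnS // ltnW.
have -> : [set x | (c x == k) && (c' x == l)] = P :\: P'.
  apply/setP => x; rewrite !inE !inordK ?ltnS // ?(ltnW (ltn_ord _)) //.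
  rewrite -!(inj_eq val_inj) /= ?ltnS.
  by move: (nat_of_ord (c x)) (nat_of_ord k) (nat_of_ord (c' x)) (nat_of_ord l) => a b e f; clear; lia.
rewrite cardsD (finset.setIidPr P'P) subzn //; exact: subset_leq_card.
Qed.

Lemma rank_act m m' g (V : preflag F d m) (V' : preflag F d m') i j k :
  g \in unitmx -> \rank (flag_act g V i + flag_act g V j :&: flag_act g V' k)%MS =
                  \rank (V i + V j :&: V' k)%MS.
Proof.
move=> ug; rewrite -[RHS](mxrankMfree _ (_ : row_free g)) ?row_free_unit //.
apply: eqmx_rank; apply/eqmxP; apply: eqmx_sym; apply: eqmx_trans (addsmxMr _ _ _) _.
rewrite !ffunE; apply: adds_eqmx; first exact/eqmx_sym/genmxE.
apply: eqmx_trans (capmxMunit _ _ ug) _.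
by apply: cap_eqmx; apply/eqmx_sym/genmxE.
Qed.

Lemma relpos_act m m' g (V : preflag F d m) (V' : preflag F d m') :
  g \in unitmx -> relpos (flag_act g V) (flag_act g V') = relpos V V'.
Proof. by move=> ug; apply/matrixP => k l; rewrite !mxE !rank_act. Qed.

Lemma cflag_perm m B (s : 'S_D) (c e : {ffun I -> 'I_m}) :
  (forall x, e (s x) = c x) -> cflag (perm_mx s *m B) c = cflag B e.
Proof.
move=> H; apply/ffunP => k; rewrite !ffunE; apply/eq_genmx; rewrite mulmxA.
apply: eqmxMr; apply: eqmx_trans (eqmx_sym (csp_perm _ _ _)) _.
rewrite (_ : _ @: _ = below e k) //; apply/setP => x; apply/imsetP/idP => [[y + ->]|].
  by rewrite !inE H.
by exists (s^-1%g x); rewrite ?permKV // inE -H permKV; move: H0; rewrite inE.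
Qed.

Lemma relpos_sep m m' (V W : preflag F d m) (V' W' : preflag F d m') :
    is_flag V -> is_flag V' -> is_flag W -> is_flag W' ->
    relpos V V' = relpos W W' ->
  exists2 g, Qisometry g & flag_act g V = W /\ flag_act g V' = W'.
Proof.
move=> fV fV' fW fW'.
have [B [c [c' [iB qc qc' -> ->]]]] := flag_frame fV fV'.
have [A [e [e' [iA qe qe' -> ->]]]] := flag_frame fW fW'.
rewrite !relpos_cflag // => /(crel_perm qc qe qc' qe')[s ss H].
have uB := isom_unit iB.
exists (invmx B *m perm_mx s *m A); first by rewrite !isomM ?isomV ?isom_perm.
rewrite !act_cflag -!mulmxA !mulKVmx //.
by split; apply: cflag_perm => x; have [] := H x.
Qed.

Lemma det_isom (g : 'M[F]_D) : Qisometry g -> \det g = 1 \/ \det g = -1.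
Proof. by move=> ig; rewrite (det_par two mM ig); case: fampar; [right|left]. Qed.

End CoordinateFlags.

(** * Signed labels *)

Section CombinatorialLabels.
Variables (n d : nat).
Local Notation N := (n.*2.+1).
Local Notation D := (d + d)%N.
Local Notation I := 'I_(d + d).

Lemma val_mid : mid n = n :> nat.
Proof. by rewrite inordK // ltnS -addnn leq_addr. Qed.

Lemma rev_mid : rev_ord (mid n) = mid n.
Proof. by apply: val_inj; rewrite /= val_mid; lia. Qed.

(** The index set of the subspace [famsp] of two coordinate flags. It is a transversal as soon as no
    index has the middle color in both colorings. *)
Definition famset (c c' : {ffun I -> 'I_N}) : {set I} :=
  if (#|below c n| < d)%N then
    if (#|below c' n| < d)%N then below c n :|: (below c n.+1 :&: below c' n)
    else below c' n
  else below c n.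

(** At least d indices with color below n, together with their duals of color above n, exhaust all
    2d indices. *)
Lemma below_full (c : {ffun I -> 'I_N}) x : equivariant c -> (d <= #|below c n|)%N ->
  c x != mid n.
Proof.
move=> /equivariantP qc le; apply/eqP => cx.
have E : below c n :|: @sg d @: below c n = finset.setT.
  apply/eqP; rewrite eqEcard finset.subsetT cardsT card_ord.
  have := cardsUI (below c n) (@sg d @: below c n).
  rewrite card_imset; last exact: can_inj (@sgK d).
  rewrite (_ : _ :&: _ = finset.set0) ?cards0 ?addn0 => [->|]; first exact: leq_add.
  apply/setP => y; rewrite !inE; apply/negP => /andP[yc /imsetP[z + E]].
  by move: yc; rewrite E !inE qc /= => h1 h2; move: h1 h2; move: (nat_of_ord (c z)) => a; lia.
have : x \in below c n :|: @sg d @: below c n by rewrite E inE.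
rewrite !inE cx val_mid ltnn /= => /imsetP[y + E'].
have := congr1 c E'; rewrite qc cx => /(congr1 (@rev_ord _)); rewrite rev_mid rev_ordK => e.
by rewrite inE -e val_mid ltnn.
Qed.

Lemma famset_transversal (c c' : {ffun I -> 'I_N}) : equivariant c -> equivariant c' ->
  (forall x, c x = mid n -> c' x = mid n -> False) -> transversal_sg (famset c c').
Proof.
move=> qc qc' H x; have Ec := equivariantP _ qc x; have Ec' := equivariantP _ qc' x.
have h (c1 : {ffun I -> 'I_N}) : equivariant c1 -> (#|below c1 n| < d)%N = false ->
    (nat_of_ord (c1 x)) <> n.
  move=> q1 /negbT; rewrite -leqNgt => le; apply/eqP; have := below_full x q1 le.
  by rewrite -(inj_eq val_inj) /= val_mid.
have {}H : (nat_of_ord (c x)) = n -> (nat_of_ord (c' x)) = n -> False.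
  by move=> e e'; apply: (H x); apply: val_inj; rewrite /= val_mid.
move: H.
have := ltn_ord (c x); have := ltn_ord (c' x).
rewrite /famset; case: ifP => [_|/(h c qc)]; last first.
  rewrite !inE Ec /=; move: (nat_of_ord (c x)) (nat_of_ord (c' x)) => a b; lia.
case: ifP => [_|/(h c' qc')].
  rewrite !inE Ec Ec' /=; move: (nat_of_ord (c x)) (nat_of_ord (c' x)) => a b; lia.
rewrite !inE Ec' /=; move: (nat_of_ord (c x)) (nat_of_ord (c' x)) => a b; lia.
Qed.

Lemma crel_mid_gt0 (c c' : {ffun I -> 'I_N}) :
  reflect (exists x, c x = mid n /\ c' x = mid n) (0 < crel c c' (mid n) (mid n)).
Proof.
rewrite mxE ltz_nat; apply: (iffP card_gt0P) => [[x]|[x [e e']]].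
  by rewrite inE => /andP[/eqP e /eqP e']; exists x.
by exists x; rewrite inE e e' eqxx.
Qed.

Definition clabXX (p : {ffun I -> 'I_N} * {ffun I -> 'I_N}) : signed n :=
  let A := crel p.1 p.2 in
  (A, if 0 < A (mid n) (mid n) then None
      else Some (odd #|famset p.1 p.2 :&: low d| == odd d)).

Definition CX := {c : {ffun I -> 'I_N} | equivariant c}.
Definition CY := {f : {ffun I -> 'I_D} |
  [&& equivariant f, injectiveb f & odd #|below f d :&: low d| == odd d]}.

End CombinatorialLabels.

Section Labels.
Variables (F : finFieldType) (n d : nat).
Hypothesis two : 2%N \notin [pchar F].
Hypothesis d_gt0 : (0 < d)%N.
Local Notation N := (n.*2.+1).
Local Notation D := (d + d)%N.
Local Notation I := 'I_(d + d).
Local Notation coordsp := (@coordsp F d).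
Variables (M : 'M[F]_D) (mM : max_isotropic M).

Lemma standard_frame : exists2 T, Qisometry T & (coordsp (low d) *m T :=: M)%MS.
Proof.
have m0 : max_isotropic (coordsp (low d) *m 1%:M).
  exact: (transversal_max_isotropic (isom1 _ _) (@low_transversal d)).
have [T iT [E _]] := Qisometry_swap two m0 mM.
by exists T => //; rewrite -[coordsp _]mulmx1.
Qed.

Lemma SO_mxP (g : 'M[F]_D) : reflect (Qisometry g /\ \det g = 1) (SO_mx g).
Proof. by apply: (iffP andP) => [[ig /eqP]|[ig ->]]; rewrite ?eqxx. Qed.

Lemma same_familyE U : same_family M U = ~~ fampar U M.
Proof. by rewrite /same_family /fampar; case: odd; case: odd. Qed.

Lemma same_family_eqmx (U V : 'M[F]_D) : (U :=: V)%MS -> same_family M U = same_family M V.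
Proof. by move=> E; rewrite !same_familyE (par_eqmx E (eqmx_refl M)). Qed.

Lemma same_family_isom (U g : 'M[F]_D) : max_isotropic U -> Qisometry g ->
  (same_family M (U *m g) == same_family M U) = (\det g == 1).
Proof.
move=> mU ig; have mUg := max_isotropic_isom ig mU.
rewrite !same_familyE (par_trans two mU mUg mM) (det_par two mU ig).
by case: (fampar U _); case: (fampar _ M); rewrite ?eqxx //= expr1 (negPf (opp1_neq1 two)).
Qed.

Lemma is_flag_act m g (V : preflag F d m) : Qisometry g -> is_flag V -> is_flag (flag_act g V).
Proof.
move=> ig fV; have [B [c [_ [iB qc _ -> _]]]] := flag_frame two mM fV fV.
by rewrite act_cflag is_flag_cflag // isomM.
Qed.

Section Standard.
Variables (T : 'M[F]_D) (iT : Qisometry T) (ET : (coordsp (low d) *m T :=: M)%MS).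

Lemma same_family_csp (S : {set I}) : same_family M (coordsp S *m T) = (odd #|S :&: low d| == odd d).
Proof.
rewrite /same_family -(rank_csp_mul _ (isom_unit iT)).
by rewrite (csp_mul_cap _ _ (isom_unit iT)) (cap_eqmx (eqmx_refl _) ET).
Qed.

Definition refl_mx i : 'M[F]_D := perm_mx (swap [set i]).

Lemma det_refl i : \det (refl_mx i) = -1.
Proof. by rewrite det_perm odd_swap cards1. Qed.

(** If the basis change has determinant -1, a reflection exchanging two dual basis vectors is
    inserted and absorbed into both colorings. Here d > 0 provides the hyperbolic plane. *)
Lemma SO_bruhat m m' (V : preflag F d m) (V' : preflag F d m') :
    is_flag V -> is_flag V' ->
  exists g (c : {ffun I -> 'I_m}) (c' : {ffun I -> 'I_m'}),
    [/\ SO_mx g, equivariant c, equivariant c', V = flag_act g (cflag T c)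
      & V' = flag_act g (cflag T c')].
Proof.
move=> fV fV'; have [B [c [c' [iB qc qc' -> ->]]]] := flag_frame two mM fV fV'.
have uT := isom_unit iT.
have dB : \det (invmx T *m B) = 1 \/ \det (invmx T *m B) = -1.
  by apply: (det_isom two mM); rewrite isomM ?isomV.
have [dB1|dBN] := dB.
  exists (invmx T *m B), c, c'; rewrite !act_cflag mulKVmx //; split=> //.
  by apply/SO_mxP; rewrite isomM ?isomV.
pose i0 := Ordinal d_gt0; pose s := swap [set i0].
exists (invmx T *m (refl_mx i0 *m B)), [ffun x => c (s x)], [ffun x => c' (s x)].
have q k (e : {ffun I -> 'I_k}) : equivariant e -> equivariant [ffun x => e (s x)].
  move=> /equivariantP qe; apply/equivariantP => x; rewrite !ffunE -qe.
  by have /sgpermP -> := swap_sgperm [set i0].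
rewrite !act_cflag mulKVmx //; split; rewrite ?q //.
- apply/SO_mxP; rewrite isomM ?isomV ?isomM ?isom_swap //; split=> //.
  by rewrite !det_mulmx det_refl mulrCA -det_mulmx dBN mulrNN mulr1.
- by rewrite (@cflag_perm _ _ _ _ s _ c) // => x; rewrite ffunE.
- by rewrite (@cflag_perm _ _ _ _ s _ c') // => x; rewrite ffunE.
Qed.
End Standard.

(* The maximal isotropic subspace, canonically attached to (V, V') when the middle
   entry of the relative position vanishes, whose family is recorded by the sign. *)
Definition famsp (V V' : preflag F d N) : 'M[F]_D :=
  if (\rank (V (inord n)) < d)%N then
    if (\rank (V' (inord n)) < d)%N then
      (V (inord n) + V (inord n.+1) :&: V' (inord n))%MS
    else V' (inord n)
  else V (inord n).

Lemma inord_n : (inord n : 'I_N.+1) = n :> nat.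
Proof. by rewrite inordK //; clear; lia. Qed.
Lemma inord_nS : (inord n.+1 : 'I_N.+1) = n.+1 :> nat.
Proof. by rewrite inordK //; clear; lia. Qed.

Lemma cflag_n B (c : {ffun I -> 'I_N}) :
  (cflag B c (inord n) :=: coordsp (below c n) *m B)%MS.
Proof. by have := cflagE B c (inord n); rewrite inord_n. Qed.

Lemma cflag_nS B (c : {ffun I -> 'I_N}) :
  (cflag B c (inord n.+1) :=: coordsp (below c n.+1) *m B)%MS.
Proof. by have := cflagE B c (inord n.+1); rewrite inord_nS. Qed.

Lemma famsp_cflag B c c' : Qisometry B ->
  (famsp (cflag B c) (cflag B c') :=: coordsp (famset c c') *m B)%MS.
Proof.
move=> iB; have uB := isom_unit iB; rewrite /famsp /famset !cflag_n !rank_csp_mul //.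
case: ifP => _; last exact: cflag_n.
case: ifP => _; last exact: cflag_n.
apply: eqmx_sym; apply: eqmx_trans (csp_mul_add _ _ _) _.
apply: adds_eqmx; first exact/eqmx_sym/cflag_n.
apply: eqmx_trans (csp_mul_cap _ _ uB) _.
by apply: cap_eqmx; [apply/eqmx_sym/cflag_nS|apply/eqmx_sym/cflag_n].
Qed.

Lemma famsp_act g (V V' : preflag F d N) : g \in unitmx ->
  (famsp (flag_act g V) (flag_act g V') :=: famsp V V' *m g)%MS.
Proof.
move=> ug; rewrite /famsp !ffunE !mxrank_gen !mxrankMfree ?row_free_unit //.
case: ifP => _; last exact: genmxE.
case: ifP => _; last exact: genmxE.
apply: eqmx_sym; apply: eqmx_trans (addsmxMr _ _ _) _.
apply: adds_eqmx; first exact/eqmx_sym/genmxE.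
apply: eqmx_trans (capmxMunit _ _ ug) _.
by apply: cap_eqmx; apply/eqmx_sym/genmxE.
Qed.

Lemma famsp_max (V V' : preflag F d N) : is_flag V -> is_flag V' ->
  ~~ (0 < relpos V V' (mid n) (mid n)) -> max_isotropic (famsp V V').
Proof.
move=> fV fV'; have [B [c [c' [iB qc qc' -> ->]]]] := flag_frame two mM fV fV'.
rewrite relpos_cflag // => /crel_mid_gt0 H.
apply: (max_isotropic_eqmx (eqmx_sym (famsp_cflag _ _ iB))).
apply: transversal_max_isotropic => //; apply: famset_transversal => // x e e'.
by apply: H; exists x.
Qed.

Lemma relpos_mid_gt0 (V V' : preflag F d N) : is_flag V -> is_flag V' ->
    0 < relpos V V' (mid n) (mid n) ->
  (\rank (V (inord n)) < d)%N /\ (\rank (V' (inord n)) < d)%N.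
Proof.
move=> fV fV'; have [B [c [c' [iB qc qc' -> ->]]]] := flag_frame two mM fV fV'.
rewrite relpos_cflag // => /crel_mid_gt0[x [e e']].
rewrite !cflagE !rank_csp_mul ?isom_unit // !inord_n.
split; rewrite ltnNge; apply/negP => le.
  by have := below_full x qc le; rewrite e eqxx.
by have := below_full x qc' le; rewrite e' eqxx.
Qed.

(** Makes the table of signs uniform: in each of its cases with a sign, the sign is the family of
    one subspace attached to (V, V'). *)
Lemma sgn_labE (V V' : Xflag n d F) : sgn_lab M V V' =
  if 0 < relpos (val V) (val V') (mid n) (mid n) then None
  else Some (same_family M (famsp (val V) (val V'))).
Proof.
rewrite /sgn_lab /component /famsp.
case: (boolP (0 < relpos (val V) (val V') (mid n) (mid n))) => m0.
  by have [-> ->] := relpos_mid_gt0 (valP V) (valP V') m0.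
case: (ltnP (\rank (val V (inord n))) d) => _; case: (ltnP (\rank (val V' (inord n))) d) => _ //=.
- by case: (same_family M (val V' (inord n))).
- by case: (same_family M (val V (inord n))).
- by case: (same_family M (val V (inord n))); case: (same_family M (val V' (inord n))).
Qed.

Lemma labXX_act (V V' W W' : Xflag n d F) g : SO_mx g ->
    val W = flag_act g (val V) -> val W' = flag_act g (val V') ->
  labXX n M (W, W') = labXX n M (V, V').
Proof.
move=> /SO_mxP[ig dg] E E'; have ug := isom_unit ig.
rewrite /labXX !sgn_labE E E' relpos_act //=; congr (_, _).
case: ifP => // /negbT m0; congr Some; rewrite (same_family_eqmx (famsp_act _ _ ug)).
have := same_family_isom (famsp_max (valP V) (valP V') m0) ig.
by rewrite dg eqxx => /eqP.
Qed.

(* An isometry of determinant -1 moving one pair to the other is corrected by a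
   reflection fixing both flags, which exists if the middle entry is positive. *)
Lemma labXX_sep (V V' W W' : Xflag n d F) : labXX n M (V, V') = labXX n M (W, W') ->
  exists2 g, SO_mx g & flag_act g (val V) = val W /\ flag_act g (val V') = val W'.
Proof.
rewrite /labXX !sgn_labE /= => -[Er Es].
have [g ig [e e']] := relpos_sep two mM (valP V) (valP V') (valP W) (valP W') Er.
have [dg|dg] := det_isom two mM ig; first by exists g; rewrite //; apply/SO_mxP.
move: Es; rewrite -Er; case: ifP => [m0 _|/negbT m0 [Es]]; last first.
  have mA := famsp_max (valP V) (valP V') m0.
  have := same_family_isom mA ig; rewrite dg (negPf (opp1_neq1 two)).
  by rewrite -(same_family_eqmx (famsp_act _ _ (isom_unit ig))) e e' Es eqxx.
have [B [c [c' [iB qc qc' Ec Ec']]]] := flag_frame two mM (valP V) (valP V').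
move: m0; rewrite Ec Ec' relpos_cflag // => /crel_mid_gt0[x [cx cx']].
have uB := isom_unit iB.
pose h := invmx B *m refl_mx (hidx x) *m B.
have ih : Qisometry h by rewrite !isomM ?isomV ?isom_swap.
have dh : \det h = -1 by rewrite !det_mulmx mulrAC -det_mulmx mulVmx // det1 mul1r det_refl.
have fix_h (k : {ffun I -> 'I_N}) : equivariant k -> k x = mid n -> flag_act h (cflag B k) = cflag B k.
  move=> /equivariantP qk kx; rewrite act_cflag /h !mulmxA mulmxV // mul1mx.
  apply: cflag_perm => y; rewrite swapE inE; case: eqP => // /esym/hidx_eq[->|->].
    by rewrite qk kx rev_mid.
  by rewrite sgK qk kx rev_mid.
exists (h *m g).
  by apply/SO_mxP; rewrite isomM // det_mulmx dh dg mulrNN mulr1.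
clearbody h; split; rewrite -(flag_actM h g) fix_h //.
  by rewrite -Ec; exact: e.
by rewrite -Ec'; exact: e'.
Qed.

Lemma orbXXE s t : orbXX (n := n) (Fq := F) s t = (labXX n M s == labXX n M t).
Proof.
case: s t => [V V'] [W W']; rewrite /orbXX /same_orbit /=; apply/existsP/eqP.
  by case=> g /and3P[sg]; rewrite !movesE => /eqP e /eqP e'; apply/esym/(labXX_act sg).
move=> /labXX_sep[g sg [e e']]; exists g.
by rewrite sg !movesE e e' !eqxx.
Qed.

End Labels.

(** * Coarsening and refining coordinate flags *)

Section Refinement.
Variables (n d : nat).
Hypothesis d_gt0 : (0 < d)%N.
Local Notation N := (n.*2.+1).
Local Notation D := (d + d)%N.
Local Notation I := 'I_(d + d).
Local Notation CX := (CX n d).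
Local Notation CY := (CY d).

Lemma CX_equiv (c : CX) : equivariant (val c). Proof. exact: valP. Qed.
Lemma CY_equiv (f : CY) : equivariant (val f). Proof. by have /and3P[] := valP f. Qed.
Lemma CY_inj (f : CY) : injective (val f).
Proof. by have /and3P[_ /injectiveP] := valP f. Qed.
Lemma CY_odd (f : CY) : odd #|below (val f) d :&: low d| = odd d.
Proof. by have /and3P[_ _ /eqP] := valP f. Qed.

Lemma CY_onto (f : CY) (l : 'I_D) : exists x, val f x = l.
Proof. by exists (invF (@CY_inj f) l); rewrite f_invF. Qed.

Lemma card_below_CY (f : CY) k : (k <= D)%N -> #|below (val f) k| = k.
Proof.
move=> kD; rewrite -(card_imset _ (@CY_inj f)).
have -> : val f @: below (val f) k = [set l : 'I_D | (l < k)%N].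
  apply/setP => l; rewrite inE; apply/imsetP/idP => [[x + ->]|lk].
    by rewrite inE.
  by have [x fx] := CY_onto f l; exists x; rewrite // inE fx.
by rewrite -sum1dep_card (big_ord_narrow kD) sum1_card card_ord.
Qed.

(* The second alternative describes the maximal isotropic subspace other than
   F_d that contains F_(d-1). *)
Definition nice (m : {ffun 'I_D -> 'I_N}) : Prop :=
  (forall l, m (rev_ord l) = rev_ord (m l)) /\
  forall k : nat, (exists2 j : 'I_D.+1, True & forall l, (m l < k)%N = (l < j)%N) \/
    (forall l, (m l < k)%N = ((l < d.-1)%N || (l == d :> nat))).

Definition K := {m : {ffun 'I_D -> 'I_N} | `[< nice m >]}.

(** Every term of the complete flag is a term of its image, so the image determines the flag. *)
Definition separating (m : K) : Prop := forall j : 'I_D.+1,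
  exists k : 'I_N.+1, forall l, (val m l < k)%N = (l < j)%N.

Lemma K_nice (m : K) : nice (val m). Proof. by have /asboolP := valP m. Qed.

Lemma coarsen_equiv (m : K) (f : CY) : equivariant [ffun x => val m (val f x)].
Proof.
apply/equivariantP => x; rewrite !ffunE (equivariantP _ (CY_equiv f)).
by have [-> _] := K_nice m.
Qed.

(** The flag pi F: position l of F goes to step m l. In terms of colorings both alternatives of
    [nice] are compositions with m. *)
Definition coarsen (m : K) (f : CY) : CX := Sub _ (coarsen_equiv m f).

Definition rlabel (m : K) : 'M[int]_(N, D) := \matrix_(k, l) (val m l == k)%:Z.

Definition clabXY (p : CX * CY) : 'M[int]_(N, D) := crel (val p.1) (val p.2).
Definition clabYY (p : CY * CY) : 'M[int]_D := crel (val p.1) (val p.2).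

Lemma clabXY_coarsen m f : clabXY (coarsen m f, f) = rlabel m.
Proof.
apply/matrixP => k l; rewrite !mxE /=; congr Posz.
have [x fx] := CY_onto f l.
case: eqP => [mk|ne].
  rewrite (_ : [set _ | _] = [set x]) ?cards1 //; apply/setP => y; rewrite !inE ffunE.
  rewrite -fx (inj_eq (@CY_inj f)); case: (y =P x) => [->|]; rewrite ?andbF //.
  by rewrite fx mk eqxx.
rewrite (_ : [set _ | _] = finset.set0) ?cards0 //; apply/setP => y; rewrite !inE ffunE.
by apply/negP => /andP[/eqP e1 /eqP e2]; apply: ne; rewrite -e2.
Qed.

Lemma clabXY_rl (c : {ffun I -> 'I_N}) (f : {ffun I -> 'I_D}) m : crel c f = rlabel m ->
  forall x, c x = val m (f x).
Proof.
move=> E x; have /(congr1 (fun A : 'M_(N, D) => A (c x) (f x))) := E.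
rewrite !mxE; case: eqP => // _ [/eqP]; rewrite cards_eq0 => /eqP/setP/(_ x).
by rewrite !inE !eqxx.
Qed.

Section Ref.
Variables (c : CX) (f : CY).

(* Encodes the lexicographic order of (c x, f x). *)
Definition key (x : I) : nat := (val c x * D + val f x)%N.

Lemma key_inj : injective key.
Proof.
move=> x y; rewrite /key => E; apply: (@CY_inj f); apply: val_inj.
have := congr1 (modn^~ D) E; rewrite !modnMDl !modn_small //.
Qed.

Lemma key_lt x y : (key y < key x)%N =
  (val c y < val c x)%N || ((val c y == val c x) && (val f y < val f x)%N).
Proof.
rewrite /key -(inj_eq val_inj) /=.
have := ltn_ord (val f x); have := ltn_ord (val f y).
move: (nat_of_ord (val f x)) (nat_of_ord (val f y)) => a b.
move: (nat_of_ord (val c x)) (nat_of_ord (val c y)) => u v hb ha.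
case: (ltngtP v u) => [vu|uv|->] /=.
- apply: leq_trans (_ : v.+1 * D <= _)%N; first by rewrite mulSn addnC ltn_add2r.
  by apply: leq_trans (leq_mul vu (leqnn D)) (leq_addr _ _).
- apply/negbTE; rewrite -leqNgt; apply: leq_trans (_ : u.+1 * D <= _)%N.
    by rewrite mulSn addnC leq_add2r ltnW.
  by apply: leq_trans (leq_mul uv (leqnn D)) (leq_addr _ _).
- by rewrite ltn_add2l.
Qed.

Lemma key_sg x y : (key (sg y) < key (sg x))%N = (key x < key y)%N.
Proof.
rewrite !key_lt !(equivariantP _ (CX_equiv c)) !(equivariantP _ (CY_equiv f)).
rewrite -!(inj_eq val_inj) /=.
have := ltn_ord (val f x); have := ltn_ord (val f y).
have := ltn_ord (val c x); have := ltn_ord (val c y).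
move: (nat_of_ord (val f x)) (nat_of_ord (val f y)) => a b.
move: (nat_of_ord (val c x)) (nat_of_ord (val c y)) => u v; lia.
Qed.

Definition pos (x : I) : nat := #|[set y | (key y < key x)%N]|.

Lemma pos_lt x y : (pos y < pos x)%N = (key y < key x)%N.
Proof.
have le u v : (key u <= key v)%N -> (pos u <= pos v)%N.
  move=> uv; apply: subset_leq_card; apply/fintype.subsetP => z.
  by rewrite !inE => /leq_trans; apply.
case: (ltnP (key y) (key x)) => [yx|/le]; last by rewrite leqNgt => /negbTE.
apply: proper_card; apply/fintype.properP; split.
  by apply/fintype.subsetP => z; rewrite !inE => /ltn_trans; apply.
by exists y; rewrite !inE ?yx // ltnn.
Qed.

Lemma pos_ltD x : (pos x < D)%N.
Proof.
rewrite -[X in (_ < X)%N]card_ord -cardsT; apply: proper_card.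
apply/fintype.properP; split; first by rewrite finset.subsetT.
by exists x; rewrite !inE ?ltnn.
Qed.

Lemma pos_sg x : pos (sg x) = (D - (pos x).+1)%N.
Proof.
have -> : pos (sg x) = #|[set y | (key x < key y)%N]|.
  rewrite -(card_imset _ (can_inj (@sgK d))); congr #|pred_of_set _|.
  apply/setP => y; rewrite inE; apply/idP/imsetP => [yx|[z + ->]].
    by exists (sg y); rewrite ?sgK // inE -[x]sgK key_sg.
  by rewrite inE -{1}[x]sgK -key_sg !sgK.
have : #|[set y | (key x < key y)%N]| = #|~: (x |: [set y | (key y < key x)%N])|.
  congr #|pred_of_set _|; apply/setP => y; rewrite !inE negb_or -leqNgt ltn_neqAle.
  by rewrite eq_sym (inj_eq key_inj) eq_sym.
move=> ->; have := cardsC (x |: [set y | (key y < key x)%N]).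
rewrite card_ord cardsU1 inE ltnn /= -/(pos x); move: #|_| (pos x) => a b; lia.
Qed.

Definition pos_ord x : 'I_D := Ordinal (pos_ltD x).

Lemma pos_inj : injective pos.
Proof.
move=> x y E; apply: key_inj; have := pos_lt x y; have := pos_lt y x.
by rewrite E ltnn => /esym h1 /esym h2; move: h1 h2; case: (ltngtP (key x) (key y)).
Qed.

(** The color is the primary key of the order, so the indices of color below k form an initial
    segment. *)
Lemma pos_below k x : (val c x < k)%N = (pos x < #|below (val c) k|)%N.
Proof.
case: (ltnP (val c x) k) => ck; apply/esym.
  rewrite (_ : (pos x).+1 = #|x |: [set y | (key y < key x)%N]|).
    apply: subset_leq_card; apply/fintype.subsetP => y; rewrite !inE.
    case/predU1P => [->//|]; rewrite key_lt => /orP[h|/andP[/eqP -> _]] //.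
    exact: ltn_trans h ck.
  by rewrite cardsU1 inE ltnn.
apply/negbTE; rewrite -leqNgt; apply: subset_leq_card; apply/fintype.subsetP => y.
by rewrite !inE key_lt => h; rewrite (leq_trans h ck).
Qed.

(** Exchanging positions d - 1 and d replaces F_d by the other maximal isotropic subspace containing
    F_(d-1) and leaves all other terms unchanged. *)
Definition flip (l : nat) : nat :=
  if l == d.-1 then d else if l == d then d.-1 else l.

Lemma flip_lt l : (l < D)%N -> (flip l < D)%N.
Proof. by rewrite /flip; do ?[case: ifP => ? //]; lia. Qed.

Lemma flipK : involutive flip.
Proof.
move=> l; rewrite /flip; case: (eqVneq l d.-1) => [->|h].
  by rewrite eqxx; case: eqP => //; lia.
by case: (eqVneq l d) => [->|h']; rewrite ?eqxx ?(negPf h) ?(negPf h').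
Qed.

Lemma flip_rev l : (l < D)%N -> flip (D - l.+1) = (D - (flip l).+1)%N.
Proof. by rewrite /flip => lD; do ?[case: eqP => ?]; lia. Qed.

(* Sorting by (c, f) may yield a flag of the wrong family: then F_d is replaced. *)
Definition wrong : bool :=
  odd #|[set x | (pos x < d)%N] :&: low d| != odd d.

Definition ref_ord (x : I) : 'I_D :=
  if wrong then Ordinal (flip_lt (pos_ltD x)) else pos_ord x.

Lemma val_ref_ord x : ref_ord x = (if wrong then flip (pos x) else pos x) :> nat.
Proof. by rewrite /ref_ord; case: ifP. Qed.

Lemma ref_inj : injective ref_ord.
Proof.
move=> x y /(congr1 val); rewrite /= !val_ref_ord; case: ifP => _; last exact: pos_inj.
by move/(can_inj flipK)/pos_inj.
Qed.

(** The indices at positions d - 1 and d are dual to each other, so exactly one of them is in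
    [low d]. *)
Lemma flip_odd : odd #|[set x | (flip (pos x) < d)%N] :&: low d| =
  ~~ odd #|[set x | (pos x < d)%N] :&: low d|.
Proof.
have [x px] : exists x, pos x = d.-1.
  have dD : (d.-1 < D)%N by lia.
  have inj : injective pos_ord by move=> x y /(congr1 val)/pos_inj.
  by exists (invF inj (Ordinal dD)); have /(congr1 val) := f_invF inj (Ordinal dD).
have psx : pos (sg x) = d by rewrite pos_sg px; lia.
pose R := [set y | (pos y < d.-1)%N].
have E1 : [set y | (pos y < d)%N] = x |: R.
  apply/setP => y; rewrite !inE -(inj_eq pos_inj) px; move: (pos y) => a; lia.
have E2 : [set y | (flip (pos y) < d)%N] = sg x |: R.
  apply/setP => y; rewrite !inE -(inj_eq pos_inj) psx /flip; move: (pos y) => a.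
  by do ?[case: eqP => ?]; lia.
have C z : z \notin R -> #|(z |: R) :&: low d| = ((z \in low d) + #|R :&: low d|)%N.
  move=> zR; rewrite finset.setIUl; case: (boolP (z \in low d)) => zl.
    have -> : [set z] :&: low d = [set z] by apply/finset.setIidPl; rewrite finset.sub1set.
    by rewrite cardsU1 finset.in_setI negb_and zR.
  by rewrite (_ : [set z] :&: _ = finset.set0) ?finset.set0U //; apply/eqP; rewrite setI_eq0 disjoints1.
have xR : x \notin R by rewrite inE px; lia.
have sR : sg x \notin R by rewrite inE psx; lia.
by rewrite E1 E2 (C _ xR) (C _ sR) !oddD low_sg; case: (x \in _); case: (odd #|_|).
Qed.

Definition ref_fun : {ffun I -> 'I_D} := [ffun x => ref_ord x].

Lemma refy_subproof : [&& equivariant ref_fun, injectiveb ref_fun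
  & odd #|below ref_fun d :&: low d| == odd d].
Proof.
apply/and3P; split.
- apply/equivariantP => x; apply: val_inj; rewrite !ffunE /= !val_ref_ord pos_sg.
  by case: ifP => //; rewrite flip_rev // pos_ltD.
- by apply/injectiveP => x y; rewrite !ffunE => /ref_inj.
- have [w|w] := boolP wrong.
    have -> : below ref_fun d = [set x | (flip (pos x) < d)%N].
      by apply/setP => x; rewrite !inE ffunE val_ref_ord w.
    by rewrite flip_odd; move: w; rewrite /wrong; case: odd; case: odd.
  have -> : below ref_fun d = [set x | (pos x < d)%N].
    by apply/setP => x; rewrite !inE ffunE val_ref_ord (negPf w).
  by move: w; rewrite /wrong negbK.
Qed.

Definition refy : CY := exist _ ref_fun refy_subproof.

Definition ref_type : {ffun 'I_D -> 'I_N} := [ffun l => val c (invF (@CY_inj refy) l)].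

(** Colors below k fill the first j positions in the sorted order. Flipping disturbs such a segment
    only when j = d, and then the second alternative of [nice] appears. *)
Lemma refk_subproof : `[< nice ref_type >].
Proof.
apply/asboolP.
have L l : exists2 x, ref_ord x = l & invF (@CY_inj refy) l = x.
  have [x fx] := CY_onto refy l; exists x; first by rewrite -fx ffunE.
  by rewrite -fx invF_f.
split=> [l|k].
  rewrite !ffunE; have [x <- ->] := L l; rewrite -(equivariantP _ (CX_equiv c)); congr (val c _).
  have <- : val refy (sg x) = rev_ord (ref_ord x).
    by rewrite (equivariantP _ (CY_equiv refy)) ffunE.
  by rewrite invF_f.
have jD : (#|below (val c) k| < D.+1)%N.
  by rewrite ltnS -[X in (_ <= X)%N]card_ord max_card.
pose j := Ordinal jD.
have E l : (ref_type l < k)%N =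
   ((if wrong then flip l else l) < j)%N.
  rewrite ffunE; have [x <- ->] := L l; rewrite val_ref_ord pos_below.
  by case: wrong; rewrite ?flipK.
case: (boolP (wrong && (j == d :> nat))) => [/andP[w /eqP jd]|h].
  right=> l; rewrite E w jd /flip; do ?[case: eqP => ?]; lia.
left; exists j => // l; rewrite E; move: h; case: wrong => //=.
by rewrite /flip => h; do ?[case: eqP => ?]; move: h; move: #|_| => a; lia.
Qed.

Definition refk : K := exist _ ref_type refk_subproof.

Lemma coarsen_ref : coarsen refk refy = c.
Proof.
apply/val_inj/ffunP => x; rewrite [val (coarsen _ _)]/= ffunE /= [LHS]ffunE.
by rewrite -[ref_fun]/(val refy) invF_f.
Qed.

(** In terms of subspaces the right side is V_a + V_(a+1) :&: F_b with a = [val c x] and b =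
    [val f x], an expression invariant under the stabilizer of V and F. The bound k < d avoids the
    term that flipping may change. *)
Lemma below_refy k x : (k < d)%N -> pos x = k ->
  below (val refy) k = below (val c) (val c x) :|:
    (below (val c) (val c x).+1 :&: below (val f) (val f x)).
Proof.
move=> kd px; apply/setP => y; rewrite !inE ffunE val_ref_ord.
have -> : ((if wrong then flip (pos y) else pos y) < k)%N = (pos y < pos x)%N.
  by rewrite px; case: wrong => //; rewrite /flip; do ?[case: eqP => ?]; lia.
rewrite pos_lt key_lt -(inj_eq val_inj) /= ltnS.
by case: (ltngtP (nat_of_ord (val c y)) (nat_of_ord (val c x))) => /=.
Qed.

Lemma pos_onto k : (k < D)%N -> exists x, pos x = k.
Proof.
move=> kD; have inj : injective pos_ord by move=> x y /(congr1 val)/pos_inj.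
by exists (invF inj (Ordinal kD)); have /(congr1 val) := f_invF inj (Ordinal kD).
Qed.

End Ref.

Section Injective.
Hypothesis dn : (d <= n)%N.

Lemma full_lt (l : 'I_D) : ((if (l < d)%N then l : nat else l + (N - D)) < N)%N.
Proof. by have := ltn_ord l; case: ifP; lia. Qed.

(** The first d positions go to the first d steps and the last d positions to the last d steps; the
    N - 2d steps between them are trivial. *)
Definition full_type : {ffun 'I_D -> 'I_N} := [ffun l => Ordinal (full_lt l)].

Lemma full_subproof : `[< nice full_type >].
Proof.
apply/asboolP; split=> [l|k].
  by apply: val_inj; rewrite !ffunE /=; have := ltn_ord l; do ?[case: ifP => ?]; lia.
left; have jD : ((if (k <= d)%N then k else if (k <= d + (N - D))%N then d else minn D (k - (N - D))) < D.+1)%N.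
  by do ?[case: ifP => ?]; lia.
by exists (Ordinal jD) => // l; rewrite ffunE /=; have := ltn_ord l; do ?[case: ifP => ?]; lia.
Qed.

Definition full : K := exist _ full_type full_subproof.

Lemma full_separating : separating full.
Proof.
move=> j.
have kN : ((if (j <= d)%N then j : nat else j + (N - D)) < N.+1)%N.
  by have := ltn_ord j; case: ifP; lia.
exists (Ordinal kN) => l; rewrite ffunE /=; have := ltn_ord l; do ?[case: ifP => ?]; lia.
Qed.

End Injective.
End Refinement.

(** * The flag varieties as a model *)

Section FlagModel.
Variables (F : finFieldType) (n d : nat).
Hypothesis two : 2%N \notin [pchar F].
Local Notation N := (n.*2.+1).
Local Notation D := (d + d)%N.
Local Notation I := 'I_(d + d).
Local Notation coordsp := (@coordsp F d).
Variables (M : 'M[F]_D) (mM : max_isotropic M).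
Variables (T : 'M[F]_D) (iT : Qisometry T) (ET : (coordsp (low d) *m T :=: M)%MS).
Local Notation X := (Xflag n d F).
Local Notation Y := (Yflag M).
Local Notation CX := (CX n d).
Local Notation CY := (CY d).
Local Notation K := (K n d).

Lemma Y_flag (y : Y) : is_flag (val y). Proof. by have /andP[] := valP y. Qed.
Lemma Y_complete (y : Y) : is_complete M (val y). Proof. by have /andP[] := valP y. Qed.

Lemma Y_rank (y : Y) (i : 'I_D.+1) : \rank (val y i) = i.
Proof. by have /andP[/forallP H _] := Y_complete y; apply/eqP. Qed.

Lemma inord_d : (inord d : 'I_D.+1) = d :> nat.
Proof. by rewrite inordK // ltnS leq_addr. Qed.

Lemma Y_mid_max (y : Y) : max_isotropic (val y (inord d)).
Proof.
apply/max_isotropicP; rewrite Y_rank inord_d; split=> //.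
have E := flag_perp (inord d) (Y_flag y); apply: eqmx_sym.
apply: eqmx_trans E _; rewrite (_ : rev_ord (inord d) = inord d :> 'I_D.+1) //.
by apply: val_inj; rewrite /= inord_d; clear; lia.
Qed.

Lemma Y_family (y : Y) : same_family M (val y (inord d)).
Proof. by have /andP[] := Y_complete y. Qed.

Lemma Y_act_subproof (g : 'M[F]_D) (y : Y) : SO_mx g ->
  is_flag (flag_act g (val y)) && is_complete M (flag_act g (val y)).
Proof.
move=> /SO_mxP[ig dg]; have ug := isom_unit ig.
rewrite (is_flag_act two mM) ?Y_flag //=; apply/andP; split.
  apply/forallP => i; rewrite ffunE mxrank_gen mxrankMfree ?row_free_unit //.
  by rewrite Y_rank.
rewrite ffunE (same_family_eqmx M (genmxE _)).
have := same_family_isom two mM (Y_mid_max y) ig.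
by rewrite dg eqxx Y_family => /eqP->.
Qed.

(** The middle terms of all flags in Y belong to one family. Hence pairs involving Y need no sign:
    an isometry relating them is automatically special. *)
Lemma Y_det (g : 'M[F]_D) (y y' : Y) : Qisometry g ->
  flag_act g (val y) = val y' -> \det g = 1.
Proof.
move=> ig E; have := same_family_isom two mM (Y_mid_max y) ig.
have -> : same_family M (val y (inord d) *m g) = same_family M (val y' (inord d)).
  by rewrite -E ffunE; apply: same_family_eqmx; apply/eqmx_sym/genmxE.
by rewrite !Y_family eqxx => /esym/eqP.
Qed.

Definition SOgroup := {g : 'M[F]_D | SO_mx g}.

Lemma X_act_subproof (g : SOgroup) (x : X) : is_flag (flag_act (val g) (val x)).
Proof.
by have /SO_mxP[ig _] := valP g; apply: (is_flag_act two mM ig (valP x)).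
Qed.

Definition actX (g : SOgroup) (x : X) : X := Sub _ (X_act_subproof g x).
Definition actY (g : SOgroup) (y : Y) : Y :=
  exist _ (flag_act (val g) (val y)) (Y_act_subproof y (valP g)).

Lemma SO_unit (g : SOgroup) : val g \in unitmx.
Proof. by have /SO_mxP[/isom_unit] := valP g. Qed.

Lemma flag_act_inj m (g : 'M[F]_D) (V V' : preflag F d m) : g \in unitmx ->
  is_flag V -> is_flag V' -> flag_act g V = flag_act g V' -> V = V'.
Proof.
move=> ug fV fV' /(congr1 (flag_act (invmx g))).
by rewrite !flag_actM mulmxV // !flag_act1.
Qed.

Lemma rX_subproof (c : CX) : is_flag (cflag T (val c)).
Proof. exact: is_flag_cflag iT (CX_equiv c). Qed.

Definition realX (c : CX) : X := Sub _ (rX_subproof c).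

Lemma cflag_d_family (f : {ffun I -> 'I_D}) :
  same_family M (cflag T f (inord d)) = (odd #|below f d :&: low d| == odd d).
Proof.
rewrite (same_family_eqmx M (cflagE _ _ _)) (same_family_csp iT ET).
by rewrite inord_d.
Qed.

Lemma rY_subproof (f : CY) :
  is_flag (cflag T (val f)) && is_complete M (cflag T (val f)).
Proof.
rewrite is_flag_cflag ?CY_equiv //=; apply/andP; split.
  apply/forallP => i; rewrite cflagE rank_csp_mul ?isom_unit // card_below_CY //.
  by rewrite -ltnS.
by rewrite cflag_d_family CY_odd.
Qed.

Definition realY (f : CY) : Y := exist _ (cflag T (val f)) (rY_subproof f).

Lemma realXX c c' : labXX n M (realX c, realX c') = clabXX (val c, val c').
Proof.
rewrite /labXX (sgn_labE two mM) /clabXX /= relpos_cflag //.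
by rewrite (same_family_eqmx M (famsp_cflag _ _ iT)) (same_family_csp iT ET).
Qed.

Lemma realXY c f : labXY n M (realX c, realY f) = clabXY (c, f).
Proof. exact: relpos_cflag. Qed.

Lemma realYY f f' : labYY M (realY f, realY f') = clabYY (f, f').
Proof. exact: relpos_cflag. Qed.

Lemma CY_of_Y (f : {ffun I -> 'I_D}) (y : Y) (g : 'M[F]_D) : SO_mx g -> equivariant f ->
  val y = flag_act g (cflag T f) -> exists f' : CY, val f' = f.
Proof.
move=> sg qf E; have [ig dg] := SO_mxP _ sg; have ug := isom_unit ig.
have r k : (k <= D)%N -> #|below f k| = k.
  move=> kD; have := Y_rank y (inord k); rewrite E ffunE mxrank_gen mxrankMfree ?row_free_unit //.
  by rewrite cflagE rank_csp_mul ?isom_unit // inordK.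
have inj : injective f.
  move=> x y0 fxy.
  (* Consecutive terms of a complete flag differ by one dimension, so only one index has the color
     [f x]. *)
  have : #|below f (f x).+1 :\: below f (f x)| == 1%N.
    rewrite cardsD (finset.setIidPr (below_sub f (leqnSn _))) !r ?subSnn //.
    exact: ltnW.
  case/cards1P => z /setP Ez; have := Ez x; have := Ez y0.
  by rewrite !inE -fxy ltnSn ltnn /= => /esym/eqP -> /esym/eqP ->.
suff H : [&& equivariant f, injectiveb f & odd #|below f d :&: low d| == odd d].
  by exists (exist _ f H).
apply/and3P; split=> //; first exact/injectiveP.
rewrite -cflag_d_family.
have mc : max_isotropic (cflag T f (inord d)).
  apply: (max_isotropic_eqmx (eqmx_sym (cflagE _ _ _))).
  apply: transversal_max_isotropic => // x; rewrite !inE (equivariantP _ qf) /= inord_d.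
  have := ltn_ord (f x); move: (nat_of_ord (f x)) => a; clear; lia.
have := same_family_isom two mM mc ig; rewrite dg eqxx => /eqP <-.
rewrite -(same_family_eqmx M (genmxE _)); have := Y_family y.
by rewrite E ffunE.
Qed.

Hypothesis d_gt0 : (0 < d)%N.

Lemma bruhatXX (x x' : X) : exists (g : SOgroup) c c', x = actX g (realX c) /\ x' = actX g (realX c').
Proof.
have [g [c [c' [sg qc qc' E E']]]] := SO_bruhat two d_gt0 mM iT (valP x) (valP x').
exists (Sub g sg), (Sub c qc), (Sub c' qc'); split; exact: val_inj.
Qed.

Lemma bruhatXY (x : X) (y : Y) : exists (g : SOgroup) c f, x = actX g (realX c) /\ y = actY g (realY f).
Proof.
have [g [c [c' [sg qc qc' E E']]]] := SO_bruhat two d_gt0 mM iT (valP x) (Y_flag y).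
have [f Ef] := CY_of_Y sg qc' E'.
exists (Sub g sg), (Sub c qc), f; split; apply: val_inj => //=.
by rewrite -[sval f]/(val f) Ef.
Qed.

Lemma bruhatYY (y y' : Y) : exists (g : SOgroup) f f', y = actY g (realY f) /\ y' = actY g (realY f').
Proof.
have [g [c [c' [sg qc qc' E E']]]] := SO_bruhat two d_gt0 mM iT (Y_flag y) (Y_flag y').
have [f Ef] := CY_of_Y sg qc E; have [f' Ef'] := CY_of_Y sg qc' E'.
by exists (Sub g sg), f, f'; split; apply: val_inj; rewrite /= -[sval _]/(val _) ?Ef ?Ef'.
Qed.

Lemma labXX_inv (g : SOgroup) x x' : labXX n M (actX g x, actX g x') = labXX n M (x, x').
Proof. exact: (labXX_act two mM (valP g)). Qed.

Lemma labXY_inv (g : SOgroup) x y : labXY n M (actX g x, actY g y) = labXY n M (x, y).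
Proof. exact: relpos_act (SO_unit g). Qed.

Lemma labYY_inv (g : SOgroup) y y' : labYY M (actY g y, actY g y') = labYY M (y, y').
Proof. exact: relpos_act (SO_unit g). Qed.

Lemma labXX_sepG x1 x1' x2 x2' : labXX n M (x1, x1') = labXX n M (x2, x2') ->
  exists g, actX g x1 = x2 /\ actX g x1' = x2'.
Proof.
move=> /(labXX_sep two mM)[g sg [e e']]; exists (Sub g sg).
by split; apply: val_inj.
Qed.

Lemma labXY_sepG x1 y1 x2 y2 : labXY n M (x1, y1) = labXY n M (x2, y2) ->
  exists g, actX g x1 = x2 /\ actY g y1 = y2.
Proof.
move=> /(relpos_sep two mM (valP x1) (Y_flag y1) (valP x2) (Y_flag y2))[g ig [e e']].
have sg : SO_mx g by apply/SO_mxP; rewrite (Y_det ig e').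
by exists (Sub g sg); split; apply: val_inj.
Qed.

Lemma labYY_sepG y1 y1' y2 y2' : labYY M (y1, y1') = labYY M (y2, y2') ->
  exists g, actY g y1 = y2 /\ actY g y1' = y2'.
Proof.
move=> /(relpos_sep two mM (Y_flag y1) (Y_flag y1') (Y_flag y2) (Y_flag y2'))[g ig [e e']].
have sg : SO_mx g by apply/SO_mxP; rewrite (Y_det ig e').
by exists (Sub g sg); split; apply: val_inj.
Qed.

Lemma orbXYE s t : orbXY (n := n) (Fq := F) (M := M) s t = (labXY n M s == labXY n M t).
Proof.
case: s t => [x y] [x' y']; rewrite /orbXY /same_orbit /=; apply/existsP/eqP.
  case=> g /and3P[sg]; rewrite !movesE => /eqP e /eqP e'.
  rewrite -(labXY_inv (Sub g sg)); congr (labXY n M (_, _)); exact: val_inj.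
move=> /labXY_sepG[g [<- <-]]; exists (val g).
by rewrite (valP g) !movesE !eqxx.
Qed.

Lemma orbYYE s t : orbYY (Fq := F) (M := M) s t = (labYY M s == labYY M t).
Proof.
case: s t => [x y] [x' y']; rewrite /orbYY /same_orbit /=; apply/existsP/eqP.
  case=> g /and3P[sg]; rewrite !movesE => /eqP e /eqP e'.
  rewrite -(labYY_inv (Sub g sg)); congr (labYY M (_, _)); exact: val_inj.
move=> /labYY_sepG[g [<- <-]]; exists (val g).
by rewrite (valP g) !movesE !eqxx.
Qed.

Lemma flag_ext m (V V' : preflag F d m) : is_flag V -> is_flag V' ->
  (forall i, (V i :=: V' i)%MS) -> V = V'.
Proof.
case/and5P=> /forallP cV _ _ _ _ /and5P[/forallP cV' _ _ _ _] E.
by apply/ffunP => i; rewrite -(eqP (cV i)) -(eqP (cV' i)); apply/eq_genmx.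
Qed.

(** Duality gives the terms above the middle, and the middle term is determined by its family and
    the term of dimension d - 1. *)
Lemma Y_ext (y y' : Y) :
  (forall i : 'I_D.+1, (i < d)%N -> (val y i :=: val y' i)%MS) -> y = y'.
Proof.
move=> H; apply: val_inj; apply: flag_ext; rewrite ?Y_flag // => i.
have [id|di|id] := ltngtP i d; first exact: H.
  apply: eqmx_trans (flag_perp i (Y_flag y)) _.
  apply: eqmx_trans _ (eqmx_sym (flag_perp i (Y_flag y'))).
  by apply: eqmx_perp; apply: H => /=; have := ltn_ord i; lia.
have -> : i = inord d by apply: val_inj; rewrite /= inord_d.
have lt1 : (d.-1 < D.+1)%N by lia.
pose j := Ordinal lt1; have jd : (j <= (inord d : 'I_D.+1))%N by rewrite inord_d /=; lia.
apply: (par0_eqmx (Y_mid_max y) (Y_mid_max y') (E := val y j)).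
- exact: flag_nested (Y_flag y) jd.
- by rewrite H /=; [apply: flag_nested (Y_flag y') jd|lia].
- by rewrite Y_rank /= prednK.
have := Y_family y; have := Y_family y'; rewrite !same_familyE => h' h.
rewrite (par_trans two (Y_mid_max y) mM (Y_mid_max y')) (negPf h) parC.
exact: negPf.
Qed.

Lemma below_rl (m : K) (c : CX) (f : CY) k j : clabXY (c, f) = rlabel m ->
  (forall l, (val m l < k)%N = (l < j)%N) -> below (val c) k = below (val f) j.
Proof.
by move=> /clabXY_rl E H; apply/setP => x; rewrite !inE E H.
Qed.

Lemma rl_below (x : X) (y : Y) (m : K) (k : 'I_N.+1) (j : 'I_D.+1) :
    labXY n M (x, y) = rlabel m -> (forall l, (val m l < k)%N = (l < j)%N) ->
  (val x k :=: val y j)%MS.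
Proof.
have [g [c [f [-> ->]]]] := bruhatXY x y.
rewrite labXY_inv realXY => E H; rewrite /= !ffunE (below_rl E H).
exact: eqmx_refl.
Qed.

(** Here V_k meets F_d in F_(d-1), of codimension one, so the two lie in opposite families. *)
Lemma rl_other (x : X) (y : Y) (m : K) (k : 'I_N.+1) (j : 'I_D.+1) :
    labXY n M (x, y) = rlabel m -> j = d.-1 :> nat ->
    (forall l, (val m l < k)%N = (l < d.-1)%N || (l == d :> nat)) ->
  [/\ max_isotropic (val x k), (val y j <= val x k)%MS & fampar (val x k) (val y (inord d))].
Proof.
have [g [c [f [-> ->]]]] := bruhatXY x y.
rewrite labXY_inv realXY => E jd H; have [ig dg] := SO_mxP _ (valP g).
have E' := clabXY_rl E.
have xk : (val (actX g (realX c)) k :=: coordsp (below (val c) k) *m (T *m val g))%MS.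
  by rewrite [val (actX _ _)]/= act_cflag; apply: cflagE.
have yj i : (val (actY g (realY f)) i :=: coordsp (below (val f) i) *m (T *m val g))%MS.
  by rewrite [val (actY _ _)]/= act_cflag; apply: cflagE.
have iB : Qisometry (T *m val g) by rewrite isomM.
have tf : transversal_sg (below (val f) d).
  move=> z; rewrite !inE (equivariantP _ (CY_equiv f)) /=.
  have := ltn_ord (val f z); move: (nat_of_ord _) => a; clear; lia.
have cE z : (z \in below (val c) k) = (val f z < d.-1)%N || (val f z == d :> nat).
  by rewrite inE E' H.
have tc : transversal_sg (below (val c) k).
  move=> z; rewrite !cE (equivariantP _ (CY_equiv f)) /=.
  have := ltn_ord (val f z); move: (nat_of_ord _) d_gt0 => a; clear; lia.
split.
- exact: max_isotropic_eqmx (eqmx_sym xk) (transversal_max_isotropic iB tc).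
- rewrite xk yj csp_mul_subset ?isom_unit //; apply/fintype.subsetP => z.
  by rewrite cE inE jd => ->.
- rewrite (par_eqmx xk (yj _)) inord_d par_csp //.
  have -> : below (val c) k :&: below (val f) d = below (val f) d.-1.
    apply/setP => z; rewrite finset.in_setI cE !inE.
    by move: (nat_of_ord _) d_gt0 => a; clear; lia.
  rewrite card_below_CY; last by lia.
  by rewrite (_ : (d - d.-1)%N = 1%N) //; lia.
Qed.

(** Each V_k is either a term of y or the maximal isotropic subspace of the family opposite to F_d
    that contains F_(d-1). *)
Lemma rigidG (m : K) x x' y : labXY n M (x, y) = rlabel m -> labXY n M (x', y) = rlabel m -> x = x'.
Proof.
move=> E E'; apply: val_inj; apply: flag_ext (valP x) (valP x') _ => k.
have [_ /(_ k)[[j _ H]|H]] := K_nice m.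
  by apply: eqmx_trans (rl_below E H) (eqmx_sym (rl_below E' H)).
have lt1 : (d.-1 < D.+1)%N by lia.
pose j := Ordinal lt1.
have [mx ey px] := rl_other (j := j) E erefl H.
have [mx' ey' px'] := rl_other (j := j) E' erefl H.
apply: (par0_eqmx mx mx' ey ey'); first by rewrite Y_rank /= prednK.
by rewrite (par_trans two mx (Y_mid_max y) mx') px parC px'.
Qed.

(** For V_k equal to a term F_j its dimension gives j; the second alternative of [nice] is
    recognized by the family of V_k, which is not the one common to the middle terms in Y. *)
Lemma rigid_labelG (m m' : K) x y y' :
  labXY n M (x, y) = rlabel m -> labXY n M (x, y') = rlabel m' -> m = m'.
Proof.
move=> E E'; apply: val_inj.
suff H (k : 'I_N.+1) l : (val m l < k)%N = (val m' l < k)%N.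
  apply/ffunP => l; apply: val_inj.
  have := H (fintype.lift ord0 (val m l)) l; have := H (fintype.lift ord0 (val m' l)) l.
  rewrite /= /bump /= !add1n !ltnS !leqnn => h1 h2.
  by apply/eqP; rewrite eqn_leq h1 -h2.
have lt1 : (d.-1 < D.+1)%N by lia.
pose j0 := Ordinal lt1.
have other (m1 m2 : K) (y1 y2 : Y) (j : 'I_D.+1) : labXY n M (x, y1) = rlabel m1 ->
    labXY n M (x, y2) = rlabel m2 -> (forall l, (val m1 l < k)%N = (l < j)%N) ->
    (forall l, (val m2 l < k)%N = (l < d.-1)%N || (l == d :> nat)) -> False.
  move=> E1 E2 H1 H2; have [mx _ px] := rl_other (j := j0) E2 erefl H2.
  have e1 := rl_below E1 H1; have [_ rx] := max_isotropicP _ mx.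
  have jd : j = inord d.
    by apply: val_inj; rewrite /= inord_d; have := Y_rank y1 j; rewrite -e1 rx => <-.
  move: px; rewrite jd in e1; rewrite (par_eqmx e1 (eqmx_refl _)).
  rewrite (par_trans two (Y_mid_max y1) mM (Y_mid_max y2)) parC.
  have := Y_family y1; have := Y_family y2; rewrite !same_familyE parC => /negPf h2 /negPf h1.
  by rewrite [fampar M _]parC h1 [fampar M _]parC; move: h2; rewrite parC => ->.
have [_ /(_ k)[[j _ H]|H]] := K_nice m; have [_ /(_ k)[[j' _ H']|H']] := K_nice m'.
- have jj : j = j' :> nat by rewrite -(Y_rank y j) -(Y_rank y' j') -(rl_below E H) (rl_below E' H').
  by rewrite H H' jj.
- by case: (other m m' y y' j).
- by case: (other m' m y' y j').
- by rewrite H H'.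
Qed.

(** The terms of the refinement below d are built from V and F by sums and intersections, which
    commute with the action; [Y_ext] supplies the rest. *)
Lemma ref_fixedG c f (g h : SOgroup) : actX g (realX c) = actX h (realX c) ->
    actY g (realY f) = actY h (realY f) ->
  actY g (realY (refy d_gt0 c f)) = actY h (realY (refy d_gt0 c f)).
Proof.
move=> /(congr1 val) /= eX /(congr1 val) /= eY; apply: Y_ext => i id.
have iD : (i < D)%N by apply: leq_trans id _; rewrite leq_addr.
have [x px] := pos_onto c f iD.
have kN : (val c x < N.+1)%N by rewrite ltnS ltnW.
have kN' : ((val c x).+1 < N.+1)%N by rewrite ltnS.
have jD : (val f x < D.+1)%N by rewrite ltnS ltnW.
have key (a : SOgroup) : (val (actY a (realY (refy d_gt0 c f))) i :=:
    flag_act (val a) (cflag T (val c)) (Ordinal kN) +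
    flag_act (val a) (cflag T (val c)) (Ordinal kN') :&:
    flag_act (val a) (cflag T (val f)) (Ordinal jD))%MS.
  have ua := SO_unit a; have uT : T *m val a \in unitmx by rewrite unitmx_mul isom_unit.
  rewrite [val (actY _ _)]/= !act_cflag; apply: eqmx_trans (cflagE _ _ _) _.
  rewrite (below_refy d_gt0 id px); apply: eqmx_trans (csp_mul_add _ _ _) _.
  apply: adds_eqmx; first exact/eqmx_sym/(cflagE _ _ (Ordinal kN)).
  apply: eqmx_trans (csp_mul_cap _ _ uT) _; apply: cap_eqmx.
    exact/eqmx_sym/(cflagE _ _ (Ordinal kN')).
  exact/eqmx_sym/(cflagE _ _ (Ordinal jD)).
by apply: eqmx_trans (key g) _; apply: eqmx_sym; rewrite eX eY; apply: key.
Qed.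

Lemma rigid_separating (m : K) x y y' : separating m ->
  labXY n M (x, y) = rlabel m -> labXY n M (x, y') = rlabel m -> y = y'.
Proof.
move=> sm E E'; apply: val_inj; apply: flag_ext; rewrite ?Y_flag // => j.
have [k H] := sm j.
exact: eqmx_trans (eqmx_sym (rl_below E H)) (rl_below E' H).
Qed.

Definition flag_model : model (fun p : CX * CX => clabXX (val p.1, val p.2))
  (@clabXY n d) (@clabYY d) (@rlabel n d) (@refy n d d_gt0) (@separating n d)
  (labXX n M) (labXY n M) (labYY M).
Proof.
apply: (Model (aX := actX) (aY := actY) (rX := realX) (rY := realY)).
- move=> g y y' /(congr1 val) /= E; apply: val_inj.
  exact: (flag_act_inj (SO_unit g) (Y_flag y) (Y_flag y') E).
- exact: labXX_inv.
- exact: labXY_inv.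
- exact: labYY_inv.
- exact: labXX_sepG.
- exact: labXY_sepG.
- exact: labYY_sepG.
- exact: realXX.
- exact: realXY.
- exact: realYY.
- move=> x x'; have [g [c [c' [-> ->]]]] := bruhatXX x x'.
  by exists c, c'; rewrite labXX_inv realXX.
- move=> x x'; have [g [c [c' [-> ->]]]] := bruhatXY x x'.
  by exists c, c'; rewrite labXY_inv realXY.
- move=> x x'; have [g [c [c' [-> ->]]]] := bruhatYY x x'.
  by exists c, c'; rewrite labYY_inv realYY.
- exact: rigidG.
- exact: rigid_labelG.
- exact: rigid_separating.
- exact: ref_fixedG.
Defined.

End FlagModel.

(** * The double centralizer property *)

Lemma flag_generic_model n d (d_gt0 : (0 < d)%N) (C : generic_convolution n d) p :
  prime p -> odd p -> inhabited (generic_model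
    (fun q : CX n d * CX n d => clabXX (val q.1, val q.2)) (@clabXY n d) (@clabYY d)
    (@rlabel n d) (@refy n d d_gt0) (@separating n d) (cSV C) (cVH C) (cH C) p).
Proof.
move=> pp op.
have two : 2%N \notin [pchar 'F_p].
  rewrite (pcharf_eq (pchar_Fp pp)) inE; apply/eqP => e.
  by rewrite -e in op.
(* The factor 1 is the isometry T carrying the standard maximal isotropic subspace to [M], as
   expected by [flag_model]. *)
pose M : 'M['F_p]_(d + d) := coordsp 'F_p (low d) *m 1%:M.
have mM : max_isotropic M := transversal_max_isotropic (isom1 _ _) (@low_transversal d).
have := conv_atP C two mM; rewrite card_Fp // => -[_ hSV hVH hH].
have Mo := flag_model n two mM (isom1 _ _) (eqmx_refl _) d_gt0.
exact: inhabits (GenericModel Mo hSV hVH hH).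
Qed.

Lemma vpowD a b : vpow a * vpow b = vpow (a + b).
Proof. by apply: val_inj; rewrite /= expfzDr // vQ_neq0. Qed.

Lemma XiD_label n d (c c' : CX n d) : XiD d (clabXX (val c, val c')).
Proof.
rewrite /XiD /clabXX /=; set A := crel _ _.
have A0 i j : 0 <= A i j by rewrite mxE.
apply/andP; split; last first.
  (* The entries are nonnegative, so a positive middle entry makes both middle sums positive. *)
  case: (boolP (0 < A (mid n) (mid n))) => [a0|]; last by rewrite !andbF.
  rewrite !mxE (bigD1 (mid n)) //= ltr_wpDr ?sumr_ge0 //.
  by rewrite (bigD1 (mid n)) //= ltr_wpDr ?sumr_ge0.
apply/and3P; split.
- by apply/forallP => i; apply/forallP => j.
- apply/eqP; under eq_bigr => i _ do under eq_bigr => j _ do rewrite mxE.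
  rewrite -[RHS]/(Posz (d + d)) -[in RHS](card_ord (d + d)) -sum1_card.
  rewrite (partition_big (val c) xpredT) //= -[RHS]natz natr_sum; apply: eq_bigr => i _.
  rewrite (partition_big (val c') xpredT) //= natr_sum; apply: eq_bigr => j _.
  by rewrite sum1dep_card natz.
- apply/forallP => i; apply/forallP => j; rewrite !mxE; apply/eqP; congr Posz.
  rewrite -[LHS](card_imset _ (can_inj (@sgK d))); congr #|pred_of_set _|.
  apply/setP => x; rewrite inE; apply/imsetP/idP => [[y + ->]|].
    rewrite inE => /andP[/eqP <- /eqP <-].
    by rewrite (equivariantP _ (valP c)) (equivariantP _ (valP c')) !eqxx.
  move=> /andP[/eqP e /eqP e']; exists (sg x); last by rewrite sgK.
  rewrite inE (equivariantP _ (valP c)) (equivariantP _ (valP c')).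
  by rewrite e e' !rev_ordK !eqxx.
Qed.

Lemma is_tXi_label n d (c c' : CX n d) : is_tXi (clabXX (val c, val c')).
Proof.
apply/asboolP; exists 0, d.
by rewrite /shift mulr0 scale0r addr0 -surjective_pairing XiD_label.
Qed.

Section Surjectivity.
Variables (n d : nat) (Fq : finFieldType) (hFq : 2%N \notin [pchar Fq]) (d_gt0 : (0 < d)%N).
Variables (M : forall e : nat, 'M[Fq]_(e + e)) (hM : max_isotropic (M d)).
Variable C : forall e : nat, generic_convolution n e.

Lemma additive_fun_sum (U W : zmodType) (phi : U -> W) (I : Type) (r : seq I)
    (F : I -> U) : {morph phi : x y / x - y} ->
  phi (\sum_(i <- r) F i) = \sum_(i <- r) phi (F i).
Proof.
move=> addf; have phi0 : phi 0 = 0 by rewrite -(subrr 0) addf subrr.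
have phiD x y : phi (x + y) = phi x + phi y.
  by rewrite -[y in LHS]opprK -[- y]sub0r addf addf phi0 sub0r opprK.
exact: (big_morph phi phiD phi0).
Qed.

(** Every label that occurs lies in Xi_D, so Psi keeps its symbol; the factor [vpow (d_of a)] undoes
    the normalization of [a]. *)
Lemma Psi_surj (s : Smod n d Fq) : exists k : Kalg M C, Psi d k = s.
Proof.
pose lab := labXX n (M d).
have labE : forall x y, orbXX x y = (lab x == lab y) := orbXXE hFq hM.
have [T iT ET] := standard_frame hFq hM.
pose A := undup (codom lab).
pose g a : Kmod n := if insub a is Some t
  then << (val_at lab s a * vpow (d_of a)) *g t >> else 0.
exists (\sum_(a <- A) g a); rewrite /Psi additive_fun_sum; last exact: lift_is_additive.
rewrite [RHS](of_labels_decomp labE s (undup_uniq (codom lab))); last first.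
  by move=> t; rewrite mem_undup codom_f.
apply: eq_big_seq => a; rewrite mem_undup => /codomP[[x x'] Ea].
have [h [c [c' [Ex Ex']]]] := bruhatXX hFq hM iT d_gt0 x x'.
have {}Ea : a = clabXX (val c, val c').
  by rewrite Ea /lab Ex Ex' labXX_inv realXX.
have ta : is_tXi a by rewrite Ea is_tXi_label.
have XiDa : XiD d a by rewrite Ea XiD_label.
rewrite /g insubT liftU /= XiDa -scalerA; congr (_ *: _).
apply: (val_at_ext labE) => t; rewrite val_atZ /brS.
apply: etrans (congr1 (fun z => vpow (d_of a) * z) (val_at_of_labels labE
  (fun b => if b == a then vpow (- d_of a) else 0) t)) _.
apply: etrans _ (esym (val_at_of_labels labE (fun b => (b == a)%:R) t)).
case: eqP => _; last by rewrite mulr0.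
by apply: val_inj; rewrite vpowD subrr.
Qed.

End Surjectivity.

Theorem proposition5p3p2 (n d : nat) (hn : (0 < n)%N) (hd : (0 < d)%N)
    (Fq : finFieldType) (hFq : 2%N \notin [pchar Fq])
    (M : forall e : nat, 'M[Fq]_(e + e)) (hM : forall e, max_isotropic (M e))
    (C : forall e : nat, generic_convolution n e) :
  ((d <= n)%N ->
    [/\ set_bij [set: Halg M C d] (End_alg (@actK n Fq M C d))
          (@ractH n Fq M C d),
        forall (c : Lau) (h h' : Halg M C d) (x : Vmod n (M d)),
          ractH (c *: h + h') x = c *: ractH h x + ractH h' x
      & forall (h h' : Halg M C d) (x : Vmod n (M d)),
          ractH (nu_mul h h') x = ractH h' (ractH h x)]) /\
  range (@actK n Fq M C d) = End_alg (@ractH n Fq M C d).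
Proof.
(* [models] supplies the identities between structure constants, [Mo] the realization of the labels
   over the given field. *)
have models p (pp : prime p) (op : odd p) := flag_generic_model hd (C d) pp op.
have [T iT ET] := standard_frame hFq (hM d).
have Mo := flag_model n hFq (hM d) iT ET hd.
have EXX : forall s t, orbXX s t = (labXX n (M d) s == labXX n (M d) t) :=
  orbXXE hFq (hM d).
have EXY : forall s t, orbXY s t = (labXY n (M d) s == labXY n (M d) t) :=
  orbXYE hFq (hM d).
have EYY : forall s t, orbYY s t = (labYY (M d) s == labYY (M d) t) :=
  orbYYE hFq (hM d).
have sv_def s x : actS (M d) (C d) s x = gconv (labXX n (M d)) (labXY n (M d)) (labXY n (M d)) (cSV (C d)) s x by [].
have vh_def x h : actH (M d) (C d) x h = gconv (labXY n (M d)) (labYY (M d)) (labXY n (M d)) (cVH (C d)) x h by [].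
have hh_def h h' : mulH (M d) (C d) h h' = gconv (labYY (M d)) (labYY (M d)) (labYY (M d)) (cH (C d)) h h' by [].
have comm := sv_vh models Mo EXY sv_def vh_def.
have svL := svDr Mo EXY sv_def.
have vhL := vhDl Mo EXY vh_def.
split=> [dn|].
  split.
  - split.
    + move=> h _; split; first by move=> c x y; apply: vhL.
      by move=> k x; apply: comm.
    + move=> h h' _ _ E; apply: (vh_eta_inj (@clabXY_coarsen n d) models Mo EXY EYY
        vh_def (full_separating hd dn)).
      exact: (congr1 (fun phi => phi _) E).
    + move=> phi [lin com]; have [|h Eh] := centralizer_S (@clabXY_coarsen n d) models Mo EXX EXY EYY sv_def vh_def (full_separating hd dn) lin.
        (* By surjectivity of Psi, commuting with K is commuting with S. *)
        move=> s x; have [k <-] := Psi_surj hFq hd (hM d) C s; exact: com.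
      by exists h => //; apply/funext => x; rewrite Eh.
  - by move=> c h h' x; apply: (vhDr Mo EXY vh_def).
  - by move=> h h' x; apply/esym/(vh_hh models Mo EXY EYY vh_def hh_def).
apply/seteqP; split=> [_ [k _ <-]|phi [lin com]].
  by split; [move=> c x y; apply: svL|move=> h x; apply/esym/comm].
have [s Es] := centralizer_H (@clabXY_coarsen n d) (@coarsen_ref n d hd) models Mo EXX EXY EYY sv_def vh_def lin com.
have [k Ek] := Psi_surj hFq hd (hM d) C s.
by exists k => //; apply/funext => x; rewrite Es -Ek.
Qed.
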